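(* Let $0<R_1<R_2$, $T>0$, $n\in\{2,3\}$, $p\in[1,\infty]$ with conjugate exponent $p'$. Assume - $u\in W^{1,1}\big((0,T);W^{2,p}(R_1,R_2)\big)$, $\tilde f\in C^1\big([0,T];L^p(R_1,R_2)\big)$, $g\in C([0,T];\mathbb R)$, $\lambda\in L^{p'}(R_1,R_2)$; - $\displaystyle\int_{R_1}^{R_2}\lambda(r)\,dr\neq0$; - there is $m>0$ with $|D_ru(0,r)|\ge m$ for all $r\in[R_1,R_2]$; - $\displaystyle\kappa_1:=\int_{R_1}^{R_2}\lambda(\rho)\exp\Big(\int_\rho^{R_1}\alpha(s)\,ds\Big)d\rho\neq0$, where $\displaystyle\alpha(r)=\frac{D_r^2u(0,r)+(n-1)r^{-1}D_ru(0,r)}{D_ru(0,r)}$. Then the problem of finding $k$ such that $$\int_0^t\big\{D_rk(t-s,r)\,D_tD_ru(s,r)+k(t-s,r)\big[D_tD_r^2u(s,r)+(n-1)r^{-1}D_tD_ru(s,r)\big]\big\}ds$$ $$+\,D_rk(t,r)\,D_ru(0,r)+k(t,r)\big[D_r^2u(0,r)+(n-1)r^{-1}D_ru(0,r)\big]=D_t\tilde f(t,r),\qquad (t,r)\in[0,T]\times[R_1,R_2],$$ $$\int_{R_1}^{R_2}\lambda(r)k(t,r)\,dr=g(t),\qquad t\in[0,T],$$ admits a unique solution $k\in C\big([0,T];W^{1,p}(R_1,R_2)\big)$, continuously depending on $(u,\tilde f,g)$ with respect to the norms of the spaces $W^{1,1}((0,T);W^{2,p}(R_1,R_2))$, $C^1([0,T];L^p(R_1,R_2))$,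 $C([0,T];\mathbb R)$.
   Context: The functions $u,\tilde f,g,\lambda$ are given data and $k$ is the unknown. The first equation is understood, for each $t\in[0,T]$, as an equality in $L^p(R_1,R_2)$ (i.e. for almost every $r$). $D_t$ and $D_r$ denote derivatives in $t$ and $r$. *)

(* Defs.v *)
From HB Require Import structures.
From mathcomp Require Import all_boot all_order all_algebra.
From mathcomp Require Import all_classical all_reals all_analysis.

Set Implicit Arguments.
Unset Strict Implicit.
Unset Printing Implicit Defensive.

Import Order.TTheory GRing.Theory Num.Theory.
Import numFieldNormedType.Exports.

Local Open Scope classical_set_scope.
Local Open Scope ring_scope.

Notation leb := (@lebesgue_measure _).

(* Elements of the Banach spaces below (classes of functions of r) are
   represented by functions R -> R, and functions of (t, r) by R -> R -> R, the
   first argument being t.  Two representatives stand for the same element of a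
   space X when their difference has X-norm 0.  Derivatives and integrals that
   are only determined up to this equality are picked with xget. *)

Section spaces.
Context {R : realType}.
Implicit Types (a b t T : R) (p : \bar R) (f g : R -> R) (u v k : R -> R -> R).

Record fspace := FSpace {
  fmem : set (R -> R) ;
  fnorm : (R -> R) -> \bar R }.
Implicit Types (X : fspace).

(** Lebesgue and Sobolev spaces on the bounded interval ]a, b[ *)

Definition Lp a b p : fspace := FSpace
  [set f | (f \_ `]a, b[) \in Lfun leb p]
  (fun f => 'N[leb]_p[EFin \o (f \_ `]a, b[)]%E).

(* C_c^oo(]a, b[) *)
Definition test_fun a b (phi : R -> R) :=
  (forall j x, derivable (derive1n j phi) x 1) /\
  exists c d, [/\ a < c, d < b & forall x, x \notin `[c, d] -> phi x = 0].

Definition is_weak_deriv a b (j : nat) f g :=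
  locally_integrable `]a, b[ g /\
  forall phi, test_fun a b phi ->
    \int[leb]_(x in `]a, b[) (f x * derive1n j phi x) =
    (-1) ^+ j * \int[leb]_(x in `]a, b[) (g x * phi x).

Definition Dr a b j f : R -> R :=
  xget (cst 0) [set g | is_weak_deriv a b j f g].

(* W^{l, p}(]a, b[) *)
Definition Wlp a b l p : fspace := FSpace
  [set f | fmem (Lp a b p) f /\ forall j, (j <= l)%N ->
             exists2 g, fmem (Lp a b p) g & is_weak_deriv a b j f g]
  (fun f => \sum_(j < l.+1) fnorm (Lp a b p) (Dr a b j f))%E.

(* the representative that is continuous on [a, b] *)
Definition rcont a b f : R -> R :=
  xget (cst 0) [set g | {within `[a, b], continuous g} /\
    {ae leb, forall r : R, r \in `]a, b[ -> g r = f r}].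

(** Bochner integral with respect to t, for X-valued functions *)

Record simple_fun X := SimpleFun {
  slen : nat ;
  sset : nat -> set R ;
  sval : nat -> R -> R ;
  measurable_sset : forall i, measurable (sset i) ;
  mem_sval : forall i, fmem X (sval i) }.

Definition simple_eval X (s : simple_fun X) t : R -> R :=
  fun r => \sum_(i < slen s) \1_(sset s i) t * sval s i r.

Definition simple_int X (I : set R) (s : simple_fun X) : R -> R :=
  fun r => \sum_(i < slen s) fine (leb (sset s i `&` I)) * sval s i r.

Definition strongly_measurable X (I : set R) v :=
  exists s : nat -> simple_fun X, {ae leb, forall t, I t ->
    fmem X (v t) /\
    fnorm X (v t \- simple_eval (s i) t) @[i --> \oo] --> 0%E}.

(* the integral of a nonnegative function is defined as a supremum of integrals
   of Borel simple functions below it, so it has the expected value on the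
   Lebesgue measurable functions t |-> ||v t|| met here *)
Definition L1norm X (I : set R) v : \bar R :=
  (\int[leb]_(t in I) fnorm X (v t))%E.

(* L^1(I; X) *)
Definition L1 X (I : set R) v :=
  strongly_measurable X I v /\ (L1norm X I v < +oo)%E.

Definition is_bochner_int X (I : set R) v (w : R -> R) :=
  [/\ L1 X I v, fmem X w & exists s : nat -> simple_fun X,
    L1norm X I (fun t => v t \- simple_eval (s i) t) @[i --> \oo] --> 0%E /\
    fnorm X (w \- simple_int I (s i)) @[i --> \oo] --> 0%E].

Definition bochner_int X (I : set R) v : R -> R :=
  xget (cst 0) [set w | is_bochner_int X I v w].

(** W^{1,1}(]0, T[; X) *)

Definition is_weak_Dt X T u v :=
  L1 X `]0, T[ v /\
  forall phi, test_fun 0 T phi ->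
    fnorm X (bochner_int X `]0, T[ (fun t r => derive1 phi t * u t r) \+
             bochner_int X `]0, T[ (fun t r => phi t * v t r)) = 0%E.

Definition weak_Dt X T u : R -> R -> R :=
  xget (fun=> cst 0) [set v | is_weak_Dt X T u v].

Definition W11 X T u := L1 X `]0, T[ u /\ exists v, is_weak_Dt X T u v.

Definition W11norm X T u : \bar R :=
  (L1norm X `]0%R, T[ u + L1norm X `]0%R, T[ (weak_Dt X T u))%E.

(** C([0, T]; X) and C^1([0, T]; X) *)

Definition C0 X T k := forall t : R, t \in `[0, T] ->
  fmem X (k t) /\
  fnorm X (k s \- k t) @[s --> within `[0, T] (nbhs t)] --> 0%E.

Definition C0norm X T k : \bar R :=
  ereal_sup [set fnorm X (k t) | t in `[0, T]].

(* one-sided at 0 and T *)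
Definition is_Dt X T v v' := forall t : R, t \in `[0, T] ->
  fmem X (v' t) /\
  fnorm X (fun r => (s - t)^-1 * (v s r - v t r) - v' t r)
    @[s --> within `[0, T] t^'] --> 0%E.

Definition strong_Dt X T v : R -> R -> R :=
  xget (fun=> cst 0) [set v' | is_Dt X T v v'].

Definition C1 X T v := C0 X T v /\ exists v', is_Dt X T v v' /\ C0 X T v'.

Definition C1norm X T v : \bar R :=
  (C0norm X T v + C0norm X T (strong_Dt X T v))%E.

(* the representative in C([0, T]; X) of an element of W^{1,1}(]0, T[; X) *)
Definition tcont X T u : R -> R -> R :=
  xget (fun=> cst 0) [set v | C0 X T v /\
    {ae leb, forall t : R, t \in `]0, T[ -> fnorm X (v t \- u t) = 0%E}].

End spaces.

Section problem.
Context {R : realType}.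
Variables (R1 R2 T : R) (n : nat) (p : \bar R).
Implicit Types (u f k : R -> R -> R) (g lambda v : R -> R).

Local Notation Dr j := (Dr R1 R2 j).
Local Notation Lp p := (Lp R1 R2 p).
Local Notation W l := (Wlp R1 R2 l p).

(* u(0, .), read on the representative continuous in t *)
Definition u0 u : R -> R := tcont (W 2) T u 0.

(* D_t D_r^j u, the derivative in t of D_r^j u : ]0, T[ -> L^p *)
Definition DtDr j u : R -> R -> R := weak_Dt (Lp p) T (fun t => Dr j (u t)).

(* D_r^2 v + (n - 1) r^-1 D_r v, from the two derivatives v1, v2 of v *)
Definition radial (v1 v2 : R -> R) : R -> R :=
  fun r => v2 r + (n%:R - 1) * r^-1 * v1 r.

Definition alpha u : R -> R :=
  fun r => radial (Dr 1 (u0 u)) (Dr 2 (u0 u)) r / Dr 1 (u0 u) r.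

(* the exponent is the integral of alpha from rho to R1 (R1 < rho) *)
Definition kappa1 lambda u : R :=
  \int[leb]_(rho in `]R1, R2[)
    (lambda rho * expR (- \int[leb]_(s in `]R1, rho[) alpha u s)).

Definition admissible lambda u f g :=
  [/\ W11 (W 2) T u, C1 (Lp p) T f, {within `[0, T], continuous g},
      (exists2 m : R, 0 < m & forall r : R, r \in `[R1, R2] ->
         m <= `|rcont R1 R2 (Dr 1 (u0 u)) r|)
    & kappa1 lambda u != 0].

Definition convolution u k t : R -> R :=
  bochner_int (Lp p) `]0, t[ (fun s r =>
    Dr 1 (k (t - s)) r * DtDr 1 u s r +
    k (t - s) r * radial (DtDr 1 u s) (DtDr 2 u s) r).

Definition is_solution lambda u f g k :=
  [/\ C0 (W 1) T k,
      (forall t : R, t \in `[0, T] ->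
         {ae leb, forall r : R, r \in `]R1, R2[ ->
           convolution u k t r
           + Dr 1 (k t) r * Dr 1 (u0 u) r
           + k t r * radial (Dr 1 (u0 u)) (Dr 2 (u0 u)) r
           = strong_Dt (Lp p) T f t r})
    & (forall t : R, t \in `[0, T] ->
         \int[leb]_(r in `]R1, R2[) (lambda r * k t r) = g t)].

(* continuity at (u, f, g) of the solution map, defined on admissible data *)
Definition continuous_dependence lambda u f g :=
  forall eps : R, 0 < eps -> exists2 delta : R, 0 < delta &
  forall u' f' g', admissible lambda u' f' g' ->
    (W11norm (W 2) T (fun t => u' t \- u t)%R < delta%:E)%E ->
    (C1norm (Lp p) T (fun t => f' t \- f t)%R < delta%:E)%E ->
    (forall t : R, t \in `[0, T] -> `|g' t - g t| < delta) ->
  forall k k', is_solution lambda u f g k -> is_solution lambda u' f' g' k' ->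
    (C0norm (W 1) T (fun t => k' t \- k t)%R < eps%:E)%E.

End problem.

(* Main.v *)
(** At a fixed time, moving the convolution to the right-hand side leaves the
    linear first order equation k' a + k b = H in r, where a = D_r u(0, .) is
    bounded away from 0. The integrating factor exp(int alpha) solves it up to a
    constant, which the condition int lambda k = g determines because kappa_1 is
    not 0; this gives a bounded solution operator from L^p x R to W^{1,p}. The
    convolution is bilinear and bounded by the integral of |k(t - s)| |D_t u(s)|
    over ]0, t[, since W^{1,p} embeds in L^infinity. For the norms weighted by
    exp(- omega t) it is therefore a contraction when omega is large, so Picard
    iteration gives existence and an a priori estimate. That estimate gives
    uniqueness and, applied to the difference of two solutions, the continuous
    dependence; here u(0, .) is controlled by the trace estimate for
    W^{1,1}(]0, T[; W^{2,p}). *)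

From HB Require Import structures.
Require Import Defs.
From mathcomp Require Import all_boot all_order all_algebra.
From mathcomp Require Import all_classical all_reals all_analysis.
From mathcomp Require Import measurable_realfun ess_sup_inf.
From mathcomp Require Import ring lra.

Set Implicit Arguments.
Unset Strict Implicit.
Unset Printing Implicit Defensive.

Import Order.TTheory GRing.Theory Num.Theory.
Import numFieldNormedType.Exports.
Import HBNNSimple.

Local Open Scope classical_set_scope.
Local Open Scope ring_scope.

(** * Integrals of real functions *)

(** Elements of the spaces are representatives, and [Dr], [weak_Dt], [bochner_int], [tcont] and
    [strong_Dt] are choices, so linearity and uniqueness hold only up to norm 0. The analysis is
    therefore done in complete seminormed spaces ([banach]), with operators linear up to norm 0
    ([bop]) and a relational Bochner integral ([BI]), to which the chosen objects are then compared.
    D_t D_r^j u is defined in L^p, whereas the estimates concern the W^{2,p}-valued D_t u. The two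
    are linked because bounded operators commute with the Bochner integral and weak time derivatives
    are unique; this uniqueness rests on a vector-valued fundamental lemma, proved with Borel sets
    instead of duality. The contraction factor is 1/2: the weighted mass of |D_t u| tends to 0 as
    omega grows, by dominated convergence. For continuous dependence the perturbed solution is
    inserted in the unperturbed equation, so that only the constants of the unperturbed problem
    occur. The source then contains the perturbed solution itself; this part is a small multiple of
    the unknown difference, absorbed by iterating the bound. *)

Notation intg D f := (leb.-integrable D (EFin \o f)).

Section real_integral.
Context {R : realType}.
Implicit Types (D I : set R) (f g h m : R -> R).

Lemma aeS (P Q : R -> Prop) : (forall t, P t -> Q t) ->
  {ae leb, forall t : R, P t} -> {ae leb, forall t : R, Q t}.
Proof. by move=> PQ; apply: (@filterS _ _ (ae_filter_ringOfSetsType _)) => t /PQ. Qed.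

Lemma aeS2 (P Q S : R -> Prop) : (forall t, P t -> Q t -> S t) ->
  {ae leb, forall t : R, P t} -> {ae leb, forall t : R, Q t} ->
  {ae leb, forall t : R, S t}.
Proof. by move=> PQ; move=> h; apply: (@filterS2 _ _ (ae_filter_ringOfSetsType _) _ _ _ _ h) => t /PQ; apply. Qed.

Lemma aeS3 (P Q S U : R -> Prop) : (forall t, P t -> Q t -> S t -> U t) ->
  {ae leb, forall t : R, P t} -> {ae leb, forall t : R, Q t} ->
  {ae leb, forall t : R, S t} -> {ae leb, forall t : R, U t}.
Proof. by move=> PQ; move=> h k; apply: (@filterS3 _ _ (ae_filter_ringOfSetsType _) _ _ _ _ _ h k) => t /PQ; apply. Qed.

Lemma measurable_intg D f : intg D f -> measurable_fun D f.
Proof. by move=> /integrableP[/measurable_EFinP]. Qed.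

Lemma intg_le_ae D f g : measurable D -> measurable_fun D f -> intg D g ->
  {ae leb, forall t, D t -> `|f t| <= g t} -> intg D f.
Proof.
move=> mD mf ig fg; apply/integrableP; split; first exact/measurable_EFinP.
have /integrableP[mg] := ig; apply: le_lt_trans.
apply: ae_ge0_le_integral => //.
- by apply/measurableT_comp => //; exact/measurable_EFinP.
- exact: measurableT_comp.
- by apply: aeS fg => t fgt Dt /=; rewrite lee_fin (le_trans (fgt Dt))// ler_norm.
Qed.

Lemma intgD D f g : measurable D -> intg D f -> intg D g -> intg D (f \+ g).
Proof. by move=> mD If Ig; have := @integrableD _ _ _ leb _ mD _ _ If Ig. Qed.

Lemma intgB D f g : measurable D -> intg D f -> intg D g -> intg D (f \- g).
Proof. by move=> mD If Ig; have := @integrableB _ _ _ leb _ mD _ _ If Ig. Qed.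

Lemma intgZ D f c : measurable D -> intg D f -> intg D (fun t => c * f t).
Proof. by move=> mD If; have := @integrableZl _ _ _ leb _ mD c _ If. Qed.

Lemma intg_cst I c : measurable I -> (leb I < +oo)%E -> intg I (cst c).
Proof.
move=> mI Ioo; apply: measurable_bounded_integrable => //.
by exists `|c|; split => // M cM x _ /=; exact: ltW.
Qed.

Lemma Rintegral_ae_eq D f g : measurable D -> measurable_fun D f ->
  measurable_fun D g -> {ae leb, forall t, D t -> f t = g t} ->
  \int[leb]_(t in D) f t = \int[leb]_(t in D) g t.
Proof.
move=> mD mf mg fg; rewrite /Rintegral; congr fine.
apply: ae_eq_integral => //; try exact/measurable_EFinP.
by apply: aeS fg => t fgt Dt; rewrite fgt.
Qed.

Lemma Rintegral_ge0_ae D f : measurable D -> intg D f ->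
  {ae leb, forall t, D t -> 0 <= f t} -> 0 <= \int[leb]_(t in D) f t.
Proof.
move=> mD If f0.
rewrite (_ : Rintegral _ _ _ = \int[leb]_(t in D) `|f t|).
  by apply: Rintegral_ge0 => t _.
apply: Rintegral_ae_eq => //; first exact: measurable_intg.
  by apply: measurableT_comp => //; exact: measurable_intg.
by apply: aeS f0 => t ft Dt; rewrite ger0_norm// ft.
Qed.

Lemma le_Rintegral_ae D f g : measurable D -> intg D f -> intg D g ->
  {ae leb, forall t, D t -> f t <= g t} ->
  \int[leb]_(t in D) f t <= \int[leb]_(t in D) g t.
Proof.
move=> mD If Ig fg; rewrite -subr_ge0 -RintegralB//.
apply: Rintegral_ge0_ae => //; first exact: intgB.
by apply: aeS fg => t fgt Dt; rewrite subr_ge0 fgt.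
Qed.

Lemma le_norm_Rintegral_ae D f g : measurable D -> intg D f -> intg D g ->
  {ae leb, forall t, D t -> `|f t| <= g t} ->
  `|\int[leb]_(t in D) f t| <= \int[leb]_(t in D) g t.
Proof.
move=> mD If Ig fg; apply: (le_trans (@le_normr_Rintegral _ _ _ leb _ _ mD If)).
by apply: le_Rintegral_ae => //; exact: integrable_norm.
Qed.

Lemma ge0_integral_Rintegral D f : measurable D -> intg D f ->
  (\int[leb]_(t in D) (f t)%:E = (\int[leb]_(t in D) f t)%:E)%E.
Proof. by move=> mD If; rewrite fineK//; exact: integrable_fin_num. Qed.

Lemma intgM D f g K : measurable D -> measurable_fun D f -> intg D g ->
  {ae leb, forall t, D t -> `|f t| <= K} -> intg D (fun t => f t * g t).
Proof.
move=> mD mf Ig fK; apply: (intg_le_ae (g := fun t => K * `|g t|)) => //.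
- by apply: measurable_funM => //; exact: measurable_intg.
- by apply: intgZ => //; exact: (integrable_norm Ig).
- apply: aeS fK => t fKt Dt; rewrite normrM ler_wpM2r// fKt//.
Qed.

(** No measurability of [f] or [g] is assumed. The integral is a supremum over simple functions
    below the integrand, and such a function falls below [g], with the same integral, once
    multiplied by the indicator of the complement of the null set [N]. The intended integrand is t
    -> ||v t||, only known to agree almost everywhere with a measurable function. *)
Lemma le_integral_lower D (f g : R -> \bar R) : measurable D ->
  (forall t, 0 <= f t)%E -> (forall t, 0 <= g t)%E ->
  {ae leb, forall t, D t -> (f t <= g t)%E} ->
  (\int[leb]_(t in D) f t <= \int[leb]_(t in D) g t)%E.
Proof.
move=> mD f0 g0 [N [mN N0 fgN]].
rewrite integral_mkcond [leRHS]integral_mkcond.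
rewrite !ge0_integralTE; [|by move=> t; apply: erestrict_ge0..].
apply: ge_ereal_sup => _ [h hf <-].
pose h1 := mul_nnsfun h (indic_nnsfun R (measurableC mN)).
have -> : sintegral leb h = sintegral leb h1.
  rewrite -!integralT_nnsfun; apply: ae_eq_integral => //; try exact/measurable_EFinP.
  exists N; split => // t /= /not_implyP[_ ht].
  apply: contrapT => Nt; apply: ht; congr EFin.
  by rewrite /= /mindic indicE mem_set// mulr1.
apply: ereal_sup_ubound; exists h1 => //= t.
rewrite /mindic indicE; have [tN|tN] := boolP (t \in ~` N); last first.
  by rewrite mulr0; apply: erestrict_ge0.
rewrite mulr1 (le_trans (hf t))// !patchE; case: ifPn => // tD.
apply: contrapT => fg; move: tN; rewrite inE => /=; apply; apply: fgN => /=.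
by apply: contra_not fg; apply; rewrite inE in tD.
Qed.

Lemma L1norm_Rintegral D (f : R -> \bar R) g : measurable D ->
  (forall t, 0 <= f t)%E -> intg D g ->
  {ae leb, forall t, D t -> f t = (g t)%:E} ->
  (\int[leb]_(t in D) f t = (\int[leb]_(t in D) g t)%:E)%E.
Proof.
move=> mD f0 Ig fg.
rewrite -ge0_integral_Rintegral// (_ : (\int[leb]_(t in D) (g t)%:E)%E =
  (\int[leb]_(t in D) `|(g t)%:E|)%E).
  by apply/eqP; rewrite eq_le; apply/andP; split; apply: le_integral_lower => //;
    apply: aeS fg => t + Dt => /(_ Dt) <-; rewrite gee0_abs.
apply: ae_eq_integral => //.
- exact: measurable_int Ig.
- by apply: measurableT_comp => //; exact: measurable_int Ig.
- by apply: aeS fg => t + Dt => /(_ Dt) <-; rewrite gee0_abs.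
Qed.

Lemma le_L1norm_Rintegral D (f : R -> \bar R) g : measurable D ->
  (forall t, 0 <= f t)%E -> intg D g ->
  {ae leb, forall t, D t -> (f t <= (g t)%:E)%E} ->
  (\int[leb]_(t in D) f t <= (\int[leb]_(t in D) g t)%:E)%E.
Proof.
move=> mD f0 Ig fg.
rewrite -(@L1norm_Rintegral D (fun t => `|(g t)%:E|)%E g)//.
  apply: le_integral_lower => //; apply: aeS fg => t + Dt => /(_ Dt) fg.
  by rewrite (le_trans fg)// lee_fin ler_norm.
by apply: aeS fg => t + Dt => /(_ Dt) fg; rewrite gee0_abs// (le_trans (f0 t)).
Qed.

Lemma cvg_Rintegral_dominated D (F : nat -> R -> R) f g : measurable D ->
  (forall i, measurable_fun D (F i)) -> measurable_fun D f -> intg D g ->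
  {ae leb, forall t, D t -> F i t @[i --> \oo] --> f t} ->
  {ae leb, forall t, D t -> forall i, `|F i t| <= g t} ->
  [/\ intg D f, \int[leb]_(t in D) F i t @[i --> \oo] --> \int[leb]_(t in D) f t &
  \int[leb]_(t in D) `|F i t - f t| @[i --> \oo] --> 0].
Proof.
move=> mD mF mf Ig Ff Fg.
have h1 : {ae leb, forall t, D t -> (EFin \o F i) t @[i --> \oo] --> (EFin \o f) t}.
  by apply: aeS Ff => t Fft Dt; apply: cvg_comp (Fft Dt) _.
have h2 : {ae leb, forall t i, D t -> (`|(EFin \o F i) t| <= (EFin \o g) t)%E}.
  by apply: aeS Fg => t Fgt i Dt /=; rewrite lee_fin Fgt.
have mF' i : measurable_fun D (EFin \o F i) by exact/measurable_EFinP.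
have mf' : measurable_fun D (EFin \o f) by exact/measurable_EFinP.
have [If c0 c1] := @dominated_convergence _ _ _ leb D mD (fun i => EFin \o F i)
  (EFin \o f) (EFin \o g) mF' mf' h1 Ig h2.
have IF i : intg D (F i).
  by apply: intg_le_ae Ig _ => //; apply: aeS Fg => t Fgt Dt; exact: Fgt.
split => //.
- apply: fine_cvg; rewrite -ge0_integral_Rintegral//; exact: c1.
- exact: fine_cvg c0.
Qed.

Lemma Rintegral_abs_continuous D f : measurable D -> intg D f ->
  forall e, 0 < e -> exists2 d, 0 < d & forall A, measurable A -> A `<=` D ->
  (leb A < d%:E)%E -> \int[leb]_(t in A) `|f t| < e.
Proof.
move=> mD If e e0.
have If' : intg setT (f \_ D).
  by rewrite -restrict_EFin; apply/(@integrable_mkcond _ _ _ leb D _ mD).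
have [d [d0 hd]] := @integral_normr_continuous _ _ _ leb _ If' _ e0.
exists d => // A mA AD Ad; rewrite (le_lt_trans _ (hd A mA Ad))//.
rewrite le_eqVlt; apply/orP; left; apply/eqP/eq_Rintegral => x; rewrite inE => Ax.
by rewrite patchE mem_set//; exact: AD.
Qed.

(** By monotone convergence the sum has integral at most 2, hence is finite almost everywhere.
    Errors of size 2^-i thus yield convergence almost everywhere, both for Bochner approximants and
    in the completeness of L^p. *)
Lemma summable_ae D (m : nat -> R -> R) : measurable D ->
  (forall i, intg D (m i)) -> (forall i t, 0 <= m i t) ->
  (forall i, \int[leb]_(t in D) m i t <= 2 ^- i) ->
  {ae leb, forall t, D t -> cvgn (series (fun i => m i t))}.
Proof.
move=> mD Im m0 mi.
have mm i : measurable_fun D (EFin \o m i) by exact: measurable_int (Im i).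
pose S t := (\sum_(0 <= i <oo) (EFin \o m i) t)%E.
have mS : measurable_fun D S.
  by apply: ge0_emeasurable_sum => // i t _ _; rewrite lee_fin.
have S0 t : (0 <= S t)%E by apply: nneseries_ge0 => i _ _; rewrite lee_fin.
have IS : leb.-integrable D S.
  apply/integrableP; split => //.
  rewrite (_ : (\int[leb]_(t in D) `|S t|)%E = (\int[leb]_(t in D) S t)%E); last first.
    by apply: eq_integral => t _; rewrite gee0_abs.
  rewrite /S integral_nneseries//; last by move=> i t _; rewrite lee_fin.
  have I0 i : (0 <= \int[leb]_(t in D) (EFin \o m i) t)%E.
    by apply: integral_ge0 => t _; rewrite lee_fin.
  apply: (@le_lt_trans _ _ (2%:E)); last exact: ltry.
  apply: lime_le; first by apply: is_cvg_nneseries.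
  apply: nearW => n; apply: (@le_trans _ _ (\sum_(0 <= i < n) (2 ^- i)%:E)%E).
    by apply: lee_sum => i _; rewrite /comp ge0_integral_Rintegral// lee_fin.
  rewrite sumEFin lee_fin.
  suff -> : \sum_(0 <= i < n) (2 ^- i : R) = 2 - 2 * 2 ^- n.
    by rewrite gerBl mulr_ge0.
  elim: n => [|n ih]; first by rewrite big_geq// expr0 invr1 mulr1 subrr.
  by rewrite big_nat_recr//= ih exprS invfM; lra.
have := @integrable_ae _ _ _ leb D mD _ IS; apply: aeS => t St Dt.
have {}St := St Dt.
apply: nondecreasing_is_cvgn.
  by apply/nondecreasing_seqP => n; rewrite seriesSr lerDl.
exists (fine (S t)) => _ [n _ <-].
rewrite -lee_fin fineK// /series/= -sumEFin.
by apply: (@nneseries_lim_ge _ (fun i => (m i t)%:E) xpredT) => i _; rewrite lee_fin.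
Qed.

End real_integral.

(** * Banach spaces of functions and the Bochner integral *)

Lemma le_leb {R : realType} (A B : set R) : measurable A -> measurable B ->
  A `<=` B -> (leb A <= leb B)%E.
Proof. by move=> mA mB AB; apply: (@le_measure _ _ _ leb) => //; rewrite inE. Qed.

Section banach.
Context {R : realType}.
Implicit Types (X Y : fspace (R:=R)) (I J A : set R) (f g h w : R -> R) (c : R).

Definition nrm X f : R := fine (fnorm X f).

(** A complete seminormed space: [fnorm] may vanish on a nonzero representative. Nonnegativity is
    asked of every function, member or not, because norms are integrated over times at which
    membership may fail. *)
Record banach X : Prop := Banach {
  mem0 : fmem X (fun=> 0) ;
  memD : forall f g, fmem X f -> fmem X g -> fmem X (f \+ g) ;
  memZ : forall c f, fmem X f -> fmem X (fun r => c * f r) ;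
  fnorm_ge0 : forall f, (0 <= fnorm X f)%E ;
  fnorm_lty : forall f, fmem X f -> (fnorm X f < +oo)%E ;
  fnormD : forall f g, fmem X f -> fmem X g ->
    (fnorm X (f \+ g)%R <= fnorm X f + fnorm X g)%E ;
  fnormZ : forall c f, fmem X f ->
    fnorm X (fun r => c * f r) = (`|c|%:E * fnorm X f)%E ;
  fcomplete : forall f : nat -> R -> R, (forall i, fmem X (f i)) ->
    (forall e, 0 < e -> exists N, forall i j, (N <= i)%N -> (N <= j)%N ->
      nrm X (f i \- f j) <= e) ->
    exists2 w, fmem X w &
      forall e, 0 < e -> exists N, forall i, (N <= i)%N -> nrm X (f i \- w) <= e }.

Variables (X : fspace (R:=R)) (bX : banach X).
Local Notation N := (nrm X).
Local Notation mem := (fmem X).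

Lemma nrmE f : mem f -> fnorm X f = (N f)%:E.
Proof. by move=> mf; rewrite fineK// ge0_fin_numE ?fnorm_ge0 ?fnorm_lty. Qed.

Lemma nrm_ge0 f : 0 <= N f.
Proof. by rewrite fine_ge0 ?fnorm_ge0. Qed.

Lemma nrmD f g : mem f -> mem g -> N (f \+ g) <= N f + N g.
Proof.
by move=> mf mg; rewrite -lee_fin EFinD -!nrmE//; [exact: fnormD|exact: memD].
Qed.

Lemma nrmZ c f : mem f -> N (fun r => c * f r) = `|c| * N f.
Proof. by move=> mf; rewrite {1}/nrm fnormZ// fineM// nrmE. Qed.

Lemma subfunE f g : f \- g = f \+ (fun r => -1 * g r).
Proof. by apply/funext => r /=; rewrite mulN1r. Qed.

Lemma memB f g : mem f -> mem g -> mem (f \- g).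
Proof. by move=> mf mg; rewrite subfunE; apply: memD => //; exact: memZ. Qed.

Lemma nrmB f g : mem f -> mem g -> N (f \- g) <= N f + N g.
Proof.
move=> mf mg; rewrite subfunE (le_trans (nrmD _ _))//; first exact: memZ.
by rewrite nrmZ// normrN1 mul1r.
Qed.

Lemma nrmC f g : mem f -> mem g -> N (f \- g) = N (g \- f).
Proof.
move=> mf mg; rewrite (_ : g \- f = fun r => -1 * (f \- g) r).
  by rewrite nrmZ ?normrN1 ?mul1r//; exact: memB.
by apply/funext => r /=; rewrite mulN1r opprB.
Qed.

Lemma nrm0 : N (fun=> 0) = 0.
Proof.
rewrite (_ : (fun=> 0) = fun r => 0 * (fun=> 0) r); last by apply/funext => r; rewrite mul0r.
by rewrite nrmZ ?normr0 ?mul0r//; exact: mem0.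
Qed.

Lemma nrm_triangle g f h : mem f -> mem g -> mem h ->
  N (f \- h) <= N (f \- g) + N (g \- h).
Proof.
move=> mf mg mh; rewrite (_ : f \- h = (f \- g) \+ (g \- h)).
  by apply: nrmD; exact: memB.
by apply/funext => r /=; rewrite addrA subrK.
Qed.

Lemma nrm_le_sub f g : mem f -> mem g -> N f <= N (f \- g) + N g.
Proof.
move=> mf mg; rewrite [X in N X <= _](_ : f = (f \- g) \+ g).
  by apply: nrmD => //; exact: memB.
by apply/funext => r /=; rewrite subrK.
Qed.

Lemma nrm_dist f g : mem f -> mem g -> `|N f - N g| <= N (f \- g).
Proof.
move=> mf mg; rewrite ler_norml lerBlDr nrm_le_sub// andbT.
by rewrite lerNl opprB lerBlDr nrmC// nrm_le_sub.
Qed.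

Lemma nrm_eq f g : mem f -> mem g -> N (f \- g) = 0 -> N f = N g.
Proof.
move=> mf mg fg; apply/eqP; rewrite -subr_eq0 -normr_le0.
by rewrite (le_trans (nrm_dist mf mg))// fg.
Qed.

Lemma mem_sum n (F : 'I_n -> R -> R) : (forall i, mem (F i)) ->
  mem (fun r => \sum_(i < n) F i r).
Proof.
elim: n F => [|n ih] F mF.
  by rewrite (_ : (fun r => _) = fun=> 0)//; [exact: mem0|apply/funext => r; rewrite big_ord0].
rewrite (_ : (fun r => _) =
  (fun r => \sum_(i < n) F (widen_ord (leqnSn n) i) r) \+ F ord_max).
  by apply: memD => //; exact: ih.
by apply/funext => r; rewrite big_ord_recr.
Qed.

Lemma nrm_sum n (F : 'I_n -> R -> R) : (forall i, mem (F i)) ->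
  N (fun r => \sum_(i < n) F i r) <= \sum_(i < n) N (F i).
Proof.
elim: n F => [|n ih] F mF.
  rewrite (_ : (fun r => _) = fun=> 0) ?big_ord0 ?nrm0//.
  by apply/funext => r; rewrite big_ord0.
rewrite (_ : (fun r => _) =
  (fun r => \sum_(i < n) F (widen_ord (leqnSn n) i) r) \+ F ord_max).
  by rewrite big_ord_recr/= (le_trans (nrmD _ _)) ?lerD2r ?ih//; exact: mem_sum.
by apply/funext => r; rewrite big_ord_recr.
Qed.

Lemma mem_simple_eval (s : simple_fun X) t : mem (simple_eval s t).
Proof. by apply: mem_sum => i; apply: memZ => //; exact: mem_sval. Qed.

Lemma mem_simple_int I (s : simple_fun X) : mem (simple_int I s).
Proof. by apply: mem_sum => i; apply: memZ => //; exact: mem_sval. Qed.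

(* Norms of simple functions are handled by peeling off one indicator at a time,
   which splits the domain in two; the offset [w] makes the induction go through. *)
Section offset.
Variables (S : nat -> set R) (v : nat -> R -> R).
Hypotheses (mS : forall i, measurable (S i)) (mv : forall i, mem (v i)).

Definition offset_eval n w t : R -> R :=
  fun r => w r + \sum_(i < n) \1_(S i) t * v i r.

Lemma offset_evalS n w t : offset_eval n.+1 w t =
  if t \in S n then offset_eval n (w \+ v n) t else offset_eval n w t.
Proof.
rewrite /offset_eval; case: ifPn => tS; apply/funext => r; rewrite big_ord_recr/=.
  by rewrite indicE tS mul1r; lra.
by rewrite indicE (negbTE tS) mul0r addr0.
Qed.

Lemma measurable_offset n w : mem w ->
  measurable_fun setT (fun t => N (offset_eval n w t)).
Proof.
elim: n w => [|n ih] w mw.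
  rewrite (_ : (fun t => _) = cst (N w)); first exact: measurable_cst.
  apply/funext => t; congr N; apply/funext => r.
  by rewrite /offset_eval big_ord0 addr0.
rewrite (_ : (fun t => _) = fun t => \1_(S n) t * N (offset_eval n (w \+ v n) t) +
    \1_(~` S n) t * N (offset_eval n w t)).
  apply: measurable_funD; apply: measurable_funM.
  - exact: measurable_indic.
  - by apply: ih; exact: memD.
  - by apply: measurable_indic; exact: measurableC.
  - exact: ih.
apply/funext => t; rewrite offset_evalS !indicE in_setC.
by case: ifPn => tS /=; rewrite ?(mul1r,mul0r,addr0,add0r).
Qed.

Lemma nrm_offset_le n w t : mem w ->
  N (offset_eval n w t) <= N w + \sum_(i < n) N (v i).
Proof.
move=> mw; rewrite /offset_eval.
have mF (i : 'I_n) : mem (fun r => \1_(S i) t * v i r) by exact: memZ.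
rewrite (le_trans (nrmD mw (mem_sum mF)))// lerD2l (le_trans (nrm_sum mF))//.
apply: ler_sum => i _; rewrite nrmZ// ler_piMl ?nrm_ge0//.
by rewrite indicE; case: (_ \in _); rewrite ?normr1 ?normr0.
Qed.

Lemma intg_offset n w I : mem w -> measurable I -> (leb I < +oo)%E ->
  intg I (fun t => N (offset_eval n w t)).
Proof.
move=> mw mI Ioo.
apply: (intg_le_ae (g := cst (N w + \sum_(i < n) N (v i)))) => //.
- by apply: measurable_funTS; exact: measurable_offset.
- exact: intg_cst.
- apply: aeW => t It; rewrite ger0_norm ?nrm_ge0//; exact: nrm_offset_le.
Qed.

Lemma leb_split I i : measurable I -> (leb I < +oo)%E ->
  [/\ (leb (I `&` S i) < +oo)%E, (leb (I `\` S i) < +oo)%E &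
   forall A, measurable A -> fine (leb (A `&` I)) =
     fine (leb (A `&` (I `&` S i))) + fine (leb (A `&` (I `\` S i)))].
Proof.
move=> mI Ioo.
have h1 : (leb (I `&` S i) < +oo)%E.
  by apply: le_lt_trans Ioo; apply: le_leb => //; exact: measurableI.
have h2 : (leb (I `\` S i) < +oo)%E.
  by apply: le_lt_trans Ioo; apply: le_leb => //; exact: measurableD.
split => // A mA.
have mAI : measurable (A `&` I) by exact: measurableI.
have mI1 : measurable (I `&` S i) by exact: measurableI.
have mI2 : measurable (I `\` S i) by exact: measurableD.
rewrite -fineD; first last.
- rewrite ge0_fin_numE//; apply: le_lt_trans h2; apply: le_leb => //; exact: measurableI.
- rewrite ge0_fin_numE//; apply: le_lt_trans h1; apply: le_leb => //; exact: measurableI.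
congr fine; rewrite (@measureDI _ _ _ leb _ _ mAI (mS i)) addeC setIA; congr (_ + leb _)%E.
by rewrite setIDA.
Qed.

(** With [w = 0] this is the triangle inequality for the integral of a simple function. The sets
    [S i] may overlap, so there are no constant pieces to sum over directly; on the part of [I]
    inside [S n] the offset becomes [w + v n], outside it stays [w]. *)
Lemma nrm_offset_int n w I : mem w -> measurable I -> (leb I < +oo)%E ->
  N (fun r => fine (leb I) * w r + \sum_(i < n) fine (leb (S i `&` I)) * v i r) <=
  \int[leb]_(t in I) N (offset_eval n w t).
Proof.
elim: n w I => [|n ih] w I mw mI Ioo.
  rewrite (_ : (fun r => _) = fun r => fine (leb I) * w r); last first.
    by apply/funext => r; rewrite big_ord0 addr0.
  rewrite nrmZ// ger0_norm ?fine_ge0// mulrC -(@Rintegral_cst _ _ _ leb _ mI).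
  rewrite (@eq_Rintegral _ _ _ leb I (fun t => N (offset_eval 0 w t)))// => t _.
  congr N; apply/funext => r; by rewrite /offset_eval big_ord0 addr0.
have [I1oo I2oo IE] := leb_split n mI Ioo.
set I1 := I `&` S n in I1oo IE; set I2 := I `\` S n in I2oo IE.
have mI1 : measurable I1 by exact: measurableI.
have mI2 : measurable I2 by exact: measurableD.
have II : I = I1 `|` I2 by rewrite /I1 /I2 setUIDK.
have /ih/(_ mI1 I1oo) h1 := memD bX mw (mv n).
have := ih w I2 mw mI2 I2oo.
set F1 := (fun r => _) in h1; set F2 := (fun r => _) => h2.
have mF1 : mem F1.
  apply: (memD bX (f := fun r => fine (leb I1) * (w \+ v n) r)).
    by apply: memZ => //; exact: memD.
  by apply: mem_sum => i; exact: memZ.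
have mF2 : mem F2.
  apply: (memD bX (f := fun r => fine (leb I2) * w r)); first exact: memZ.
  by apply: mem_sum => i; exact: memZ.
rewrite [X in N X](_ : _ = F1 \+ F2).
  rewrite [X in Rintegral _ X]II (@Rintegral_setU _ _ _ leb _ _ _ mI1 mI2); last 2 first.
  - by rewrite -II; apply: intg_offset.
  - by apply/disj_setPS => t [[_ tS] [_ +]].
  rewrite (le_trans (nrmD mF1 mF2))// lerD//.
    rewrite (le_trans h1)// le_eqVlt; apply/orP; left; apply/eqP/eq_Rintegral => t.
    by rewrite inE => -[_ tS]; rewrite offset_evalS mem_set.
  rewrite (le_trans h2)// le_eqVlt; apply/orP; left; apply/eqP/eq_Rintegral => t.
  by rewrite inE => -[_ tS]; rewrite offset_evalS memNset.
apply/funext => r; rewrite big_ord_recr/= /F1 /F2.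
have := IE setT measurableT; rewrite !setTI => ->.
under eq_bigr do rewrite IE// mulrDl.
rewrite big_split/= (_ : S n `&` I = I1); last by rewrite setIC.
by lra.
Qed.

End offset.

End banach.

(** * The Bochner integral in epsilon form *)

Section bochner.
Context {R : realType}.
Implicit Types (X Y : fspace (R:=R)) (I J A : set R) (f g h w : R -> R) (c : R).
Implicit Types (v : R -> R -> R).

Section simple.
Variables (X : fspace (R:=R)) (bX : banach X).
Local Notation N := (nrm X).
Local Notation mem := (fmem X).
Implicit Types s : simple_fun X.

Lemma cvg_fnormP {T : Type} {F : set_system T} {FF : Filter F} (f : T -> R -> R) :
  (\forall x \near F, mem (f x)) ->
  fnorm X (f x) @[x --> F] --> 0%E <->
  (forall e, 0 < e -> \forall x \near F, N (f x) <= e).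
Proof.
move=> mf; split => [h e e0|h].
  have hf : (fine \o (fun x => fnorm X (f x))) x @[x --> F] --> 0 by exact: fine_cvg.
  have /cvgr0Pnorm_le/(_ e e0) := hf.
  by apply: filterS => x; rewrite ger0_norm// /comp; exact: nrm_ge0.
apply: cvg_EFin.
  by apply: filterS mf => x mfx; rewrite nrmE.
apply/cvgr0Pnorm_le => e e0; apply: filterS (h e e0) => x.
by rewrite ger0_norm//; exact: nrm_ge0.
Qed.

Lemma simple_evalE s t : simple_eval s t =
  offset_eval (sset s) (Defs.sval s) (slen s) (fun=> 0) t.
Proof. by apply/funext => r; rewrite /offset_eval add0r. Qed.

Lemma measurable_simple s : measurable_fun setT (fun t => N (simple_eval s t)).
Proof.
under eq_fun do rewrite simple_evalE.
by apply: measurable_offset => //; [exact: measurable_sset|exact: mem_sval|exact: mem0].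
Qed.

Lemma intg_simple I s : measurable I -> (leb I < +oo)%E ->
  intg I (fun t => N (simple_eval s t)).
Proof.
move=> mI Ioo; under eq_fun do rewrite simple_evalE.
by apply: intg_offset => //; [exact: measurable_sset|exact: mem_sval|exact: mem0].
Qed.

Lemma nrm_simple_int I s : measurable I -> (leb I < +oo)%E ->
  N (simple_int I s) <= \int[leb]_(t in I) N (simple_eval s t).
Proof.
move=> mI Ioo; under eq_Rintegral do rewrite simple_evalE.
have := @nrm_offset_int R X bX _ _ (measurable_sset s) (mem_sval s)
  (slen s) (fun=> 0) I (mem0 bX) mI Ioo.
by apply: le_trans; rewrite /simple_int; under [X in _ <= N X]eq_fun do rewrite mulr0 add0r.
Qed.

Lemma measurable_nth (S S' : nat -> set R) n i : (forall j, measurable (S j)) ->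
  (forall j, measurable (S' j)) ->
  measurable (if (i < n)%N then S i else S' (i - n)%N).
Proof. by case: ifP. Qed.

Lemma mem_nth_sum (F F' : nat -> R -> R) n i : (forall j, mem (F j)) ->
  (forall j, mem (F' j)) -> mem (if (i < n)%N then F i else F' (i - n)%N).
Proof. by case: ifP. Qed.

Definition sadd s s' : simple_fun X := SimpleFun (slen s + slen s')
  (fun i => measurable_nth (slen s) i (measurable_sset s) (measurable_sset s'))
  (fun i => mem_nth_sum (slen s) i (mem_sval s) (mem_sval s')).

Lemma sadd_eval s s' t : simple_eval (sadd s s') t = simple_eval s t \+ simple_eval s' t.
Proof.
apply/funext => r; rewrite /simple_eval/= big_split_ord/=; congr (_ + _).
  by apply: eq_bigr => i _; rewrite ltn_ord.
by apply: eq_bigr => i _; rewrite ltnNge leq_addr/= addKn.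
Qed.

Lemma sadd_int I s s' : simple_int I (sadd s s') = simple_int I s \+ simple_int I s'.
Proof.
apply/funext => r; rewrite /simple_int/= big_split_ord/=; congr (_ + _).
  by apply: eq_bigr => i _; rewrite ltn_ord.
by apply: eq_bigr => i _; rewrite ltnNge leq_addr/= addKn.
Qed.

Lemma mem_scale c (F : nat -> R -> R) i : (forall j, mem (F j)) -> mem (fun r => c * F i r).
Proof. by move=> mF; exact: memZ. Qed.

Definition sscale c s : simple_fun X := SimpleFun (slen s) (measurable_sset s)
  (fun i => mem_scale c i (mem_sval s)).

Lemma sscale_eval c s t : simple_eval (sscale c s) t = fun r => c * simple_eval s t r.
Proof.
by apply/funext => r; rewrite /simple_eval/= mulr_sumr; apply: eq_bigr => i _; rewrite mulrCA.
Qed.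

Lemma sscale_int I c s : simple_int I (sscale c s) = fun r => c * simple_int I s r.
Proof.
by apply/funext => r; rewrite /simple_int/= mulr_sumr; apply: eq_bigr => i _; rewrite mulrCA.
Qed.

Definition ssub s s' := sadd s (sscale (-1) s').

Lemma ssub_eval s s' t : simple_eval (ssub s s') t = simple_eval s t \- simple_eval s' t.
Proof. by rewrite /ssub sadd_eval sscale_eval -subfunE. Qed.

Lemma ssub_int I s s' : simple_int I (ssub s s') = simple_int I s \- simple_int I s'.
Proof. by rewrite /ssub sadd_int sscale_int -subfunE. Qed.

Lemma measurable_setIn (S : nat -> set R) A i : measurable A ->
  (forall j, measurable (S j)) -> measurable (S i `&` A).
Proof. by move=> mA mS; exact: measurableI. Qed.

Definition srestr A (mA : measurable A) s : simple_fun X :=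
  SimpleFun (slen s) (fun i => measurable_setIn i mA (measurable_sset s))
  (mem_sval s).

Lemma srestr_eval A (mA : measurable A) s t :
  simple_eval (srestr mA s) t = fun r => \1_A t * simple_eval s t r.
Proof.
apply/funext => r; rewrite /simple_eval/= mulr_sumr; apply: eq_bigr => i _.
by rewrite indicI /= mulrCA mulrA.
Qed.

Lemma srestr_int A (mA : measurable A) I s :
  simple_int I (srestr mA s) = simple_int (A `&` I) s.
Proof.
by apply/funext => r; rewrite /simple_int/=; apply: eq_bigr => i _; rewrite setIA.
Qed.

End simple.

Section BI.
Variables (X : fspace (R:=R)) (bX : banach X) (I : set R).
Hypotheses (mI : measurable I) (Ioo : (leb I < +oo)%E).
Local Notation N := (nrm X).
Local Notation mem := (fmem X).
Implicit Types (s : simple_fun X) (m : R -> R).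

Definition simple_approx v s m e := [/\ intg I m,
  {ae leb, forall t, I t -> N (v t \- simple_eval s t) <= m t} &
  \int[leb]_(t in I) m t <= e].

(* An epsilon form of is_bochner_int: the integral in L1norm is only additive on
   measurable functions, hence the integrable majorant [m] of the norms. *)
Definition BI v w := [/\ mem w, {ae leb, forall t, I t -> mem (v t)} &
  forall e, 0 < e -> exists s m, simple_approx v s m e /\ N (w \- simple_int I s) <= e].

Definition Bint v := exists w, BI v w.

Lemma simple_int_diff s s' m : intg I m ->
  {ae leb, forall t, I t -> N (simple_eval s t \- simple_eval s' t) <= m t} ->
  N (simple_int I s \- simple_int I s') <= \int[leb]_(t in I) m t.
Proof.
move=> Im hm; rewrite -ssub_int; apply: le_trans (nrm_simple_int _ _ mI Ioo) _ => //.
apply: le_Rintegral_ae => //; first exact: intg_simple.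
by apply: aeS hm => t; rewrite ssub_eval.
Qed.

(** The inequality is taken over from a simple approximant, with errors e/2 in the integrand and in
    the integral. A majorant [m] instead of the norm of [v] avoids asking that this norm be
    measurable. *)
Lemma BI_nrm_le v w m : BI v w -> intg I m ->
  {ae leb, forall t, I t -> N (v t) <= m t} -> N w <= \int[leb]_(t in I) m t.
Proof.
move=> [mw mv h] Im vm; apply/ler_addgt0Pr => e e0.
have [|s [m' [[Im' sm' m'e] ws]]] := h (e / 2); first by rewrite divr_gt0.
have msi := mem_simple_int bX I s.
have : N (simple_int I s) <= \int[leb]_(t in I) (m t + m' t).
  apply: le_trans (nrm_simple_int _ _ mI Ioo) _ => //.
  apply: le_Rintegral_ae => //; [exact: intg_simple|exact: intgD|].
  apply: aeS3 mv vm sm' => t mv vm sm' It.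
  have mse := mem_simple_eval bX s t.
  rewrite (le_trans (nrm_le_sub bX mse (mv It)))// addrC lerD//; first exact: vm.
  by rewrite nrmC//; [exact: sm'|exact: mv].
rewrite RintegralD// => h1.
have := nrm_le_sub bX mw msi.
by lra.
Qed.

Lemma BI_D v v' w w' : BI v w -> BI v' w' -> BI (fun t => v t \+ v' t) (w \+ w').
Proof.
move=> [mw mv h] [mw' mv' h']; split.
- exact: memD.
- by apply: aeS2 mv mv' => t mv mv' It; apply: memD => //; [exact: mv|exact: mv'].
move=> e e0.
have [|s [m [[Im sm me] ws]]] := h (e / 2); first by rewrite divr_gt0.
have [|s' [m' [[Im' sm' me'] ws']]] := h' (e / 2); first by rewrite divr_gt0.
have E (f g f' g' : R -> R) : (f \+ g) \- (f' \+ g') = (f \- f') \+ (g \- g').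
  by apply/funext => r /=; lra.
exists (sadd s s'), (m \+ m'); split; first split.
- exact: intgD.
- apply: (@aeS3 _ _ _ _ _ _ mv mv'); last first.
    apply: (@aeS2 _ _ _ (fun t => I t -> N (v t \- simple_eval s t) <= m t /\ N (v' t \- simple_eval s' t) <= m' t) _ sm sm').
    by move=> t h1 h2 It; split; [exact: h1|exact: h2].
  move=> t mvt mvt' h1 It; have [h2 h3] := h1 It.
  rewrite sadd_eval E; apply: le_trans (nrmD bX _ _) (lerD h2 h3).
    by apply: memB => //; [exact: mvt|exact: mem_simple_eval].
  by apply: memB => //; [exact: mvt'|exact: mem_simple_eval].
- by rewrite RintegralD//; lra.
rewrite sadd_int E; apply: le_trans (nrmD bX _ _) _.
- by apply: memB => //; exact: mem_simple_int.
- by apply: memB => //; exact: mem_simple_int.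
- by lra.
Qed.

Lemma BI_Z c v w : BI v w -> BI (fun t r => c * v t r) (fun r => c * w r).
Proof.
move=> [mw mv h]; split.
- exact: memZ.
- by apply: aeS mv => t mv It; apply: memZ => //; exact: mv.
move=> e e0.
(* Dividing by [|c| + 1] is safe also when [c] is 0; the same device recurs below with other
   constants. *)
have c0 : 0 < `|c| + 1 by rewrite ltr_pwDr.
have [|s [m [[Im sm me] ws]]] := h (e / (`|c| + 1)); first by rewrite divr_gt0.
have E (f g : R -> R) : (fun r => c * f r) \- (fun r => c * g r) = fun r => c * (f \- g) r.
  by apply/funext => r /=; lra.
have ce x : x <= e / (`|c| + 1) -> `|c| * x <= e.
  move=> xe; apply: le_trans (ler_wpM2l _ xe) _ => //.
  rewrite mulrCA -[leRHS]mulr1; apply: ler_wpM2l; first exact: ltW.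
  by rewrite ler_pdivrMr// mul1r lerDl.
exists (sscale bX c s), (fun t => `|c| * m t); split; first split.
- exact: intgZ.
- apply: aeS2 mv sm => t mv sm It; rewrite sscale_eval E nrmZ//.
    by rewrite ler_wpM2l// sm.
  by apply: memB => //; [exact: mv|exact: mem_simple_eval].
- by rewrite RintegralZl// ce.
rewrite sscale_int E nrmZ//; first exact: ce.
by apply: memB => //; exact: mem_simple_int.
Qed.

Lemma BI_B v v' w w' : BI v w -> BI v' w' -> BI (fun t => v t \- v' t) (w \- w').
Proof.
move=> h h'; rewrite subfunE; under [X in BI X]eq_fun do rewrite subfunE.
by apply: BI_D => //; exact: BI_Z.
Qed.

Lemma BI_eq v v' w : BI v w -> {ae leb, forall t, I t -> mem (v' t)} ->
  {ae leb, forall t, I t -> N (v t \- v' t) = 0} -> BI v' w.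
Proof.
move=> [mw mv h] mv' vv'; split => // e e0.
have [s [m [[Im sm me] ws]]] := h e e0; exists s, m; split => //; split => //.
have mvv : {ae leb, forall t, I t -> mem (v t) /\ mem (v' t)}.
  by apply: aeS2 mv mv' => t h1 h2 It; split; [exact: h1|exact: h2].
apply: aeS3 mvv vv' sm => t mvv vv' sm It; have [mvt mvt'] := mvv It.
have mse := mem_simple_eval bX s t.
rewrite (le_trans (nrm_triangle bX mvt' mvt mse))// nrmC// vv'// add0r; exact: sm.
Qed.

Lemma BI_ext v v' w : BI v w -> {ae leb, forall t, I t -> v t = v' t} -> BI v' w.
Proof.
move=> [mw mv h] vv'; apply: (@BI_eq v); first by split.
  by apply: aeS2 mv vv' => t h1 h2 It; rewrite -h2//; exact: h1.
apply: aeS vv' => t h2 It; rewrite -h2//.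
rewrite (_ : _ \- _ = fun=> 0) ?nrm0//.
by apply/funext => r /=; rewrite subrr.
Qed.

(** [BI_nrm_le] for the difference, with the majorant 0. *)
Lemma BI_uniq v v' w w' : BI v w -> BI v' w' ->
  {ae leb, forall t, I t -> N (v t \- v' t) = 0} -> N (w \- w') = 0.
Proof.
move=> h h' vv'; apply/eqP; rewrite eq_le nrm_ge0// andbT.
have := @BI_nrm_le _ _ (fun=> 0) (BI_B h h').
rewrite (@Rintegral_cst _ _ _ leb _ mI) mul0r; apply; first exact: intg_cst.
by apply: aeS vv' => t + It => ->.
Qed.

(** The integrals of simple approximants with error 1/(i+1) form a Cauchy sequence, because the
    integral of a difference is bounded by the sum of the two errors; completeness supplies the
    value. *)
Lemma simple_approx_Bint v : {ae leb, forall t, I t -> mem (v t)} ->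
  (forall e, 0 < e -> exists s m, simple_approx v s m e) -> Bint v.
Proof.
move=> mv h.
have e0 (i : nat) : 0 < i.+1%:R^-1 :> R by [].
have /choice[s /choice[m hsm]] : forall i : nat, exists s, exists m, simple_approx v s m i.+1%:R^-1.
  by move=> i; exact: h.
have bnd i j : N (simple_int I (s i) \- simple_int I (s j)) <= i.+1%:R^-1 + j.+1%:R^-1.
  have [Im sm me] := hsm i; have [Im' sm' me'] := hsm j.
  apply: (@le_trans _ _ (\int[leb]_(t in I) (m i t + m j t))); last first.
    by rewrite RintegralD//; exact: lerD.
  apply: simple_int_diff; first exact: intgD.
  apply: aeS3 mv sm sm' => t mv sm sm' It.
  have m1 := mem_simple_eval bX (s i) t; have m2 := mem_simple_eval bX (s j) t.
  rewrite (le_trans (nrm_triangle bX m1 (mv It) m2))// lerD//; last exact: sm'.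
  by rewrite nrmC//; [exact: sm|exact: mv].
have inv_le e : 0 < e -> exists n : nat, forall i, (n <= i)%N -> i.+1%:R^-1 <= e :> R.
  move=> e1; exists (Num.truncn e^-1) => i ni.
  rewrite -[leRHS]invrK lef_pV2 ?posrE ?invr_gt0//.
  by rewrite (le_trans (ltW (truncnS_gt _)))// ler_nat ltnS.
have [e e1|w mw hw] := @fcomplete _ _ bX (fun i => simple_int I (s i)) (fun i => mem_simple_int bX I (s i)).
  have [|n hn] := inv_le (e / 2); first by rewrite divr_gt0.
  exists n => i j ni nj; rewrite (le_trans (bnd i j))//.
  by rewrite (le_trans (lerD (hn _ ni) (hn _ nj)))// -splitr.
exists w; split => // e e1.
have [n hn] := inv_le e e1; have [n' hn'] := hw e e1.
have [Im sm me] := hsm (maxn n n').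
exists (s (maxn n n')), (m (maxn n n')); split; first split => //.
  by rewrite (le_trans me)// hn// leq_maxl.
rewrite nrmC//; first by rewrite hn'// leq_maxr.
exact: mem_simple_int.
Qed.

Lemma Bint_simple_approx v e : Bint v -> 0 < e -> exists s m, simple_approx v s m e.
Proof. by move=> [w [_ _ h]] e0; have [s [m [? _]]] := h e e0; exists s, m. Qed.

Lemma Bint_mem v : Bint v -> {ae leb, forall t, I t -> mem (v t)}.
Proof. by move=> [w []]. Qed.

Lemma Bint_lim v : {ae leb, forall t, I t -> mem (v t)} ->
  (forall e, 0 < e -> exists v' m, [/\ Bint v', intg I m,
    {ae leb, forall t, I t -> N (v t \- v' t) <= m t} & \int[leb]_(t in I) m t <= e]) ->
  Bint v.
Proof.
move=> mv h; apply: simple_approx_Bint => // e e0.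
have [|v' [m [Bv' Im vm me]]] := h (e / 2); first by rewrite divr_gt0.
have [|s [m' [Im' vm' me']]] := @Bint_simple_approx v' (e / 2) Bv'; first by rewrite divr_gt0.
exists s, (m \+ m'); split; [exact: intgD| |by rewrite RintegralD//; lra].
have mm : {ae leb, forall t, I t -> mem (v t) /\ mem (v' t)}.
  by apply: aeS2 mv (Bint_mem Bv') => t h1 h2 It; split; [exact: h1|exact: h2].
apply: aeS3 mm vm vm' => t mm vm vm' It; have [m1 m2] := mm It.
apply: le_trans (nrm_triangle bX m1 m2 _) (lerD (vm It) (vm' It)).
exact: mem_simple_eval.
Qed.

End BI.

End bochner.

(** * Comparison with the defined Bochner integral *)

Section bochner_int.
Context {R : realType}.
Implicit Types (X Y Z : fspace (R:=R)) (I J A : set R) (f g h w : R -> R) (c : R).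
Implicit Types (v : R -> R -> R) (m : R -> R).

Section link.
Variables (X : fspace (R:=R)) (bX : banach X) (I : set R).
Hypotheses (mI : measurable I) (Ioo : (leb I < +oo)%E).
Local Notation N := (nrm X).
Local Notation mem := (fmem X).

(** Off the exceptional set [Z] the norm is a limit of norms of simple functions, which are
    measurable; multiplication by the indicator of [D] makes the limit measurable on all of [I]. The
    result agrees with the norm only almost everywhere. *)
Lemma strongly_measurable_nrm v (s0 : simple_fun X) : strongly_measurable X I v ->
  exists m, [/\ measurable_fun I m, forall t, 0 <= m t &
    {ae leb, forall t, I t -> N (v t \- simple_eval s0 t) = m t}].
Proof.
move=> [s [Z [mZ Z0 hZ]]].
pose D := I `\` Z.
have mD : measurable D by exact: measurableD.
have DP t : D t -> mem (v t) /\ fnorm X (v t \- simple_eval (s i) t) @[i --> \oo] --> 0%E.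
  move=> [It nZ]; apply: contrapT => h; apply: nZ; apply: hZ => /=.
  by apply: contra_not h; exact.
exists (fun t => \1_D t * N (v t \- simple_eval s0 t)); split.
- apply: (@measurable_fun_cvg _ _ _ _
    (fun i t => \1_D t * N (simple_eval (ssub bX (s i) s0) t))).
    move=> i; apply: measurable_funM; first exact: measurable_indic.
    by apply: measurable_funTS; exact: measurable_simple.
  move=> t It; have [tD|tD] := pselect (D t); last first.
    by rewrite indicE memNset//; under eq_fun do rewrite mul0r; rewrite mul0r; exact: cvg_cst.
  apply: cvgMr; have [mv] := DP t tD.
  have ms i := mem_simple_eval bX (s i) t; have ms0 := mem_simple_eval bX s0 t.
  have mB i : mem (v t \- simple_eval (s i) t) by exact: memB.
  move=> /(cvg_fnormP bX)-/(_ (nearW _ mB)) h.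
  apply/cvgrPdist_le => e /h; apply: filterS => i hi.
  rewrite ssub_eval (le_trans (nrm_dist bX _ _))//; [exact: memB|exact: memB|].
  rewrite [X in N X](_ : _ = v t \- simple_eval (s i) t)//.
  by apply/funext => r /=; lra.
- by move=> t; rewrite mulr_ge0 ?nrm_ge0.
exists Z; split => // t /= /not_implyP[It h]; apply: contrapT => nZ; apply: h.
by rewrite indicE mem_set ?mul1r.
Qed.

Lemma L1_nrm v (s0 : simple_fun X) : strongly_measurable X I v ->
  (L1norm X I (fun t => v t \- simple_eval s0 t)%R < +oo)%E ->
  exists m, [/\ intg I m, forall t, 0 <= m t,
    {ae leb, forall t, I t -> N (v t \- simple_eval s0 t) = m t} &
    L1norm X I (fun t => v t \- simple_eval s0 t) = (\int[leb]_(t in I) m t)%:E].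
Proof.
move=> Sv Loo; have [m [mm m0 Nm]] := strongly_measurable_nrm s0 Sv.
have mv : {ae leb, forall t, I t -> mem (v t)}.
  by have [s] := Sv; apply: aeS => t h It; have [] := h It.
have fm : {ae leb, forall t, I t -> fnorm X (v t \- simple_eval s0 t) = (m t)%:E}.
  apply: aeS2 mv Nm => t mv Nm It; rewrite (nrmE bX) ?Nm//.
  by apply: memB => //; [exact: mv|exact: mem_simple_eval].
have Im : intg I m.
  apply/integrableP; split; first exact/measurable_EFinP.
  apply: le_lt_trans Loo; apply: le_integral_lower => //.
    by move=> t; exact: fnorm_ge0.
  by apply: aeS fm => t fm It; rewrite fm//= ger0_norm.
exists m; split => //; apply: L1norm_Rintegral => // t; exact: fnorm_ge0.
Qed.

(** Subtracting a zero simple function puts [v] in the form that [L1_nrm] asks for; scaling any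
    simple function by 0 provides one. *)
Lemma L1_zero v s : v = fun t => v t \- simple_eval (sscale bX 0 s) t.
Proof. by apply/funext => t; apply/funext => r; rewrite sscale_eval /= mul0r subr0. Qed.

Lemma L1_nrm0 v : L1 X I v -> exists m, [/\ intg I m, forall t, 0 <= m t,
  {ae leb, forall t, I t -> N (v t) = m t} & L1norm X I v = (\int[leb]_(t in I) m t)%:E].
Proof.
move=> [Sv Lv]; have [s hs] := Sv.
have E := L1_zero v (s 0%N).
have [|m [Im m0 h hm]] := @L1_nrm v (sscale bX 0 (s 0%N)) Sv; first by rewrite -E.
exists m; split; [by []|by []| |by rewrite {1}E].
by apply: aeS h => t h It; rewrite -h//; congr N; rewrite {1}E.
Qed.

(** Bochner's criterion. The simple functions [s i] converge almost everywhere but without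
    domination, so each is cut off outside the set [E i] where its norm is at most twice [mu], the
    norm of [v]. The errors are then dominated by [3 * mu]. *)
Lemma L1_Bint v : L1 X I v -> Bint X I v.
Proof.
move=> [Sv Lv]; have [s hs] := Sv.
have [mu [Imu mu0 Nmu _]] := L1_nrm0 (conj Sv Lv).
have mmu := measurable_intg Imu.
have mv : {ae leb, forall t, I t -> mem (v t)}.
  by apply: aeS hs => t h It; have [] := h It.
pose E i := I `&` [set t | N (simple_eval (s i) t) <= 2 * mu t].
have mE i : measurable (E i).
  apply: measurable_fun_le => //; first by apply: measurable_funTS; exact: measurable_simple.
  by apply: measurable_funM.
pose s' i := srestr (mE i) (s i).
have /choice[d hd] i := strongly_measurable_nrm (s' i) Sv.
have s'2 i t : I t -> N (simple_eval (s' i) t) <= 2 * mu t.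
  move=> It; rewrite srestr_eval nrmZ//; last exact: mem_simple_eval.
  rewrite indicE; case: (boolP (t \in E i)) => tE; last by rewrite normr0 mul0r mulr_ge0.
  by rewrite normr1 mul1r; move: tE; rewrite inE => -[].
have d3 : {ae leb, forall t, I t -> forall i, `|d i t| <= 3 * mu t}.
  have : {ae leb, forall t, forall i, I t -> N (v t \- simple_eval (s' i) t) = d i t}.
    by apply: ae_foralln => i; have [] := hd i.
  move=> h; apply: aeS3 mv Nmu h => t mv Nmu h It i.
  have ms := mem_simple_eval bX (s' i) t.
  rewrite -h// ger0_norm ?nrm_ge0// (le_trans (nrmB bX (mv It) ms))// Nmu//.
  by have := s'2 i t It; lra.
have d0 : {ae leb, forall t, I t -> d i t @[i --> \oo] --> cst (0 : R) t}.
  have : {ae leb, forall t, forall i, I t -> N (v t \- simple_eval (s' i) t) = d i t}.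
    by apply: ae_foralln => i; have [] := hd i.
  move=> h; apply: aeS3 h hs Nmu => t h hs Nmu It.
  have [mvt] := hs It; have ms i := mem_simple_eval bX (s i) t.
  have ms' i := mem_simple_eval bX (s' i) t.
  have mB i : mem (v t \- simple_eval (s i) t) by exact: memB.
  move=> /(cvg_fnormP bX)-/(_ (nearW _ mB)) {}hs.
  (* Where [mu t = 0] the cut-off functions have norm 0. Where [mu t > 0] the cut-off is eventually
     inactive, since the norm of [s i] at [t] tends to [mu t], which is less than [2 * mu t]. *)
  apply/cvgr0Pnorm_le => e e0; have := mu0 t; rewrite le_eqVlt => /orP[/eqP mu0t|mut].
    apply: nearW => i; rewrite -h// ger0_norm ?nrm_ge0//.
    rewrite (le_trans (nrmB bX mvt (ms' i)))// Nmu//.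
    by have := s'2 i t It; lra.
  near=> i; rewrite -h// ger0_norm ?nrm_ge0//.
  rewrite (_ : simple_eval (s' i) t = simple_eval (s i) t).
    by near: i; exact: hs.
  rewrite srestr_eval; apply/funext => r; rewrite indicE mem_set ?mul1r//.
  split => //=.
  have := nrm_le_sub bX (ms i) mvt; rewrite nrmC// Nmu//.
  suff : N (v t \- simple_eval (s i) t) <= mu t by lra.
  by near: i; exact: hs.
have [_ _] := @cvg_Rintegral_dominated _ I d (cst 0) (fun t => 3 * mu t) mI
  (fun i => let: And3 h _ _ := hd i in h) (measurable_cst _) (intgZ _ mI Imu) d0 d3.
move=> /cvgr0Pnorm_le di0.
apply: (simple_approx_Bint bX) => // e e0.
have [n _ /(_ n (leqnn n)) hn] := di0 e e0.
exists (s' n), (d n); split.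
- have [md _ _] := hd n.
  apply: (intg_le_ae mI md (intgZ 3 mI Imu)).
  by apply: aeS d3 => t h It; exact: h.
- by have [_ _] := hd n; apply: aeS => t h It; rewrite h.
- apply: le_trans hn; rewrite ger0_norm; last by apply: Rintegral_ge0 => t _.
  rewrite le_eqVlt; apply/orP; left; apply/eqP/eq_Rintegral => t _.
  by have [_ d0' _] := hd n; rewrite /= subr0 ger0_norm.
Unshelve. all: by end_near. Qed.

(** Approximation errors 2^-i make the majorants [m i] summable almost everywhere, so the simple
    functions converge pointwise almost everywhere; this is the strong measurability that
    [is_bochner_int] contains. *)
Lemma BI_is_bochner_int v w : BI X I v w -> is_bochner_int X I v w.
Proof.
move=> [mw mv h].
have e0 (i : nat) : 0 < 2 ^- i :> R by rewrite invr_gt0 exprn_gt0.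
have /choice[s /choice[m hsm]] : forall i : nat, exists s : simple_fun X, exists m,
    simple_approx I v s m (2 ^- i) /\ N (w \- simple_int I s) <= 2 ^- i.
  by move=> i; exact: h.
have mB i t : mem (v t) -> mem (v t \- simple_eval (s i) t).
  by move=> mvt; apply: memB => //; exact: mem_simple_eval.
have fm i : {ae leb, forall t, I t -> (fnorm X (v t \- simple_eval (s i) t)%R <= `|m i t|%:E)%E}.
  have [[_ sm _] _] := hsm i; apply: aeS2 mv sm => t mv sm It.
  by rewrite (nrmE bX)//; [rewrite lee_fin (le_trans (sm It))// ler_norm|exact/mB/mv].
have Im i : intg I (fun t => `|m i t|).
  by have [[Im _ _] _] := hsm i; exact: (@integrable_norm _ _ _ leb _ _ Im).
have Ile i : \int[leb]_(t in I) `|m i t| <= 2 ^- i.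
  have [[Im' sm me] _] := hsm i; rewrite (le_trans _ me)//.
  have Imi := Im i; apply: le_Rintegral_ae => //.
  by apply: aeS sm => t sm It; rewrite ger0_norm// (le_trans _ (sm It))// nrm_ge0.
have to0 (F : nat -> \bar R) : (forall i, (0 <= F i)%E) -> (forall i, (F i <= (2 ^- i)%:E)%E) ->
    F i @[i --> \oo] --> 0%E.
  move=> F0 Fi; apply: (@squeeze_cvge _ _ _ _ (cst 0%E) _ (fun i => (2 ^- i)%:E)).
  - by apply: nearW => i; rewrite F0 Fi.
  - exact: cvg_cst.
  - apply: cvg_EFin; first exact: nearW.
    have := @cvg_geometric R 1 2^-1; rewrite /geometric/=.
    rewrite ger0_norm// invf_lt1// ltr1n => /(_ isT).
    by under eq_fun do rewrite mul1r exprVn.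
have Li i : (L1norm X I (fun t => v t \- simple_eval (s i) t)%R <= (2 ^- i)%:E)%E.
  apply: (@le_trans _ _ (\int[leb]_(t in I) `|m i t|)%:E); last by rewrite lee_fin.
  apply: le_L1norm_Rintegral => //; by move=> t; exact: fnorm_ge0.
split => //.
  split.
    exists s; have sae := summable_ae mI Im (fun i t => normr_ge0 _) Ile.
    have fm' : {ae leb, forall t, forall i, I t -> (fnorm X (v t \- simple_eval (s i) t)%R <= `|m i t|%:E)%E}.
      exact: ae_foralln.
    apply: aeS3 mv sae fm' => t mv sae fm' It; split; first exact: mv.
    apply: (@squeeze_cvge _ _ _ _ (cst 0%E) _ (fun i => `|m i t|%:E)).
    - by apply: nearW => i; rewrite fnorm_ge0//= fm'.
    - exact: cvg_cst.
    - by apply: cvg_EFin; [exact: nearW|exact: (cvg_series_cvg_0 (sae It))].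
  have [[Im0 sm0 _] _] := hsm 0%N.
  have Is := intg_simple bX (s 0%N) mI Ioo.
  apply: (@le_lt_trans _ _ (\int[leb]_(t in I) (m 0%N t + N (simple_eval (s 0%N) t)))%:E); last exact: ltry.
  apply: le_L1norm_Rintegral => //; [by move=> t; exact: fnorm_ge0|exact: intgD|].
  apply: aeS2 mv sm0 => t mv sm0 It; rewrite (nrmE bX) ?lee_fin; last exact: mv.
  rewrite (le_trans (nrm_le_sub bX (mv It) (mem_simple_eval bX (s 0%N) t)))// lerD2r.
  exact: sm0.
exists s; split.
  apply: (to0 (fun i => L1norm X I (fun t => v t \- simple_eval (s i) t)%R)) => // i; apply: integral_ge0 => t _; exact: fnorm_ge0.
apply: (to0 (fun i => fnorm X (w \- simple_int I (s i))%R)) => i; first exact: fnorm_ge0.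
rewrite (nrmE bX) ?lee_fin; first by have [] := hsm i.
by apply: memB => //; exact: mem_simple_int.
Qed.

Lemma is_bochner_int_BI v w : is_bochner_int X I v w -> BI X I v w.
Proof.
move=> [[Sv Lv] mw [s [Ls ws]]]; split => //.
  by have [s'] := Sv; apply: aeS => t h It; have [] := h It.
move=> e e0.
have : \forall i \near \oo, (L1norm X I (fun t => v t \- simple_eval (s i) t)%R <= e%:E)%E.
  have Ls' : (fine \o (fun i => L1norm X I (fun t => v t \- simple_eval (s i) t)%R)) x @[x --> \oo] --> 0.
    exact: fine_cvg.
  have /cvgr0Pnorm_le/(_ _ e0) := Ls'.
  have : \forall i \near \oo, L1norm X I (fun t => v t \- simple_eval (s i) t)%R \is a fin_num.
    exact: cvg_is_fine Ls.
  apply: filterS2 => i fi; rewrite /comp => ie.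
  by rewrite -(fineK fi) lee_fin (le_trans (ler_norm _)).
move=> Ls'.
have ws' : \forall i \near \oo, N (w \- simple_int I (s i)) <= e.
  move/(cvg_fnormP bX) : ws; apply => //; apply: nearW => i.
  by apply: memB => //; exact: mem_simple_int.
have [n _ /(_ n (leqnn n))] : \forall i \near \oo, (L1norm X I (fun t => v t \- simple_eval (s i) t)%R <= e%:E)%E /\ N (w \- simple_int I (s i)) <= e.
  by apply: filterS2 Ls' ws' => i; split.
move=> [h1 h2].
have [m [Im m0 sm Lm]] := L1_nrm Sv (le_lt_trans h1 (ltry _)).
exists (s n), m; split => //; split => //.
  by apply: aeS sm => t sm It; rewrite sm.
by rewrite -lee_fin -Lm.
Qed.

(** The choice made by [bochner_int] is opened here only; afterwards it is seen through [BI]. *)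
Lemma Bint_bochner_int v : Bint X I v -> BI X I v (bochner_int X I v).
Proof.
move=> [w h]; apply: is_bochner_int_BI; rewrite /bochner_int.
by apply: (@xgetPex _ (cst 0) [set w | is_bochner_int X I v w]); exists w; exact: BI_is_bochner_int.
Qed.

Lemma Bint_L1 v : Bint X I v -> L1 X I v.
Proof. by move=> [w /BI_is_bochner_int[]]. Qed.

Lemma Bint_nrm v : Bint X I v -> exists m, [/\ intg I m, forall t, 0 <= m t,
    {ae leb, forall t, I t -> N (v t) = m t} & L1norm X I v = (\int[leb]_(t in I) m t)%:E].
Proof.
by move=> h; apply: L1_nrm0; exact: Bint_L1.
Qed.

End link.
End bochner_int.

(** * Bounded operators, restriction and vanishing of integrals *)

Section bochner_ops.
Context {R : realType}.
Implicit Types (X Y Z : fspace (R:=R)) (I J A : set R) (f g h w : R -> R) (c : R).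
Implicit Types (v : R -> R -> R) (m : R -> R).

(* Linearity can only be asked up to functions of norm 0: Dr picks a
   representative of the derivative. *)
Record bop X Y (L : (R -> R) -> R -> R) (K : R) : Prop := Bop {
  bop_ge0 : 0 <= K ;
  bop_mem : forall f, fmem X f -> fmem Y (L f) ;
  bop_le : forall f, fmem X f -> nrm Y (L f) <= K * nrm X f ;
  bop_add : forall f g, fmem X f -> fmem X g ->
    nrm Y (L (f \+ g) \- (L f \+ L g)) = 0 ;
  bop_scal : forall c f, fmem X f ->
    nrm Y (L (fun r => c * f r) \- (fun r => c * L f r)) = 0 }.

Section nrmeq.
Variables (X : fspace (R:=R)) (bX : banach X).
Local Notation N := (nrm X).
Local Notation mem := (fmem X).

Lemma nrmeq_refl f : N (f \- f) = 0.
Proof.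
rewrite (_ : f \- f = fun=> 0) ?nrm0//.
by apply/funext => r /=; rewrite subrr.
Qed.

Lemma nrmeq_trans g f h : mem f -> mem g -> mem h ->
  N (f \- g) = 0 -> N (g \- h) = 0 -> N (f \- h) = 0.
Proof.
move=> mf mg mh fg gh; apply/eqP; rewrite eq_le nrm_ge0// andbT.
by rewrite (le_trans (nrm_triangle bX mf mg mh))// fg gh addr0.
Qed.

Lemma nrmeq_add f f' g g' : mem f -> mem f' -> mem g -> mem g' ->
  N (f \- f') = 0 -> N (g \- g') = 0 -> N ((f \+ g) \- (f' \+ g')) = 0.
Proof.
move=> mf mf' mg mg' ff gg; apply/eqP; rewrite eq_le nrm_ge0// andbT.
rewrite [X in N X <= _](_ : _ = (f \- f') \+ (g \- g')); last first.
  by apply/funext => r /=; lra.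
by rewrite (le_trans (nrmD bX _ _)) ?ff ?gg ?addr0//; exact: memB.
Qed.

End nrmeq.

Section oper.
Variables (X Y : fspace (R:=R)) (bX : banach X) (bY : banach Y).
Variables (L : (R -> R) -> R -> R) (K : R) (bL : bop X Y L K).

Lemma bop_sum n (c : nat -> R) (F : nat -> R -> R) : (forall i, fmem X (F i)) ->
  nrm Y (L (fun r => \sum_(i < n) c i * F i r) \- (fun r => \sum_(i < n) c i * L (F i) r)) = 0.
Proof.
move=> mF; have mcF i : fmem X (fun r => c i * F i r) by exact: memZ.
have mLF i : fmem Y (fun r => c i * L (F i) r) by apply: memZ => //; exact: (bop_mem bL).
elim: n => [|n ih].
  have E0 (G : nat -> R -> R) : (fun r => \sum_(i < 0) G i r) = fun=> 0.
    by apply/funext => r; rewrite big_ord0.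
  rewrite (E0 (fun i r => c i * F i r)) (E0 (fun i r => c i * L (F i) r)).
  have := bop_scal bL 0 (mem0 bX).
  have Z (f : R -> R) : (fun r => 0 * f r) = fun=> 0.
    by apply/funext => r; rewrite mul0r.
  by rewrite (Z (fun=> 0)) (Z (L (fun=> 0))).
have ES (G : nat -> R -> R) : (fun r => \sum_(i < n.+1) G i r) =
    (fun r => \sum_(i < n) G i r) \+ G n.
  by apply/funext => r; rewrite big_ord_recr.
rewrite (ES (fun i r => c i * F i r)) (ES (fun i r => c i * L (F i) r)).
have mS : fmem X (fun r => \sum_(i < n) c i * F i r) by apply: mem_sum.
have mSL : fmem Y (fun r => \sum_(i < n) c i * L (F i) r) by apply: mem_sum.
apply: (@nrmeq_trans _ bY (L (fun r => \sum_(i < n) c i * F i r) \+ L (fun r => c n * F n r))).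
- by apply: (bop_mem bL); apply: memD.
- by apply: memD => //; exact: (bop_mem bL).
- exact: memD.
- exact: (bop_add bL).
- apply: nrmeq_add => //; try exact: (bop_mem bL).
  exact: (bop_scal bL).
Qed.

Lemma bop_sub f g : fmem X f -> fmem X g -> nrm Y (L (f \- g) \- (L f \- L g)) = 0.
Proof.
move=> mf mg; rewrite (subfunE f g) (subfunE (L f) (L g)).
have mg' : fmem X (fun r => -1 * g r) by exact: memZ.
have mLf := bop_mem bL mf; have mLg := bop_mem bL mg.
have mLg' : fmem Y (fun r => -1 * L g r) by exact: memZ.
apply: (@nrmeq_trans _ bY (L f \+ L (fun r => -1 * g r))).
- by apply: (bop_mem bL); exact: memD.
- by apply: memD => //; exact: (bop_mem bL).
- exact: memD.
- exact: (bop_add bL).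
- apply: nrmeq_add => //; first exact: (bop_mem bL).
  exact: nrmeq_refl.
  exact: (bop_scal bL).
Qed.

Lemma bop_lip f g : fmem X f -> fmem X g -> nrm Y (L f \- L g) <= K * nrm X (f \- g).
Proof.
move=> mf mg; have mLf := bop_mem bL mf; have mLg := bop_mem bL mg.
have mfg := memB bX mf mg.
rewrite -(nrm_eq bY (bop_mem bL mfg) (memB bY mLf mLg) (bop_sub mf mg)).
exact: (bop_le bL).
Qed.

Lemma smap_mem (F : nat -> R -> R) : (forall i, fmem X (F i)) -> forall i, fmem Y (L (F i)).
Proof. by move=> mF i; exact: (bop_mem bL). Qed.

Definition smap (s : simple_fun X) : simple_fun Y :=
  SimpleFun (slen s) (measurable_sset s) (smap_mem (mem_sval s)).

(** The operator is applied to the values of the approximating simple functions. By [bop_sum] the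
    image of a finite combination agrees with the combination of the images up to norm 0, which
    suffices for the estimates. *)
Lemma BI_bop I v w : measurable I -> BI X I v w -> BI Y I (fun t => L (v t)) (L w).
Proof.
move=> mI [mw mv h]; split.
- exact: (bop_mem bL).
- by apply: aeS mv => t mv It; apply: (bop_mem bL); exact: mv.
move=> e e0; have K0 := bop_ge0 bL.
have c0 : 0 < K + 1 by rewrite ltr_pwDr.
have ce x : x <= e / (K + 1) -> K * x <= e.
  move=> xe; apply: le_trans (ler_wpM2l K0 xe) _.
  rewrite mulrCA -[leRHS]mulr1; apply: ler_wpM2l; first exact: ltW.
  by rewrite ler_pdivrMr// mul1r lerDl.
have [|s [m [[Im sm me] ws]]] := h (e / (K + 1)); first by rewrite divr_gt0.
have bd f (F : nat -> R -> R) (c : nat -> R) n : fmem X f -> (forall i, fmem X (F i)) ->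
    nrm Y (L f \- (fun r => \sum_(i < n) c i * L (F i) r)) <=
    K * nrm X (f \- (fun r => \sum_(i < n) c i * F i r)).
  move=> mf mF.
  have mS : fmem X (fun r => \sum_(i < n) c i * F i r).
    by apply: mem_sum => // i; exact: memZ.
  have mSL : fmem Y (fun r => \sum_(i < n) c i * L (F i) r).
    by apply: mem_sum => // i; apply: memZ => //; exact: (bop_mem bL).
  have mLf := bop_mem bL mf; have mLS := bop_mem bL mS.
  rewrite (le_trans (nrm_triangle bY mLf mLS mSL))// bop_sum// addr0.
  exact: bop_lip.
exists (smap s), (fun t => K * m t); split; first split.
- exact: intgZ.
- apply: aeS2 mv sm => t mv sm It.
  apply: le_trans (bd _ _ (fun i => \1_(sset s i) t) _ (mv It) (mem_sval s)) _.
  by rewrite ler_wpM2l// sm.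
- by rewrite RintegralZl// ce.
apply: le_trans (bd _ _ (fun i => fine (leb (sset s i `&` I))) _ mw (mem_sval s)) _.
exact: ce.
Qed.

Lemma Bint_bop I v : measurable I -> Bint X I v -> Bint Y I (fun t => L (v t)).
Proof. by move=> mI [w /BI_bop h]; exists (L w); exact: h. Qed.

End oper.

Lemma intg_patch I J m : measurable I -> measurable J -> J `<=` I ->
  intg J m -> intg I (m \_ J).
Proof.
move=> mI mJ JI Im; rewrite -restrict_EFin.
by apply/(@integrable_restrict _ _ _ leb J mJ I mI); rewrite setIidr.
Qed.

Section more.
Variables (X : fspace (R:=R)) (bX : banach X).
Local Notation N := (nrm X).
Local Notation mem := (fmem X).

Lemma BI_extend I J v w : measurable I -> measurable J -> J `<=` I ->
  BI X J v w -> BI X I (fun t r => \1_J t * v t r) w.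
Proof.
move=> mI mJ JI [mw mv h].
have v0 t : ~ J t -> (fun r => \1_J t * v t r) = fun=> 0.
  by move=> nJ; apply/funext => r; rewrite indicE memNset// mul0r.
have v1 t : J t -> (fun r => \1_J t * v t r) = v t.
  by move=> nJ; apply/funext => r; rewrite indicE mem_set// mul1r.
split => //.
  apply: aeS mv => t mv It; have [Jt|Jt] := pselect (J t); first by rewrite v1//; exact: mv.
  by rewrite v0//; exact: mem0.
move=> e e0; have [s [m [[Im sm me] ws]]] := h e e0.
have mmJ : intg I (m \_ J) by exact: intg_patch.
exists (srestr mJ s), (m \_ J); split; first split => //.
- apply: aeS sm => t sm It; rewrite srestr_eval patchE.
  have [Jt|Jt] := pselect (J t).
    rewrite v1// mem_set//; apply: le_trans _ (sm Jt); rewrite le_eqVlt; apply/orP; left.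
    apply/eqP; congr N; apply/funext => r /=; by rewrite indicE mem_set// mul1r.
  rewrite memNset// v0// [X in N X](_ : _ = fun=> 0) ?nrm0//.
  by apply/funext => r /=; rewrite indicE memNset// mul0r subr0.
- by rewrite -Rintegral_mkcondr setIidr.
by rewrite srestr_int// (setIidl JI).
Qed.

Lemma Bint_sub I J v : measurable I -> (leb I < +oo)%E -> measurable J -> J `<=` I ->
  Bint X I v -> Bint X J v.
Proof.
move=> mI Ioo mJ JI Bv.
have Joo : (leb J < +oo)%E by apply: le_lt_trans Ioo; exact: le_leb.
apply: simple_approx_Bint => //.
  by apply: aeS (Bint_mem Bv) => t h /JI; exact: h.
move=> e e0; have [s [m [Im sm me]]] := Bint_simple_approx Bv e0.
have ImJ : intg J m by exact: (@integrableS _ _ _ leb _ _ _ mI mJ JI Im).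
exists s, m; split => //.
  by apply: aeS sm => t sm /JI; exact: sm.
apply: le_trans me.
rewrite -{1}(setIidr JI) Rintegral_mkcondr; apply: le_Rintegral_ae => //.
  by apply: intg_patch => //; exact: (@integrableS _ _ _ leb _ _ _ mI mJ JI Im).
apply: aeS sm => t sm It; rewrite patchE; case: ifPn => // _.
by rewrite (le_trans _ (sm It))// nrm_ge0.
Qed.

(** The integral over [J] exists on its own and, after extension by 0, agrees with [w] up to norm 0
    by uniqueness; [w] may then replace it. *)
Lemma BI_restrict I J v w : measurable I -> (leb I < +oo)%E -> measurable J -> J `<=` I ->
  BI X I (fun t r => \1_J t * v t r) w -> BI X J v w.
Proof.
move=> mI Ioo mJ JI Bv.
have Joo : (leb J < +oo)%E by apply: le_lt_trans Ioo; exact: le_leb.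
have Bw : Bint X J v.
  have [w0 hw0] : Bint X J (fun t r => \1_J t * v t r).
    by apply: (Bint_sub mI) => //; exists w.
  exists w0; apply: (BI_ext bX hw0); apply: aeW => t Jt.
  by apply/funext => r; rewrite indicE mem_set// mul1r.
have [w' Bw'] := Bw.
have ww : N (w \- w') = 0.
  apply: (BI_uniq bX mI Ioo Bv (BI_extend mI mJ JI Bw')).
  by apply: aeW => t It; exact: nrmeq_refl.
have [mw' mv h] := Bw'; have [mw _ _] := Bv; split => // e e0.
have [s [m [hs ws]]] := h e e0; exists s, m; split => //.
have msi := mem_simple_int bX J s.
by rewrite (le_trans (nrm_triangle bX mw mw' msi))// ww add0r.
Qed.

Lemma BI_cst I f : measurable I -> (leb I < +oo)%E -> mem f ->
  BI X I (fun=> f) (fun r => fine (leb I) * f r).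
Proof.
move=> mI Ioo mf; split; [exact: memZ|by apply: aeW|].
move=> e e0.
pose s : simple_fun X := SimpleFun 1 (fun=> measurableT) (fun=> mf).
exists s, (fun=> 0); split; first split.
- exact: intg_cst.
- apply: aeW => t It; rewrite [X in N X](_ : _ = fun=> 0) ?nrm0//.
  by apply/funext => r; rewrite /simple_eval/= big_ord1 indicT mul1r subrr.
- by rewrite (@Rintegral_cst _ _ _ leb _ mI) mul0r ltW.
rewrite [X in N X](_ : _ = fun=> 0) ?nrm0 ?ltW//.
by apply/funext => r; rewrite /simple_int/= big_ord1 setTI subrr.
Qed.

Lemma BI_sum I n (V : nat -> R -> R -> R) : measurable I -> (leb I < +oo)%E ->
  (forall i, (i < n)%N -> Bint X I (V i)) ->
  Bint X I (fun t r => \sum_(i < n) V i t r).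
Proof.
move=> mI Ioo; elim: n => [|n ih] hV.
  exists (fun r => fine (leb I) * 0); apply: BI_ext (BI_cst mI Ioo (mem0 bX)) _ => //.
  by apply: aeW => t _; apply/funext => r; rewrite big_ord0.
have [|w hw] := ih; first by move=> i ni; apply: hV; rewrite ltnS ltnW.
have [w' hw'] := hV n (leqnn _).
exists (w \+ w'); apply: BI_ext (BI_D bX mI hw hw') _ => //.
by apply: aeW => t _; apply/funext => r; rewrite big_ord_recr.
Qed.

(** Dominated convergence for scalar weights bounded by 1, the errors being at most [2 * mu]. Only
    integrals of norm 0 are followed: the purpose is to close under limits the class of weights
    against which [v] integrates to 0. *)
Lemma Bint_scal_lim I (phi : nat -> R -> R) (psi : R -> R) v :
  measurable I -> (leb I < +oo)%E -> Bint X I v ->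
  (forall n, measurable_fun I (phi n)) -> measurable_fun I psi ->
  (forall n t, I t -> `|phi n t| <= 1) ->
  (forall t, I t -> phi n t @[n --> \oo] --> psi t) ->
  (forall n, exists2 w, BI X I (fun t r => phi n t * v t r) w & N w = 0) ->
  exists2 w, BI X I (fun t r => psi t * v t r) w & N w = 0.
Proof.
move=> mI Ioo Bv mphi mpsi phi1 phipsi hphi.
have [mu [Imu mu0 Nmu _]] := Bint_nrm bX mI Ioo Bv.
have mv := Bint_mem Bv.
pose F n t := (phi n t - psi t) * mu t.
have mF n : measurable_fun I (F n).
  apply: measurable_funM; last exact: measurable_intg.
  exact: measurable_funB.
have psi1 t : I t -> `|psi t| <= 1.
  move=> It; have := phipsi t It => /(cvg_norm) h.
  rewrite -(cvg_lim _ h)//; apply: limr_le; first exact: cvgP h.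
  by apply: nearW => n; exact: phi1.
have Fd : {ae leb, forall t, I t -> forall i, `|F i t| <= 2 * mu t}.
  apply: aeW => t It i; rewrite /F normrM (ger0_norm (mu0 t)) ler_wpM2r//.
  by rewrite (le_trans (ler_normB _ _))// (_ : 2 = 1 + 1)// lerD// ?phi1 ?psi1.
have F0 : {ae leb, forall t, I t -> F i t @[i --> \oo] --> cst (0 : R) t}.
  apply: aeW => t It; rewrite [X in _ --> X](_ : _ = 0 * mu t); last by rewrite mul0r.
  apply: cvgMl; rewrite -(subrr (psi t)).
  by apply: cvgB; [exact: phipsi|exact: cvg_cst].
have [_ _] := @cvg_Rintegral_dominated _ I F (cst 0) (fun t => 2 * mu t) mI
  mF (measurable_cst _) (intgZ _ mI Imu) F0 Fd.
move=> /cvgr0Pnorm_le F00.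
have IF n : intg I (fun t => `|F n t|).
  apply: (@integrable_norm _ _ _ leb I (F n)).
  by apply: (intg_le_ae mI (mF n) (intgZ 2 mI Imu)); apply: aeS Fd => t h It; exact: h.
have Nd n : {ae leb, forall t, I t ->
    N ((fun r => psi t * v t r) \- (fun r => phi n t * v t r)) <= `|F n t|}.
  apply: aeS2 mv Nmu => t mv Nmu It.
  rewrite [X in N X](_ : _ = fun r => (psi t - phi n t) * v t r); last first.
    by apply/funext => r /=; rewrite mulrBl.
  by rewrite nrmZ ?Nmu// /F ?normrM ?(ger0_norm (mu0 t)) 1?distrC//; exact: mv.
have Ile e : 0 < e -> exists n, \int[leb]_(t in I) `|F n t| <= e.
  move=> e0; have [n _ /(_ n (leqnn n)) hn] := F00 e e0; exists n.
  apply: le_trans hn; rewrite ger0_norm; last by apply: Rintegral_ge0 => t _.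
  by rewrite le_eqVlt; apply/orP; left; apply/eqP/eq_Rintegral => t _; rewrite /= subr0.
have [w hw] : Bint X I (fun t r => psi t * v t r).
  apply: Bint_lim => //.
    by apply: aeS mv => t mv It; apply: memZ => //; exact: mv.
  move=> e e0; have [n hn] := Ile e e0.
  exists (fun t r => phi n t * v t r), (fun t => `|F n t|); split => //.
  by have [w' hw' _] := hphi n; exists w'.
exists w => //; apply/eqP; rewrite eq_le nrm_ge0// andbT.
apply/ler_addgt0Pr => e e0; rewrite add0r.
have [n hn] := Ile e e0; have [w' hw' w'0] := hphi n.
have mw : mem w by case: hw. have mw' : mem w' by case: hw'.
rewrite (le_trans (nrm_le_sub bX mw mw'))// w'0 addr0 (le_trans _ hn)//.
exact: (BI_nrm_le bX mI Ioo (BI_B bX mI hw hw')).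
Qed.

(** If a simple approximant is [w] on a piece [J], then |J| ||w|| is the norm of the integral of
    [w - v] over [J], hence at most the error integrated over [J]. Summing over the pieces bounds
    the integral of the norm of the approximant by its error, so the integral of ||v|| is
    arbitrarily small. This takes the place of a duality argument. *)
Lemma Bint_zero_sets I v : measurable I -> (leb I < +oo)%E -> Bint X I v ->
  (forall A, measurable A -> A `<=` I -> exists2 w, BI X A v w & N w = 0) ->
  {ae leb, forall t, I t -> N (v t) = 0}.
Proof.
move=> mI Ioo Bv hA.
have [mu [Imu mu0 Nmu _]] := Bint_nrm bX mI Ioo Bv.
have mv := Bint_mem Bv.
have key (S : nat -> set R) (V : nat -> R -> R) : (forall i, measurable (S i)) ->
    (forall i, mem (V i)) -> forall n w J d, measurable J -> J `<=` I -> mem w ->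
    intg J d -> {ae leb, forall t, J t -> N (offset_eval S V n w t \- v t) <= d t} ->
    \int[leb]_(t in J) N (offset_eval S V n w t) <= \int[leb]_(t in J) d t.
  move=> mS mV; elim=> [|n ih] w J d mJ JI mw Id hd.
    have Joo : (leb J < +oo)%E by apply: le_lt_trans Ioo; exact: le_leb.
    have E t : offset_eval S V 0 w t = w.
      by apply/funext => r; rewrite /offset_eval big_ord0 addr0.
    under eq_Rintegral do rewrite E.
    rewrite (@Rintegral_cst _ _ _ leb _ mJ) mulrC.
    have [w0 Bw0 w00] := hA J mJ JI.
    have mw0 : mem w0 by case: Bw0.
    have mlw : mem (fun r => fine (leb J) * w r) by exact: memZ.
    have := BI_nrm_le bX mJ Joo (BI_B bX mJ (BI_cst mJ Joo mw) Bw0) Id.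
    have -> : fine (leb J) * N w = N (fun r => fine (leb J) * w r).
      by rewrite nrmZ// ger0_norm// fine_ge0.
    move=> h; rewrite (le_trans (nrm_le_sub bX mlw mw0))// w00 addr0 h//.
    by apply: aeS hd => t + Jt => /(_ Jt); rewrite E.
  have Joo : (leb J < +oo)%E by apply: le_lt_trans Ioo; exact: le_leb.
  set J1 := J `&` S n; set J2 := J `\` S n.
  have mJ1 : measurable J1 by exact: measurableI.
  have mJ2 : measurable J2 by exact: measurableD.
  have JJ : J = J1 `|` J2 by rewrite /J1 /J2 setUIDK.
  have dJ : [disjoint J1 & J2] by apply/disj_setPS => t [[_ tS] [_ +]].
  have J1J : J1 `<=` J by move=> t [].
  have J2J : J2 `<=` J by move=> t [].
  have E1 t : J1 t -> offset_eval S V n.+1 w t = offset_eval S V n (w \+ V n) t.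
    by move=> -[_ tS]; rewrite offset_evalS mem_set.
  have E2 t : J2 t -> offset_eval S V n.+1 w t = offset_eval S V n w t.
    by move=> -[_ tS]; rewrite offset_evalS memNset.
  rewrite JJ !Rintegral_setU//; last 2 first.
  - by rewrite -JJ.
  - rewrite -JJ; exact: intg_offset.
  apply: lerD.
    rewrite (@eq_Rintegral _ _ _ leb _ (fun t => N (offset_eval S V n (w \+ V n) t))); last first.
      by move=> t; rewrite inE => /E1 ->.
    apply: ih => //; [exact: subset_trans JI|exact: memD| |].
      exact: (@integrableS _ _ _ leb _ _ _ mJ mJ1 J1J Id).
    by apply: aeS hd => t hd Jt; rewrite -E1//; apply: hd; exact: J1J.
  rewrite (@eq_Rintegral _ _ _ leb _ (fun t => N (offset_eval S V n w t))); last first.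
    by move=> t; rewrite inE => /E2 ->.
  apply: ih => //; [exact: subset_trans JI| |].
    exact: (@integrableS _ _ _ leb _ _ _ mJ mJ2 J2J Id).
  by apply: aeS hd => t hd Jt; rewrite -E2//; apply: hd; exact: J2J.
have mu_int : \int[leb]_(t in I) mu t = 0.
  apply/eqP; rewrite eq_le; apply/andP; split; last exact: Rintegral_ge0.
  apply/ler_addgt0Pr => e e0; rewrite add0r.
  have [|s [m [Im sm me]]] := @Bint_simple_approx _ _ _ v (e / 2) Bv; first by rewrite divr_gt0.
  have Is := intg_simple bX s mI Ioo.
  have h1 : \int[leb]_(t in I) N (simple_eval s t) <= e / 2.
    apply: le_trans me; under eq_Rintegral do rewrite simple_evalE.
    apply: key => //; [exact: measurable_sset|exact: mem_sval|exact: mem0|].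
    apply: aeS2 mv sm => t mv sm It; rewrite -simple_evalE nrmC//; first exact: sm.
      exact: mem_simple_eval.
    exact: mv.
  rewrite [leRHS]splitr; apply: le_trans (lerD me h1); rewrite -RintegralD//.
  apply: le_Rintegral_ae => //; first exact: intgD.
  apply: aeS3 mv sm Nmu => t mv sm Nmu It.
  rewrite -Nmu// (le_trans (nrm_le_sub bX (mv It) (mem_simple_eval bX s t)))// lerD2r.
  exact: sm.
have := @ae_eq_integral_abs _ _ _ leb I mI (EFin \o mu) (measurable_int _ Imu).
move=> [+ _].
rewrite (_ : (\int[leb]_(t in I) `|(EFin \o mu) t|)%E = 0%E); last first.
  transitivity (\int[leb]_(t in I) (mu t)%:E)%E.
    by apply: eq_integral => t _ /=; rewrite ger0_norm.
  by rewrite ge0_integral_Rintegral// mu_int.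
move=> /(_ erefl) h; apply: aeS2 Nmu h => t Nmu h It; rewrite Nmu//.
by have [] := h It.
Qed.

End more.
End bochner_ops.

(** * Smooth functions and test functions *)

Section smooth.
Context {R : realType}.
Implicit Types (f g phi : R -> R).

Definition smooth f := forall j x, derivable (derive1n j f) x 1.

Definition has_deriv f f' := forall x : R, is_derive x 1 f (f' x).

Lemma has_deriv_derive1 f f' : has_deriv f f' -> derive1 f = f'.
Proof. by move=> ff'; apply/funext => x; rewrite derive1E; have [_ ->] := ff' x. Qed.

(* smoothness by coinduction: [C] is a class of functions closed under derivation *)
Lemma smooth_coind (C : (R -> R) -> Prop) :
  (forall f, C f -> exists2 f', has_deriv f f' & C f') -> forall f, C f -> smooth f.
Proof.
move=> hC f + j; elim: j f => [|j ih] f Cf x; have [f' ff' Cf'] := hC f Cf.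
  by have [] := ff' x.
by rewrite derive1Sn (has_deriv_derive1 ff'); exact: ih.
Qed.

Lemma smooth_has_deriv f : smooth f -> has_deriv f (derive1 f).
Proof.
by move=> sf x; apply: DeriveDef; [exact: (sf 0%N)|rewrite derive1E].
Qed.

Lemma smooth_derive1 f : smooth f -> smooth (derive1 f).
Proof. by move=> sf j x; rewrite -derive1Sn. Qed.

Lemma smooth_continuous f : smooth f -> continuous f.
Proof.
by move=> sf x; apply: differentiable_continuous; apply/derivable1_diffP; exact: (sf 0%N).
Qed.

Lemma has_derivM f f' g g' : has_deriv f f' -> has_deriv g g' ->
  has_deriv (fun x => f x * g x) (fun x => f' x * g x + f x * g' x).
Proof.
move=> hf hg x; have := hf x; have := hg x => ? ?.
apply: (@is_derive_eq _ _ _ (f * g)) => /=.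
by rewrite addrC /GRing.scale/= (mulrC (g x)).
Qed.

Lemma has_derivD f f' g g' : has_deriv f f' -> has_deriv g g' ->
  has_deriv (fun x => f x + g x) (fun x => f' x + g' x).
Proof.
by move=> hf hg x; have := hf x; have := hg x => ? ?; apply: (@is_derive_eq _ _ _ (f + g)).
Qed.

(** By the Leibniz rule sums of products are closed under derivation, which single products are not;
    this makes [smooth_coind] applicable to products. *)
Inductive prod_span : (R -> R) -> Prop :=
| prod_span_mul f g : smooth f -> smooth g -> prod_span (fun x => f x * g x)
| prod_span_add f g : prod_span f -> prod_span g -> prod_span (fun x => f x + g x).

Lemma prod_span_smooth f : prod_span f -> smooth f.
Proof.
apply: smooth_coind => {}f; elim=> [{}f g sf sg|{}f g _ [f' ff' Cf'] _ [g' gg' Cg']].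
  exists (fun x => derive1 f x * g x + f x * derive1 g x).
    by apply: has_derivM; exact: smooth_has_deriv.
  by apply: prod_span_add; apply: prod_span_mul => //; exact: smooth_derive1.
by exists (fun x => f' x + g' x); [exact: has_derivD|exact: prod_span_add].
Qed.

Lemma smoothM f g : smooth f -> smooth g -> smooth (fun x => f x * g x).
Proof. by move=> sf sg; apply/prod_span_smooth/prod_span_mul. Qed.

Lemma smooth_cst c : smooth (cst c).
Proof.
apply: (@smooth_coind (fun f => exists c, f = cst c)); last by exists c.
by move=> _ [d ->]; exists (cst 0) => [x|]; [exact: is_derive_cst|exists 0].
Qed.

Lemma smoothD f g : smooth f -> smooth g -> smooth (fun x => f x + g x).
Proof.
move=> sf sg; have s1 := @smooth_cst 1.
rewrite (_ : (fun x => _) = fun x => f x * cst 1 x + g x * cst 1 x); last first.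
  by apply/funext => x; rewrite !mulr1.
by apply/prod_span_smooth/prod_span_add; exact: prod_span_mul.
Qed.

Lemma smoothZ c f : smooth f -> smooth (fun x => c * f x).
Proof. by move=> sf; apply: (smoothM (@smooth_cst c)). Qed.

(** The factor [k] is there to absorb the constants that the chain rule produces, so that the class
    is closed under derivation. *)
Lemma smooth_affine k f (a b : R) : smooth f -> smooth (fun x => k * f (a * x + b)).
Proof.
move=> sf; apply: (@smooth_coind (fun h => exists k f, smooth f /\ h = fun x => k * f (a * x + b))).
  move=> _ [l [h [sh ->]]]; exists (fun x => (l * a) * derive1 h (a * x + b)).
    move=> x; have hx : is_derive x 1 (fun x => a * x + b) a.
      apply: (@is_derive_eq _ _ _ ((a *: (@id R)) + cst b)).
      by rewrite addr0 /GRing.scale/= mulr1.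
    have := smooth_has_deriv sh (a * x + b) => hd.
    apply: (@is_derive_eq _ _ _ (l *: (h \o (fun x => a * x + b)))).
    by rewrite /GRing.scale/=; lra.
  by exists (l * a), (derive1 h); split => //; exact: smooth_derive1.
by exists k, f.
Qed.

Lemma expR_poly_le n (y : R) : 0 <= y -> y ^+ n * expR (- y) <= n`!%:R.
Proof.
move=> y0; rewrite expRN ler_pdivrMr ?expR_gt0//.
case: n => [|n]; first by rewrite expr0 mul1r; rewrite (le_trans _ (expR_ge1Dx y))// lerDl.
have := expR_ge1Dxn n y0.
have f0 : 0 < n.+1`!%:R :> R by rewrite ltr0n fact_gt0.
rewrite -(ler_pM2l f0) mulrDr mulr1 mulrCA mulfV ?gt_eqF// mulr1.
by apply: le_trans; rewrite lerDr ltW.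
Qed.

Lemma horner_exp_le (p : {poly R}) : exists2 C, 0 <= C &
  forall y, 0 <= y -> `|p.[y] * expR (- y)| <= C.
Proof.
exists (\sum_(i < size p) `|p`_i| * i`!%:R).
  by apply: sumr_ge0 => i _; rewrite mulr_ge0.
move=> y y0; rewrite horner_coef mulr_suml; apply: (le_trans (ler_norm_sum _ _ _)).
apply: ler_sum => i _; rewrite -mulrA normrM ler_wpM2l// ger0_norm ?expR_poly_le//.
by rewrite mulr_ge0 ?exprn_ge0 ?expR_ge0.
Qed.

(** For [p = 1] this is the classical smooth function all of whose derivatives vanish at the origin.
    The polynomial in 1/x makes the family stable under derivation, as [smooth_coind] requires: p
    becomes X^2 (p - p'). *)
Definition flat (p : {poly R}) (x : R) := if 0 < x then p.[x^-1] * expR (- x^-1) else 0.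

(** [horner_exp_le] for X^2 p, evaluated at 1/x. A bound of order x^2 is what gives derivative 0 at
    the origin. *)
Lemma flat_le p : exists2 C, 0 <= C & forall x, `|flat p x| <= C * x ^+ 2.
Proof.
have [C C0 hC] := horner_exp_le ('X^2 * p); exists C => // x.
rewrite /flat; case: ifPn => x0; last by rewrite normr0 mulr_ge0 ?sqr_ge0.
have x0' := ltW x0; have := hC x^-1; rewrite invr_ge0 x0' => /(_ isT).
rewrite hornerM hornerXn -mulrA normrM ger0_norm ?exprn_ge0 ?invr_ge0//.
by rewrite exprVn mulrC ler_pdivrMr// exprn_gt0.
Qed.

Lemma flat_deriv p : has_deriv (flat p) (flat ('X^2 * (p - p^`()))).
Proof.
move=> x; have [x0|x0|->] := ltrgt0P x.
- apply: (@near_eq_is_derive R R R (fun x => p.[x^-1] * expR (- x^-1))).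
    near=> y; rewrite /flat; suff -> : 0 < y by [].
    by near: y; exact: lt_nbhsr.
  rewrite /flat x0.
  have hV : is_derive x 1 (fun y : R => y^-1) (- x ^- 2).
    have xn0 : id x != 0 by rewrite gt_eqF.
    apply: (@is_derive_eq _ _ _ (fun y : R => (id y)^-1)).
    by rewrite /GRing.scale/= mulr1.
  have h1 : is_derive x 1 (horner p \o (fun y => y^-1)) (p^`().[x^-1] * - x ^- 2).
    by apply: is_derive1_comp.
  have h2 : is_derive x 1 (expR \o (fun y => - y^-1)) (expR (- x^-1) * x ^- 2).
    have : is_derive x 1 (fun y : R => - y^-1) (x ^- 2).
      by apply: (@is_derive_eq _ _ _ (- (fun y : R => y^-1))); rewrite opprK.
    by move=> ?; apply: is_derive1_comp.
  apply: (@is_derive_eq _ _ _ ((horner p \o (fun y => y^-1)) * (expR \o (fun y => - y^-1)))).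
  rewrite /GRing.scale/= hornerM hornerXn hornerD hornerN.
  by rewrite exprVn; ring.
- apply: (@near_eq_is_derive R R R (cst 0)).
    near=> y; rewrite /flat; suff : y < 0 by move=> /ltW; rewrite leNgt => /negbTE ->.
    by near: y; exact: lt_nbhsl.
  rewrite /flat ltNge (ltW x0)/=; exact: is_derive_cst.
- rewrite {2}/flat ltxx.
  have [C C0 hC] := flat_le p.
  have f0 : flat p 0 = 0 by rewrite /flat ltxx.
  have cv : h^-1 *: (flat p (h *: (1:R) + 0) - flat p 0) @[h --> 0^'] --> (0 : R).
    have c1 : 0 < C + 1 by rewrite ltr_pwDr.
    apply/cvgr0Pnorm_le => e e0; near=> h.
    have h0 : h != 0 by near: h; exact: nbhs_dnbhs_neq.
    rewrite f0 subr0 addr0 /GRing.scale/= mulr1 normrM normfV ler_pdivrMl ?normr_gt0//.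
    apply: (le_trans (hC h)); rewrite -(real_normK (num_real h)) expr2 mulrA mulrC.
    apply: ler_wpM2l => //.
    apply: (@le_trans _ _ ((C + 1) * `|h|)); first by rewrite ler_wpM2r// lerDl.
    rewrite -ler_pdivlMl// mulrC.
    near: h; apply: dnbhs0_le; rewrite ?mulr_gt0 ?invr_gt0//.
  apply: DeriveDef; first by apply/cvg_ex; exists 0.
  exact: cvg_lim cv.
Unshelve. all: by end_near. Qed.

Lemma flat_smooth p : smooth (flat p).
Proof.
apply: (@smooth_coind (fun f => exists p, f = flat p)); last by exists p.
by move=> _ [q ->]; exists (flat ('X^2 * (q - q^`()))); [exact: flat_deriv|exists ('X^2 * (q - q^`()))].
Qed.

End smooth.

Lemma le_Rintegral_subset {R : realType} (A B : set R) (f : R -> R) :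
  measurable A -> measurable B -> A `<=` B -> intg B f -> (forall x, 0 <= f x) ->
  \int[leb]_(x in A) f x <= \int[leb]_(x in B) f x.
Proof.
move=> mA mB AB If f0; rewrite -{1}(setIidr AB) Rintegral_mkcondr.
apply: le_Rintegral => //.
  by apply: intg_patch => //; exact: (@integrableS _ _ _ leb _ _ _ mB mA AB If).
by move=> x _; rewrite patchE; case: ifPn.
Qed.

(** * Test functions and the fundamental lemma of the calculus of variations *)

Section test_functions.
Context {R : realType}.
Implicit Types (a b c d x y : R) (f g phi : R -> R).

(** The dilation by n+1 makes the bumps tend pointwise to the indicator of ]c, d[, since
    exp(-1/((n+1) y)) tends to 1 for y > 0. Testing against bumps thus gives, in the limit,
    integrals over intervals. *)
Definition smooth_bump c d (n : nat) x : R :=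
  flat 1 (n.+1%:R * (x - c)) * flat 1 (n.+1%:R * (d - x)).

Lemma flat1E x : flat (1 : {poly R}) x = if 0 < x then expR (- x^-1) else 0.
Proof. by rewrite /flat hornerC mul1r. Qed.

Lemma flat1_ge0 x : 0 <= flat (1 : {poly R}) x.
Proof. by rewrite flat1E; case: ifP => // _; exact: expR_ge0. Qed.

Lemma flat1_le1 x : flat (1 : {poly R}) x <= 1.
Proof.
rewrite flat1E; case: ifPn => // x0; rewrite -[leRHS]expR0 ler_expR oppr_le0.
by rewrite invr_ge0 ltW.
Qed.

Lemma smooth_bump_ge0 c d n x : 0 <= smooth_bump c d n x.
Proof. by rewrite mulr_ge0// flat1_ge0. Qed.

Lemma smooth_bump_le1 c d n x : smooth_bump c d n x <= 1.
Proof. by rewrite -[leRHS]mulr1 ler_pM ?flat1_ge0 ?flat1_le1. Qed.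

Lemma smooth_bump_out c d n x : x \notin `]c, d[ -> smooth_bump c d n x = 0.
Proof.
rewrite in_itv/= negb_and -!leNgt /smooth_bump !flat1E => /orP[h|h].
  rewrite (_ : (0 < _ * (x - c)) = false) ?mul0r//.
  by apply/negbTE; rewrite -leNgt pmulr_rle0// subr_le0.
rewrite (_ : (0 < _ * (d - x)) = false) ?mulr0//.
by apply/negbTE; rewrite -leNgt pmulr_rle0// subr_le0.
Qed.

Lemma smooth_bump_gt0 c d n x : x \in `]c, d[ -> 0 < smooth_bump c d n x.
Proof.
rewrite in_itv/= => /andP[cx xd].
by rewrite /smooth_bump !flat1E !mulr_gt0 ?subr_gt0// ?expR_gt0.
Qed.

Lemma smooth_bump_cvg c d x : x \in `]c, d[ -> smooth_bump c d n x @[n --> \oo] --> (1 : R).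
Proof.
rewrite in_itv/= => /andP[cx xd].
have key y : 0 < y -> flat (1 : {poly R}) (n.+1%:R * y) @[n --> \oo] --> (1 : R).
  move=> y0; under eq_fun do rewrite flat1E mulr_gt0// invfM.
  have h : - (n.+1%:R^-1 * y^-1) @[n --> \oo] --> - (0 * y^-1 : R).
    by apply: cvgN; apply: cvgMl; exact: cvg_harmonic.
  have := @cvg_comp _ _ _ _ _ _ _ _ h (@continuous_expR R _).
  by rewrite mul0r oppr0 expR0.
have hc : 0 < x - c by rewrite subr_gt0.
have hd : 0 < d - x by rewrite subr_gt0.
have := cvgM (key _ hc) (key _ hd); rewrite mulr1; exact.
Qed.

Lemma smooth_bump_smooth c d n : smooth (smooth_bump c d n).
Proof.
rewrite (_ : smooth_bump c d n = fun x => (1 * flat 1 (n.+1%:R * x + (- n.+1%:R * c))) *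
    (1 * flat 1 ((- n.+1%:R) * x + n.+1%:R * d))).
  by apply: smoothM; apply: smooth_affine; exact: flat_smooth.
by apply/funext => x; rewrite /smooth_bump !mul1r; congr (flat 1 _ * flat 1 _); ring.
Qed.

Lemma smooth_bump_test a b c d n : a < c -> d < b -> test_fun a b (smooth_bump c d n).
Proof.
move=> ac db; split; first exact: smooth_bump_smooth.
exists c, d; split => // x xcd; apply: smooth_bump_out; apply: contra xcd.
by apply: subset_itvW.
Qed.

Lemma test_smooth a b phi : test_fun a b phi -> smooth phi. Proof. by case. Qed.

Lemma test_continuous a b phi : test_fun a b phi -> continuous phi.
Proof. by move=> /test_smooth; exact: smooth_continuous. Qed.

Lemma test_derive1 a b phi : test_fun a b phi -> test_fun a b (derive1 phi).
Proof.
move=> [sphi [c [d [ac db hphi]]]]; split; first exact: smooth_derive1.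
exists c, d; split => // x xcd; rewrite derive1E.
have : \forall y \near x, phi y = cst 0 y.
  have op : open (~` `[c, d]%classic) by rewrite openC; exact: itv_closed.
  have := open_nbhs_nbhs (conj op (_ : (~` `[c, d]%classic) x)) => /(_ (negP xcd)).
  by apply: filterS => y /negP; exact: hphi.
by move=> /near_eq_derive ->; rewrite derive_cst.
Qed.

Lemma test_derive1n a b n phi : test_fun a b phi -> test_fun a b (derive1n n phi).
Proof. by elim: n => [//|n ih] tphi; rewrite derive1nS; exact/test_derive1/ih. Qed.

Lemma testD a b phi psi : test_fun a b phi -> test_fun a b psi ->
  test_fun a b (fun x => phi x + psi x).
Proof.
move=> [s1 [c [d [ac db h1]]]] [s2 [c' [d' [ac' db' h2]]]]; split; first exact: smoothD.
exists (Num.min c c'), (Num.max d d'); split.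
- by rewrite lt_min ac ac'.
- by rewrite gt_max db db'.
move=> x; rewrite in_itv/= ge_min le_max => hx.
rewrite h1 ?h2 ?addr0//; rewrite in_itv/=; apply: contra hx => /andP[-> ->]; by rewrite ?orbT.
Qed.

Lemma testZ a b k phi : test_fun a b phi -> test_fun a b (fun x => k * phi x).
Proof.
move=> [s1 [c [d [ac db h1]]]]; split; first exact: smoothZ.
by exists c, d; split => // x /h1 ->; rewrite mulr0.
Qed.

Lemma test_bounded a b phi : test_fun a b phi -> exists2 K, 0 <= K & forall x, `|phi x| <= K.
Proof.
move=> tphi; have cphi := test_continuous tphi; have [_ [c [d [ac db h]]]] := tphi.
have [cd|cd] := leP c d; last first.
  exists 0 => // x; rewrite h ?normr0// in_itv/=; apply/negP => /andP[h1 h2].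
  by have := le_trans h1 h2; rewrite leNgt cd.
have [|x1 _ h1] := @EVT_max R (fun x => `|phi x|) c d cd.
  apply: continuous_subspaceT => x; apply: continuous_comp; first exact: cphi.
  exact: norm_continuous.
exists `|phi x1| => // x; have [/h1//|/h ->] := boolP (x \in `[c, d]).
by rewrite normr0.
Qed.

Lemma intg_continuous c d f : continuous f -> intg `[c, d] f.
Proof.
move=> cf; apply: continuous_compact_integrable; first exact: segment_compact.
exact: continuous_subspaceT.
Qed.

Lemma measurable_continuous D f : continuous f -> measurable_fun D f.
Proof. by move=> cf; apply: measurable_funTS; exact: continuous_measurable_fun. Qed.

Lemma intg_continuous_oo c d f : continuous f -> intg `]c, d[ f.
Proof.
move=> cf; apply: (@integrableS _ _ _ leb `[c, d]) => //; last exact: intg_continuous.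
exact: subset_itv_oo_cc.
Qed.

Lemma locally_intg a b c d g : a < c -> d < b -> locally_integrable `]a, b[ g -> intg `[c, d] g.
Proof.
move=> ac db [mg _ hg]; have sub : `[c, d] `<=` `]a, b[.
  move=> x /=; rewrite !in_itv/= => /andP[cx xd].
  by rewrite (lt_le_trans ac cx) (le_lt_trans xd db).
apply/integrableP; split.
  apply/measurable_EFinP; exact: (measurable_funS _ sub mg).
by apply: hg => //; exact: segment_compact.
Qed.

Lemma intg_test a b g phi : locally_integrable `]a, b[ g -> test_fun a b phi ->
  intg `]a, b[ (fun x => g x * phi x).
Proof.
move=> lg tphi; have [K K0 hK] := test_bounded tphi.
have [_ [c [d [ac db h]]]] := tphi; have cphi := test_continuous tphi.
have Ig := locally_intg ac db lg; have [mg _ _] := lg.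
have [cd|cd] := leP c d; last first.
  apply: (@eq_integrable _ _ _ leb _ _ (cst 0%E)) => //; last exact: integrable0.
  move=> x _ /=; rewrite h ?mulr0// in_itv/=; apply/negP => /andP[h1 h2].
  by have := le_trans h1 h2; rewrite leNgt cd.
have sub : `[c, d] `<=` `]a, b[.
  move=> x /=; rewrite !in_itv/= => /andP[cx xd].
  by rewrite (lt_le_trans ac cx) (le_lt_trans xd db).
have : intg `[c, d] (fun x => g x * phi x).
  rewrite (_ : (fun x => g x * phi x) = fun x => phi x * g x); last first.
    by apply/funext => x; rewrite mulrC.
  apply: (intgM (K := K)) => //; first exact: measurable_continuous.
  by apply: aeW => x _; exact: hK.
move=> /(intg_patch (measurable_itv _) (measurable_itv _) sub).
apply: eq_integrable => // x _ /=; rewrite patchE; case: ifPn => // xcd.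
by rewrite h ?mulr0//; apply: contra xcd; rewrite inE.
Qed.

Lemma cvg_smooth_bump_integral a b c d g : a < c -> d < b -> locally_integrable `]a, b[ g ->
  \int[leb]_(x in `]a, b[) (g x * smooth_bump c d n x) @[n --> \oo] --> \int[leb]_(x in `]c, d[) g x.
Proof.
move=> ac db lg; have [mg _ _] := lg.
have sub : `]c, d[ `<=` `]a, b[ by apply: subset_itvW; exact: ltW.
have E n : \int[leb]_(x in `]a, b[) (g x * smooth_bump c d n x) =
    \int[leb]_(x in `]c, d[) (g x * smooth_bump c d n x).
  rewrite -[in RHS](setIidr sub) Rintegral_mkcondr; apply: eq_Rintegral => x _.
  rewrite patchE; case: ifPn => // xcd; rewrite smooth_bump_out ?mulr0//.
  by apply: contra xcd; rewrite inE.
under eq_fun do rewrite E.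
have mgcd : measurable_fun `]c, d[ g by exact: (measurable_funS _ sub mg).
have mb n : measurable_fun `]c, d[ (fun x => g x * smooth_bump c d n x).
  apply: measurable_funM => //; apply: measurable_continuous.
  by apply: smooth_continuous; exact: smooth_bump_smooth.
have Ig : intg `]c, d[ (fun x => `|g x|).
  apply: (@integrable_norm _ _ _ leb).
  apply: (@integrableS _ _ _ leb `[c, d]) => //; last exact: locally_intg lg.
  exact: subset_itv_oo_cc.
have [] := @cvg_Rintegral_dominated _ _ (fun n x => g x * smooth_bump c d n x) g _ _ mb mgcd Ig => //.
  apply: aeW => x xcd; rewrite -{2}(mulr1 (g x)); apply: cvgMr.
  exact: smooth_bump_cvg.
apply: aeW => x _ n; rewrite normrM -[leRHS]mulr1 ler_wpM2l// ger0_norm ?smooth_bump_ge0//.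
exact: smooth_bump_le1.
Qed.

(** Lebesgue differentiation: almost everywhere [g] is the derivative of its primitive, which is 0
    by hypothesis. The truncation [f] of [g] to [c, d] is integrable on the whole line. *)
Lemma ae_eq0_itv a b c d g : a < c -> d < b -> locally_integrable `]a, b[ g ->
  (forall x y, a < x -> y < b -> \int[leb]_(t in `]x, y[) g t = 0) ->
  {ae leb, forall x : R, x \in `]c, d[ -> g x = 0}.
Proof.
move=> ac db lg h0; have Icd := locally_intg ac db lg.
pose f := g \_ `[c, d].
have lf : locally_integrable setT f by exact: integrable_locally_restrict.
have If (A : set R) : measurable A -> intg A f.
  move=> mA; apply: (@integrableS _ _ _ leb setT) => //.
  rewrite /f -restrict_EFin.
  by apply/(@integrable_mkcond _ _ _ leb _ _ (measurable_itv _)).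
have := @FTC1 R f (BLeft c) (fun y => If _ (measurable_itv _)) lf.
apply: aeS => x hx xcd; have [cx xd] : c < x /\ x < d by move: xcd; rewrite /= in_itv/= => /andP.
have [|_] := hx; first by rewrite /= lte_fin.
rewrite /f patchE mem_set; last by rewrite /= in_itv/= (ltW cx) (ltW xd).
move=> <-; rewrite derive1E.
rewrite (@near_eq_derive R R R _ (cst 0) x 1); first exact: derive_cst.
near=> y; rewrite /=.
have cy : c < y by near: y; exact: lt_nbhsr.
have yd : y < d by near: y; exact: lt_nbhsl.
rewrite -(h0 c y ac (lt_trans yd db)).
have Icy : intg `]c, y[ g.
  apply: (@integrableS _ _ _ leb `[c, d]) => // t /=; rewrite !in_itv/= => /andP[ct ty].
  by rewrite (ltW ct) (ltW (lt_trans ty yd)).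
have Icy' : intg `[c, y[ g.
  apply: (@integrableS _ _ _ leb `[c, d]) => // t /=; rewrite !in_itv/= => /andP[ct ty].
  by rewrite ct (ltW (lt_trans ty yd)).
rewrite (@Rintegral_itv_obnd_cbnd R c (BLeft y))// Rintegral_itv_bndo_bndc//.
apply: eq_Rintegral => t; rewrite inE/= in_itv/= => /andP[ct ty].
by rewrite patchE mem_set//= in_itv/= ct (le_trans ty (ltW yd)).
Unshelve. all: by end_near. Qed.

(** Bumps turn the hypothesis into vanishing integrals over intervals well inside ]a, b[. As [g] is
    only locally integrable, the conclusion is drawn on the intervals ]a + 1/(n+1), b -
    1/(n+1)[, which exhaust ]a, b[. *)
Lemma fundamental_lemma a b g : locally_integrable `]a, b[ g ->
  (forall phi, test_fun a b phi -> \int[leb]_(x in `]a, b[) (g x * phi x) = 0) ->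
  {ae leb, forall x : R, x \in `]a, b[ -> g x = 0}.
Proof.
move=> lg h0.
have h1 x y : a < x -> y < b -> \int[leb]_(t in `]x, y[) g t = 0.
  move=> ax yb; have := cvg_smooth_bump_integral ax yb lg.
  rewrite (_ : (fun n => _) = cst 0); last first.
    by apply/funext => n; rewrite h0//; exact: smooth_bump_test.
  move=> h; apply/eqP; rewrite -(cvg_lim _ h)//.
  by rewrite lim_cst.
pose s (n : nat) := (n.+1%:R^-1 : R).
have s0 n : 0 < s n by rewrite /s invr_gt0.
have : {ae leb, forall x : R, forall n, x \in `]a + s n, b - s n[ -> g x = 0}.
  apply: ae_foralln => n; apply: ae_eq0_itv h1 => //.
    by rewrite ltrDl s0.
  by rewrite ltrBlDr ltrDl s0.
apply: aeS => x hx; rewrite /= in_itv/= => /andP[ax xb].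
have [n hn] : exists n, s n < Num.min (x - a) (b - x).
  have m0 : 0 < Num.min (x - a) (b - x) by rewrite lt_min !subr_gt0 ax.
  exists (Num.truncn (Num.min (x - a) (b - x))^-1).
  by rewrite /s invf_plt ?posrE// truncnS_gt.
apply: (hx n); rewrite /= in_itv/=; move: hn; rewrite lt_min => /andP[h2 h3].
by apply/andP; split; [rewrite -ltrBrDl|rewrite ltrBrDr -ltrBrDl].
Qed.

(** The primitive of [w] started to the left of its support vanishes again to the right of it
    because [w] has integral 0. The bound by the L^1 norm is for the trace estimate. *)
Lemma test_primitive a b w : test_fun a b w -> \int[leb]_(x in `]a, b[) w x = 0 ->
  exists phi, [/\ test_fun a b phi, derive1 phi = w &
    forall x, `|phi x| <= \int[leb]_(x in `]a, b[) `|w x|].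
Proof.
move=> tw w0; have cw := test_continuous tw; have [sw [c [d [ac db h]]]] := tw.
have mw (D : set R) : measurable_fun D w by exact: measurable_continuous.
(* Strictly between [a] and the support: the fundamental theorem of calculus then applies on the
   whole support, and the primitive is still supported inside ]a, b[. *)
pose e := (a + c) / 2.
have ae : a < e by rewrite /e; lra.
have ec : e < c by rewrite /e; lra.
pose F x := \int[leb]_(t in `[e, x]) w t.
have Iw x y : intg `[x, y] w by exact: intg_continuous.
have wlt x : x < c -> w x = 0 by move=> xc; rewrite h// in_itv/= leNgt xc.
have wP f (D : set R) : (forall x, x \notin `[c, d] -> f x = 0) -> measurable D ->
    \int[leb]_(t in D) f t = \int[leb]_(t in D `&` `[c, d]) f t.
  move=> hf mD; rewrite Rintegral_mkcondr; apply: eq_Rintegral => x _.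
  by rewrite patchE; case: ifPn => // xcd; rewrite hf//; apply: contra xcd; rewrite inE.
have abP : `]a, b[%classic `&` `[c, d]%classic = `[c, d]%classic :> set R.
  apply/setIidr => x /=; rewrite !in_itv/= => /andP[cx xd].
  by rewrite (lt_le_trans ac cx) (le_lt_trans xd db).
have F0 x : x < c -> F x = 0.
  move=> xc; rewrite /F (@eq_Rintegral _ _ _ leb _ (cst 0)) ?Rintegral_cst ?mul0r// => t.
  by rewrite inE/= in_itv/= => /andP[_ tx]; apply: wlt; exact: le_lt_trans tx xc.
have Fd x : d < x -> F x = 0.
  move=> dx; rewrite /F wP// (_ : _ `&` _ = `[c, d]%classic); first by rewrite -abP -wP.
  apply/setIidr => t /=; rewrite !in_itv/= => /andP[ct td].
  by rewrite (le_trans (ltW ec) ct) (le_trans td (ltW dx)).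
have hF : has_deriv F w.
  move=> x; have [xc|cx] := ltP x c.
    rewrite wlt//; apply: (@near_eq_is_derive R R R (cst 0)).
    by near=> y; rewrite F0//; near: y; exact: lt_nbhsl.
  have ex : e < x by exact: lt_le_trans ec cx.
  have x1 : x < x + 1 by rewrite ltrDl.
  have [dF F'] := @continuous_FTC1_closed R w e x (x + 1) x1 (Iw _ _) ex (cw x).
  have F'' : 'D_1 F x = w x by rewrite -derive1E F'.
  exact: (DeriveDef dF F'').
exists F; split; last first.
- move=> x; apply: le_trans (@le_normr_Rintegral _ _ _ leb _ _ (measurable_itv _) (Iw _ _)) _.
  have nw y : y \notin `[c, d] -> `|w y| = 0 by move=> /h ->; rewrite normr0.
  rewrite (wP (fun x => `|w x|))// [leRHS](wP (fun x => `|w x|))// abP.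
  apply: le_Rintegral_subset => //; first exact: measurableI.
  apply: (@integrable_norm _ _ _ leb); exact: Iw.
- exact: has_deriv_derive1.
split.
  apply: (@smooth_coind _ (fun f => f = F \/ smooth f)); last by left.
  move=> f [->|sf]; first by exists w => //; right.
  exists (derive1 f); first exact: smooth_has_deriv.
  by right; exact: smooth_derive1.
exists e, d; split => // x; rewrite in_itv/= negb_and -!ltNge => /orP[xe|]; last exact: Fd.
by apply: F0; exact: lt_trans ec.
Unshelve. all: by end_near. Qed.

End test_functions.

(** * Weak derivatives with respect to time *)

Section time.
Context {R : realType}.
Implicit Types (X Y Z : fspace (R:=R)) (T t : R) (v : R -> R -> R).

Lemma ae_itv_ex (c d : R) (P : R -> Prop) : c < d -> {ae leb, forall x : R, P x} ->
  exists2 x, x \in `]c, d[ & P x.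
Proof.
move=> cd [N [mN N0 PN]]; apply: contrapT => h.
have sub : `]c, d[ `<=` N.
  by move=> x xcd; apply: PN => /= Px; apply: h; exists x.
have : (leb `]c, d[%classic <= leb N)%E by apply: le_leb.
rewrite N0 lebesgue_measure_itv/= lte_fin cd -EFinD lee_fin subr_le0.
by rewrite leNgt cd.
Qed.

Lemma Rintegral_gt0 (D : set R) (c d : R) (f : R -> R) : measurable D -> intg D f ->
  (forall x, 0 <= f x) -> c < d -> `]c, d[ `<=` D ->
  (forall x, x \in `]c, d[ -> 0 < f x) -> 0 < \int[leb]_(x in D) f x.
Proof.
move=> mD If f0 cd sub fpos; rewrite lt_def Rintegral_ge0// andbT.
apply/negP => /eqP fint.
have := @ae_eq_integral_abs _ _ _ leb D mD (EFin \o f) (measurable_int _ If).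
move=> [+ _].
rewrite (_ : (\int[leb]_(t in D) `|(EFin \o f) t|)%E = 0%E); last first.
  transitivity (\int[leb]_(t in D) (f t)%:E)%E.
    by apply: eq_integral => t _ /=; rewrite ger0_norm.
  by rewrite ge0_integral_Rintegral// fint.
move=> /(_ erefl) /(ae_itv_ex cd)[x xcd /(_ (sub _ xcd)) []].
by move=> fx0; have := fpos x xcd; rewrite fx0 ltxx.
Qed.

(** Compactness of [0, T], for a pseudo-distance [D]; in this form it serves real functions and
    functions with values in a seminormed space alike. *)
Lemma heine T (D : R -> R -> R) :
  (forall s t, s \in `[0, T] -> t \in `[0, T] -> D s t = D t s) ->
  (forall s t r, s \in `[0, T] -> t \in `[0, T] -> r \in `[0, T] -> D s r <= D s t + D t r) ->
  (forall t, t \in `[0, T] -> forall e, 0 < e -> exists2 d, 0 < d &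
    forall s, s \in `[0, T] -> `|s - t| < d -> D s t <= e) ->
  forall e, 0 < e -> exists2 d, 0 < d & forall s t, s \in `[0, T] -> t \in `[0, T] ->
    `|s - t| < d -> D s t <= e.
Proof.
move=> Dsym Dtri Dc e e0.
have /compact_near_coveringP/(_ R (0^'+) (fun d t => forall s, s \in `[0, T] -> t \in `[0, T] -> `|s - t| < d -> D s t <= e) _) := @segment_compact R 0 T.
have e2 : 0 < e / 2 by rewrite divr_gt0.
case=> [t tT|d /= d0 hd].
  have [d d0 hd] := Dc t tT _ e2.
  have d2 : 0 < d / 2 by rewrite divr_gt0.
  exists (ball t (d / 2), [set x | 0 < x /\ x < d / 2]); first split.
  - exact: nbhsx_ballx.
  - exists (d / 2) => // x /=; rewrite sub0r normrN => xd x0; split => //.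
    by rewrite (le_lt_trans (ler_norm _) xd).
  move=> [t' d'] /= [tt' [d'0 d'd]] s sT t'T st'.
  have tt2 : `|t' - t| < d / 2 by rewrite distrC.
  rewrite (splitr e) (le_trans (Dtri s t t' sT tT t'T))// lerD//.
    apply: hd => //; rewrite (splitr d) (_ : s - t = (s - t') + (t' - t)); last by lra.
    by rewrite (le_lt_trans (ler_normD _ _))// ltrD// (lt_trans st').
  rewrite Dsym//; apply: hd => //; apply: lt_trans tt2 _.
  by rewrite ltr_pdivrMr// ltr_pMr// ltrDl.
exists (d / 2); first by rewrite divr_gt0.
move=> s t sT tT st; apply: (hd (d / 2)) => //=; last by rewrite divr_gt0.
rewrite sub0r normrN ger0_norm ?divr_ge0 ?(ltW d0)//.
by rewrite ltr_pdivrMr// ltr_pMr// ltrDl.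
Qed.

(** Half-open cells of length less than [d], marked by their left end points. Every [t] lies in
    exactly one of them, so a sum of indicators collapses to one term. *)
Lemma grid T d : 0 < T -> 0 < d -> exists (n : nat) (A : nat -> set R) (tau : nat -> R),
  [/\ forall j, measurable (A j), forall j, (j < n)%N -> tau j \in `[0, T] &
  forall t, `]0, T[%classic t -> exists2 j0, (j0 < n)%N &
    (forall j, \1_(A j) t = (j == j0)%:R :> R) /\ `|t - tau j0| < d].
Proof.
move=> T0 d0; pose n := Num.truncn (T / d).
pose h := T / n.+1%:R.
have h0 : 0 < h by rewrite divr_gt0.
have hd : h < d.
  by rewrite /h ltr_pdivrMr// mulrC -ltr_pdivrMr// truncnS_gt.
have hT : n.+1%:R * h = T by rewrite /h mulrC divfK// pnatr_eq0.
exists n.+1, (fun j => `[j%:R * h, j.+1%:R * h[%classic), (fun j => j%:R * h); split.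
- by move=> j; exact: measurable_itv.
- move=> j jn; rewrite in_itv/= mulr_ge0 ?(ltW h0)//= -hT ler_pM2r// ler_nat.
  exact: ltnW.
move=> t; rewrite /= in_itv/= => /andP[t0 tT].
have th0 : 0 <= t / h by rewrite divr_ge0 ?ltW.
have /andP[h1 h2] := truncn_itv th0.
have h1' : (Num.truncn (t / h))%:R * h <= t by rewrite -ler_pdivlMr.
have h2' : t < (Num.truncn (t / h)).+1%:R * h by rewrite -ltr_pdivrMr.
exists (Num.truncn (t / h)).
  rewrite -(ltr_nat R) -(ltr_pM2r h0) hT; exact: le_lt_trans tT.
split => [j|].
  rewrite indicE; congr (_%:R); congr nat_of_bool.
  apply/idP/eqP => [|->]; last by rewrite inE/= in_itv/= h1' h2'.
  rewrite inE/= in_itv/= => /andP[jt tj].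
  apply/eqP; rewrite eqn_leq; apply/andP; split; rewrite -ltnS -(ltr_nat R) -(ltr_pM2r h0).
    exact: le_lt_trans jt h2'.
  exact: le_lt_trans h1' tj.
rewrite ger0_norm ?subr_ge0//; apply: lt_trans hd.
by rewrite ltrBlDl -[X in _ < _ + X]mul1r -mulrDl natr1.
Qed.

Lemma sum_indic_nat n j0 (c : nat -> R) : (j0 < n)%N ->
  \sum_(j < n) ((j : nat) == j0)%:R * c j = c j0.
Proof.
move=> jn; rewrite (bigD1 (Ordinal jn))//= eqxx mul1r big1 ?addr0// => i ij.
rewrite (_ : (i == j0 :> nat) = false) ?mul0r//; apply/negbTE.
by apply: contra ij => /eqP ij; apply/eqP/val_inj.
Qed.

Section step.
Variables (Y Z : fspace (R:=R)) (bY : banach Y) (bZ : banach Z) (T K : R).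
Variable B : R -> (R -> R) -> R -> R.
Hypotheses (T0 : 0 < T) (bB : forall t, t \in `[0, T] -> bop Y Z (B t) K).
Hypothesis ucB : forall e, 0 < e -> exists2 d, 0 < d &
  forall s t, s \in `[0, T] -> t \in `[0, T] -> `|s - t| < d ->
  forall y, fmem Y y -> nrm Z (B s y \- B t y) <= e * nrm Y y.

Let I : set R := `]0, T[%classic.
Let mI : measurable I. Proof. exact: measurable_itv. Qed.
Let Ioo : (leb I < +oo)%E.
Proof. by rewrite /I lebesgue_measure_itv/= lte_fin T0 -EFinD ltry. Qed.

(** Replacing [B] by its values at the points of a grid gives a finite sum of integrable functions,
    with an error of at most e/(M+1) times the norm of [v t]. This is how the product of a
    continuous factor, a scalar weight or the kernel k(t - s), and an integrable one is shown to be
    integrable. *)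
Lemma Bint_step v : Bint Y I v -> Bint Z I (fun t => B t (v t)).
Proof.
move=> Bv; have [mu [Imu mu0 Nmu _]] := Bint_nrm bY mI Ioo Bv; have mv := Bint_mem Bv.
have IT t : I t -> t \in `[0, T] by exact: subset_itv_oo_cc.
apply: (Bint_lim bZ mI Ioo).
  by apply: aeS mv => t mv It; apply: (bop_mem (bB (IT _ It))); exact: mv.
move=> e e0; set M := \int[leb]_(t in I) mu t.
have M0 : 0 <= M by apply: Rintegral_ge0.
have e1 : 0 < e / (M + 1) by rewrite divr_gt0// ltr_wpDl.
have [d d0 hd] := ucB e1.
have [n [A [tau [mA htau hA]]]] := grid T0 d0.
exists (fun t r => \sum_(j < n) \1_(A j) t * B (tau j) (v t) r), (fun t => e / (M + 1) * mu t).
split.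
- apply: (BI_sum bZ (V := fun j t r => \1_(A j) t * B (tau j) (v t) r)) => // j jn.
  have [w hw] := Bint_bop bY bZ (bB (htau j jn)) mI Bv.
  have mAI : measurable (A j `&` I) by exact: measurableI.
  have [w' hw'] : Bint Z (A j `&` I) (fun t => B (tau j) (v t)).
    by apply: (@Bint_sub _ _ bZ I) => //; exists w.
  exists w'.
  have subI : A j `&` I `<=` I by move=> ? [].
  apply: (BI_ext bZ (BI_extend bZ mI mAI subI hw')).
  apply: aeW => t It; apply/funext => r; congr (_ * _).
  by rewrite indicI/= [X in _ * X]indicE mem_set// mulr1.
- exact: intgZ.
- apply: aeS2 mv Nmu => t mv Nmu It; have [j0 j0n [hj td]] := hA t It.
  rewrite (_ : (fun r => _) = B (tau j0) (v t)); last first.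
    by apply/funext => r; under eq_bigr do rewrite hj; rewrite (sum_indic_nat (fun j => B (tau j) (v t) r)).
  rewrite -Nmu//; apply: hd => //; [exact: IT|exact: htau|exact: mv].
- rewrite RintegralZl// -/M mulrAC ler_pdivrMr ?ltr_wpDl//.
  by rewrite ler_wpM2l ?(ltW e0)// lerDl.
Qed.

End step.
End time.

(** * Scalar weights and test functions in time *)

Section time_tests.
Context {R : realType}.
Implicit Types (X : fspace (R:=R)) (T t : R) (v : R -> R -> R) (phi : R -> R).

Lemma unif_continuous T phi : continuous phi -> forall e, 0 < e -> exists2 d, 0 < d &
  forall s t, s \in `[0, T] -> t \in `[0, T] -> `|s - t| < d -> `|phi s - phi t| <= e.
Proof.
move=> cphi; apply: (@heine _ T (fun s t => `|phi s - phi t|)) => [s t _ _|s t r _ _ _|t _ e e0].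
- exact: distrC.
- by rewrite (le_trans _ (ler_normD _ _))// le_eqVlt; apply/orP; left; apply/eqP; congr (`|_|); lra.
have /cvgrPdist_le/(_ _ e0) [d /= d0 hd] := cphi t.
by exists d => // s _ st; rewrite distrC; apply: hd; rewrite /= distrC.
Qed.

Lemma bound_continuous T phi : 0 < T -> continuous phi ->
  exists2 K, 0 <= K & forall t, t \in `[0, T] -> `|phi t| <= K.
Proof.
move=> T0 cphi; have [|x1 _ h1] := @EVT_max R (fun x => `|phi x|) 0 T (ltW T0).
  apply: continuous_subspaceT => x; apply: continuous_comp; first exact: cphi.
  exact: norm_continuous.
by exists `|phi x1|.
Qed.

Section tests.
Variables (X : fspace (R:=R)) (bX : banach X) (T : R) (T0 : 0 < T).
Local Notation N := (nrm X).
Local Notation mem := (fmem X).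
Let I : set R := `]0, T[%classic.
Let mI : measurable I. Proof. exact: measurable_itv. Qed.
Let Ioo : (leb I < +oo)%E.
Proof. by rewrite /I lebesgue_measure_itv/= lte_fin T0 -EFinD ltry. Qed.
Let lebI : fine (leb I) = T.
Proof. by rewrite /I lebesgue_measure_itv/= lte_fin T0/= subr0. Qed.
Let IT t : I t -> t \in `[0, T]. Proof. exact: subset_itv_oo_cc. Qed.

Lemma bop_scale c K : `|c| <= K -> bop X X (fun f r => c * f r) K.
Proof.
move=> cK; split => [|f mf|f mf|f g mf mg|d f mf].
- exact: le_trans cK.
- exact: memZ.
- by rewrite nrmZ// ler_wpM2r// nrm_ge0.
- rewrite [X in N X](_ : _ = fun=> 0) ?nrm0//; apply/funext => r /=; lra.
- rewrite [X in N X](_ : _ = fun=> 0) ?nrm0//; apply/funext => r /=; lra.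
Qed.

Lemma Bint_scale phi v : continuous phi -> Bint X I v -> Bint X I (fun t r => phi t * v t r).
Proof.
move=> cphi Bv; have [K K0 hK] := bound_continuous T0 cphi.
apply: (@Bint_step _ _ _ bX bX T K (fun t f r => phi t * f r) T0) => //.
  by move=> t tT; apply: bop_scale; exact: hK.
move=> e e0; have [d d0 hd] := unif_continuous T cphi e0; exists d => // s t sT tT st y my.
rewrite [X in N X](_ : _ = fun r => (phi s - phi t) * y r).
  by rewrite nrmZ// ler_wpM2r ?nrm_ge0// hd.
by apply/funext => r /=; rewrite mulrBl.
Qed.

(** A step function on a fine grid approximates [phi]. With a weight of mass 1 this writes [f] as an
    integral, as needed for the trace at time 0. *)
Lemma BI_scale_cst phi f : continuous phi -> mem f ->
  BI X I (fun t r => phi t * f r) (fun r => (\int[leb]_(t in I) phi t) * f r).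
Proof.
move=> cphi mf; split; [exact: memZ|by apply: aeW => t _; exact: memZ|].
move=> e e0; have N1 : 0 < (T + 1) * (N f + 1) by rewrite mulr_gt0// ltr_wpDl ?nrm_ge0 ?ltW.
set e' := e / ((T + 1) * (N f + 1)).
have e'0 : 0 < e' by rewrite divr_gt0.
have eb : e' * T * N f <= e.
  have -> : e = e' * ((T + 1) * (N f + 1)) by rewrite divfK// gt_eqF.
  rewrite -mulrA ler_pM2l//; apply: ler_pM; rewrite ?nrm_ge0 ?(ltW T0)//.
    by rewrite lerDl.
  by rewrite lerDl.
have [d d0 hd] := unif_continuous T cphi e'0.
have [n [A [tau [mA htau hA]]]] := grid T0 d0.
pose s : simple_fun X := SimpleFun n mA (fun i => memZ bX (phi (tau i)) mf).
pose ph t := \sum_(j < n) \1_(A j) t * phi (tau j).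
have sE t : simple_eval s t = fun r => ph t * f r.
  by apply/funext => r; rewrite /simple_eval /ph mulr_suml; apply: eq_bigr => i _; rewrite mulrA.
have phE t : I t -> `|phi t - ph t| <= e'.
  move=> It; have [j0 j0n [hj td]] := hA t It.
  rewrite /ph; under eq_bigr do rewrite hj; rewrite (sum_indic_nat (fun j => phi (tau j)))//.
  by apply: hd => //; [exact: IT|exact: htau].
have Ii B : measurable B -> intg I (\1_B : R -> R).
  move=> mB; apply: measurable_bounded_integrable => //.
  exists 1; split => // M M1 x _ /=; rewrite indicE.
  by case: (_ \in _); rewrite ?normr0 ?normr1 ?(ltW M1)// (le_trans _ (ltW M1)).
have [Iph phI] : intg I ph /\ \int[leb]_(t in I) ph t =
    \sum_(j < n) fine (leb (A j `&` I)) * phi (tau j).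
  rewrite /ph; elim: (n) => [|m [ih1 ih2]].
    have -> : (fun t => \sum_(j < 0) \1_(A j) t * phi (tau j)) = cst 0.
      by apply/funext => t; rewrite big_ord0.
    rewrite big_ord0; split; first exact: (intg_cst 0 mI Ioo).
    by rewrite (@Rintegral_cst _ _ _ leb _ mI) mul0r.
  have E : (fun t => \sum_(j < m.+1) \1_(A j) t * phi (tau j)) =
      (fun t => \sum_(j < m) \1_(A j) t * phi (tau j) + phi (tau m) * \1_(A m) t).
    by apply/funext => t; rewrite big_ord_recr/= (mulrC (phi _)).
  rewrite E; have I2 := intgZ (phi (tau m)) mI (Ii _ (mA m)); split; first exact: intgD.
  rewrite RintegralD// ih2 RintegralZl//; last exact: Ii.
  rewrite big_ord_recr/= mulrC; congr (_ + _); congr (_ * _).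
  by rewrite /Rintegral (@integral_indic _ _ _ leb _ mI)//; exact: mA.
exists s, (fun=> e' * N f); split; first split.
- exact: intg_cst.
- apply: aeW => t It; rewrite sE [X in N X](_ : _ = fun r => (phi t - ph t) * f r).
    by rewrite nrmZ// ler_wpM2r ?nrm_ge0// phE.
  by apply/funext => r /=; rewrite mulrBl.
- rewrite (@Rintegral_cst _ _ _ leb _ mI) lebI.
  by rewrite -mulrA (mulrC (N f)) mulrA.
have Iphi : intg I phi by exact: intg_continuous_oo.
rewrite [X in N X](_ : _ = fun r => (\int[leb]_(t in I) (phi t - ph t)) * f r); last first.
  apply/funext => r /=; rewrite RintegralB// mulrBl phI; congr (_ - _).
  by rewrite /simple_int/= mulr_suml; apply: eq_bigr => i _; rewrite mulrA.
rewrite nrmZ//; apply: (@le_trans _ _ (e' * T * N f)).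
  apply: ler_wpM2r; first exact: nrm_ge0.
  have := @le_norm_Rintegral_ae _ I (fun t => phi t - ph t) (fun=> e') mI.
  rewrite (@Rintegral_cst _ _ _ leb _ mI) lebI.
  apply; [exact: intgB|exact: intg_cst|by apply: aeW].
exact: eb.
Qed.

(** The fundamental lemma for vector-valued functions. The class [H] of sets over which [v]
    integrates to 0 contains the intervals, as limits of smooth bumps, and is closed under proper
    differences and increasing unions. Intervals being stable under intersection, it contains all
    Borel sets, and [Bint_zero_sets] applies. *)
Lemma Bint_zero_tests v : Bint X I v ->
  (forall phi, test_fun 0 T phi -> N (bochner_int X I (fun t r => phi t * v t r)) = 0) ->
  {ae leb, forall t, I t -> N (v t) = 0}.
Proof.
move=> Bv hv.
pose H A := measurable A /\ exists2 w, BI X I (fun t r => \1_A t * v t r) w & N w = 0.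
have Hlim (F : nat -> set R) (A : set R) : measurable A -> (forall n, H (F n)) ->
    (forall t, I t -> \1_(F n) t @[n --> \oo] --> (\1_A t : R)) -> H A.
  move=> mA HF FA; split => //.
  refine (@Bint_scal_lim _ X bX I (fun n => \1_(F n) : R -> R) (\1_A : R -> R) v mI Ioo Bv _ _ _ _ _) => //.
  - by move=> n; apply: measurable_indic; have [] := HF n.
  - by move=> n t _; rewrite indicE; case: (_ \in _); rewrite ?normr0 ?normr1.
  - by move=> n; have [] := HF n.
have H1 (c d : R) : 0 < c -> d < T -> H `]c, d[%classic.
  move=> c0 dT; split => //.
  refine (@Bint_scal_lim _ X bX I (smooth_bump c d) (\1_(`]c, d[%classic) : R -> R) v mI Ioo Bv _ _ _ _ _) => //.
  - by move=> n; apply: measurable_continuous; apply: smooth_continuous; exact: smooth_bump_smooth.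
  - by move=> n t _; rewrite ger0_norm ?smooth_bump_ge0// smooth_bump_le1.
  - move=> t _; rewrite indicE; case: (boolP (_ \in _)) => tcd.
      by apply: smooth_bump_cvg; move: tcd; rewrite inE.
    rewrite (_ : (fun n => _) = cst 0); first exact: cvg_cst.
    by apply/funext => n; rewrite smooth_bump_out//; apply: contra tcd; rewrite inE.
  - move=> n; have tb := smooth_bump_test n c0 dT.
    have [w hw] := Bint_scale (test_continuous tb) Bv.
    have hb := Bint_bochner_int bX mI Ioo (ex_intro _ w hw).
    by exists (bochner_int X I (fun t r => smooth_bump c d n t * v t r)); last exact: hv.
have H2 (c d : R) : 0 <= c -> d <= T -> H `]c, d[%classic.
  move=> c0 dT; pose s (n : nat) := (n.+1%:R^-1 : R).
  have s0 n : 0 < s n by rewrite /s invr_gt0.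
  apply: (@Hlim (fun n => `]c + s n, d - s n[%classic)) => //.
    move=> n; apply: H1; first by rewrite ltr_wpDl.
    by rewrite ltrBlDr (le_lt_trans dT)// ltrDl.
  move=> t _; rewrite [in X in _ --> X]indicE; case: (boolP (_ \in _)) => tcd.
    move: tcd; rewrite inE/= in_itv/= => /andP[ct td].
    have m0 : 0 < Num.min (t - c) (d - t) by rewrite lt_min !subr_gt0 ct.
    apply: cvg_near_cst; near=> n; rewrite indicE mem_set//= in_itv/=.
    have : s n < Num.min (t - c) (d - t).
      near: n; have /cvgrPdist_lt/(_ _ m0) := @cvg_harmonic R.
      by apply: filterS => n; rewrite /= sub0r normrN ger0_norm.
    rewrite lt_min => /andP[h2 h3].
    by apply/andP; split; [rewrite -ltrBrDl|rewrite ltrBrDr -ltrBrDl].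
  rewrite (_ : (fun n => _) = cst 0); first exact: cvg_cst.
  apply/funext => n; rewrite indicE memNset//= => /=; apply: contraNnot tcd.
  rewrite in_itv/= inE/= in_itv/= => /andP[h2 h3]; apply/andP; split.
    by apply: lt_trans h2; rewrite ltrDl.
  by apply: lt_trans h3 _; rewrite ltrBlDr ltrDl.
have Hext A A' : measurable A' -> H A -> {ae leb, forall t, I t -> \1_A t = \1_A' t :> R} -> H A'.
  move=> mA' [mA [w hw w0]] AA'; split => //; exists w => //; apply: (BI_ext bX hw).
  by apply: aeS AA' => t h It; apply/funext => r; rewrite h.
(* The generating intervals are closed on the right and have arbitrary end points. Only their trace
   on ]0, T[ matters, and the point [d] is a null set. *)
have H3 (c d : R) : H `]c, d]%classic.
  apply: (Hext `]Num.max c 0, Num.min d T[%classic) => //.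
    by apply: H2; [rewrite le_max lexx orbT|rewrite ge_min lexx orbT].
  exists [set d]; split => //; first exact: lebesgue_measure_set1.
  move=> t /= /not_implyP[]; rewrite /I/= in_itv/= => /andP[t0 tT] h.
  apply: contrapT => td; apply: h; rewrite !indicE; congr ((nat_of_bool _)%:R).
  apply/idP/idP; rewrite !inE/= !in_itv/= gt_max lt_min t0 tT !andbT.
    by move=> /andP[-> /ltW ->].
  by move=> /andP[-> td']; rewrite lt_neqAle td' andbT; apply/eqP.
have HT : H setT.
  apply: (Hext `]0, T[%classic) => //; first exact: H2.
  by apply: aeW => t It; rewrite !indicE !mem_set.
have HD A A' : A' `<=` A -> H A -> H A' -> H (A `\` A').
  move=> AA [mA [w hw w0]] [mA' [w' hw' w0']]; split; first exact: measurableD.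
  have mw : mem w by case: hw. have mw' : mem w' by case: hw'.
  exists (w \- w').
    apply: BI_ext (BI_B bX mI hw hw') _ => //; apply: aeW => t It; apply/funext => r /=.
    rewrite -mulrBl; congr (_ * _); rewrite !indicE.
    have [tA|tA] := pselect (A t); have [tA'|tA'] := pselect (A' t).
    - rewrite (mem_set tA) (mem_set tA') memNset ?subrr//; by case.
    - rewrite (mem_set tA) (memNset tA') mem_set ?subr0//.
    - by have := tA (AA _ tA').
    - rewrite (memNset tA) (memNset tA') memNset ?subr0//; by case.
  apply/eqP; rewrite eq_le nrm_ge0// andbT.
  by rewrite (le_trans (nrmB bX mw mw'))// w0 w0' addr0.
have HU : ndseq_closed H.
  move=> F ndF HF; apply: (Hlim F) => //.
    by apply: bigcupT_measurable => n; have [] := HF n.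
  move=> t It; have [[n _ Fn]|nF] := pselect ((\bigcup_n F n) t).
    apply: cvg_near_cst; exists n => // m /= nm; rewrite !indicE !mem_set//; first by exists n.
    by have /subsetPset := ndF _ _ nm; apply.
  rewrite (_ : (fun n => _) = cst 0); first by rewrite indicE memNset//; exact: cvg_cst.
  by apply/funext => n; rewrite indicE memNset// => Fn; apply: nF; exists n.
have HA A : measurable A -> H A.
  move=> mA.
  have := @lambda_system_subset _ (@ocitv R) (@ocitvI R) setT H.
  move=> /(_ _ _ _ A mA); apply => //.
  by move=> _ [[c d] _ <-]; exact: H3.
apply: (Bint_zero_sets bX mI Ioo Bv) => A mA AI.
have [_ [w hw w0]] := HA A mA; exists w => //.
exact: (BI_restrict bX mI).
Unshelve. all: by end_near. Qed.

End tests.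
End time_tests.

(** * Weak time derivatives and the trace at time 0 *)

Section weak_time_derivative.
Context {R : realType}.
Implicit Types (X Y : fspace (R:=R)) (t : R) (u v : R -> R -> R) (phi : R -> R).

Lemma C0P X (bX : banach X) (T : R) (k : R -> R -> R) : C0 X T k <->
  (forall t, t \in `[0, T] -> fmem X (k t)) /\
  (forall t, t \in `[0, T] -> forall e, 0 < e -> exists2 d, 0 < d &
    forall s, s \in `[0, T] -> `|s - t| < d -> nrm X (k s \- k t) <= e).
Proof.
have nearE (t : R) (P : R -> Prop) : (\forall s \near within `[0, T] (nbhs t), P s) <->
    exists2 d, 0 < d & forall s, s \in `[0, T] -> `|s - t| < d -> P s.
  split.
    rewrite near_withinE => -[d /= d0 hd]; exists d => // s sT st.
    by apply: hd => //=; rewrite distrC.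
  move=> [d d0 hd]; rewrite near_withinE; exists d => // s /= st sT.
  by apply: hd => //; rewrite distrC.
have memE t : (forall s, s \in `[0, T] -> fmem X (k s)) -> t \in `[0, T] ->
    \forall s \near within `[0, T] (nbhs t), fmem X (k s \- k t).
  move=> mk tT; apply/nearE; exists 1 => // s sT _.
  by apply: (memB bX); exact: mk.
split.
  move=> hk; have mk t : t \in `[0, T] -> fmem X (k t) by move=> tT; have [] := hk t tT.
  split => // t tT e e0; have [_] := hk t tT.
  by move=> /(cvg_fnormP bX (memE t mk tT))/(_ e e0)/nearE.
move=> [mk hk] t tT; split; first exact: mk.
by apply/(cvg_fnormP bX (memE t mk tT)) => e e0; apply/nearE; exact: hk.
Qed.

Section X.
Variables (X : fspace (R:=R)) (bX : banach X) (T : R) (T0 : 0 < T).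
Local Notation N := (nrm X).
Local Notation mem := (fmem X).
Let I : set R := `]0, T[%classic.
Let mI : measurable I. Proof. exact: measurable_itv. Qed.
Let Ioo : (leb I < +oo)%E.
Proof. by rewrite /I lebesgue_measure_itv/= lte_fin T0 -EFinD ltry. Qed.
Let IT t : I t -> t \in `[0, T]. Proof. exact: subset_itv_oo_cc. Qed.

(* is_weak_Dt, without the choice made by bochner_int *)
Definition wDt u v := [/\ Bint X I u, Bint X I v & forall phi, test_fun 0 T phi ->
  exists w w', [/\ BI X I (fun t r => derive1 phi t * u t r) w,
    BI X I (fun t r => phi t * v t r) w' & N (w \+ w') = 0]].

Lemma is_weak_Dt_wDt u v : L1 X I u -> is_weak_Dt X T u v -> wDt u v.
Proof.
move=> Lu [Lv h]; have Bu := L1_Bint bX mI Ioo Lu; have Bv := L1_Bint bX mI Ioo Lv.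
split => // phi tphi.
exists (bochner_int X I (fun t r => derive1 phi t * u t r)),
  (bochner_int X I (fun t r => phi t * v t r)); split.
- apply: Bint_bochner_int => //; apply: Bint_scale => //.
  by apply: test_continuous; exact: test_derive1 tphi.
- by apply: Bint_bochner_int => //; apply: Bint_scale => //; exact: test_continuous tphi.
- by rewrite /nrm h.
Qed.

Lemma wDt_is_weak_Dt u v : wDt u v -> is_weak_Dt X T u v.
Proof.
move=> [Bu Bv h]; split; first exact: Bint_L1.
move=> phi tphi; have [w [w' [hw hw' ww]]] := h phi tphi.
have b1 := Bint_bochner_int bX mI Ioo (ex_intro _ w hw).
have b2 := Bint_bochner_int bX mI Ioo (ex_intro _ w' hw').
have m1 : mem (bochner_int X I (fun t r => derive1 phi t * u t r)) by case: b1.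
have m2 : mem (bochner_int X I (fun t r => phi t * v t r)) by case: b2.
have mw : mem w by case: hw. have mw' : mem w' by case: hw'.
rewrite (nrmE bX); last exact: memD.
have E : N (w \- bochner_int X I (fun t r => derive1 phi t * u t r)) = 0.
  by apply: (BI_uniq bX mI Ioo hw b1); apply: aeW => t _; exact: nrmeq_refl.
have E' : N (w' \- bochner_int X I (fun t r => phi t * v t r)) = 0.
  by apply: (BI_uniq bX mI Ioo hw' b2); apply: aeW => t _; exact: nrmeq_refl.
have := nrmeq_add bX mw m1 mw' m2 E E'.
by move=> /(nrm_eq bX (memD bX mw mw') (memD bX m1 m2)) <-; rewrite ww.
Qed.

Lemma wDt_sub u v u' v' : wDt u v -> wDt u' v' ->
  wDt (fun t => u t \- u' t) (fun t => v t \- v' t).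
Proof.
move=> [[z hz] [y hy] h] [[z' hz'] [y' hy'] h']; split.
- by exists (z \- z'); exact: BI_B.
- by exists (y \- y'); exact: BI_B.
move=> phi tphi; have [w1 [w2 [h1 h2 h12]]] := h phi tphi.
have [w1' [w2' [h1' h2' h12']]] := h' phi tphi.
exists (w1 \- w1'), (w2 \- w2'); split.
- apply: (BI_ext bX (BI_B bX mI h1 h1')); apply: aeW => t _; apply/funext => r /=.
  by rewrite mulrBr.
- apply: (BI_ext bX (BI_B bX mI h2 h2')); apply: aeW => t _; apply/funext => r /=.
  by rewrite mulrBr.
have [m1 m2] : mem w1 /\ mem w2 by case: h1; case: h2.
have [m1' m2'] : mem w1' /\ mem w2' by case: h1'; case: h2'.
rewrite [X in N X](_ : _ = (w1 \+ w2) \- (w1' \+ w2')); last first.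
  by apply/funext => r /=; lra.
apply/eqP; rewrite eq_le nrm_ge0// andbT (le_trans (nrmB bX _ _))//; try exact: memD.
by rewrite h12 h12' addr0.
Qed.

(** Against every test both derivatives have the same integral, up to norm 0, so [Bint_zero_tests]
    applies to their difference. *)
Lemma wDt_uniq u v v' : wDt u v -> wDt u v' -> {ae leb, forall t, I t -> N (v t \- v' t) = 0}.
Proof.
move=> h h'; have [_ Bv _] := wDt_sub h h'; have [_ _ k] := h; have [_ _ k'] := h'.
apply: (Bint_zero_tests bX T0 Bv) => phi tphi.
have [w [y [hw hy wy]]] := k phi tphi; have [w' [y' [hw' hy' wy']]] := k' phi tphi.
have [mw my] : mem w /\ mem y by case: hw; case: hy.
have [mw' my'] : mem w' /\ mem y' by case: hw'; case: hy'.
have hb : BI X I (fun t r => phi t * (v t \- v' t) r) (y \- y').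
  apply: (BI_ext bX (BI_B bX mI hy hy')); apply: aeW => t _; apply/funext => r /=.
  by rewrite mulrBr.
have b1 := Bint_bochner_int bX mI Ioo (ex_intro _ _ hb).
have m1 : mem (bochner_int X I (fun t r => phi t * (v t \- v' t) r)) by case: b1.
have ww : N (w \- w') = 0.
  by apply: (BI_uniq bX mI Ioo hw hw'); apply: aeW => t _; exact: nrmeq_refl.
have yy : N (y \- y') = 0.
  apply/eqP; rewrite eq_le nrm_ge0// andbT.
  rewrite [X in N X <= _](_ : _ = ((w \+ y) \- (w' \+ y')) \- (w \- w')); last first.
    by apply/funext => r /=; lra.
  apply: le_trans (nrmB bX _ _) _.
  - by apply: memB => //; exact: memD.
  - exact: memB.
  rewrite ww addr0 (le_trans (nrmB bX _ _))//; try exact: memD.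
  by rewrite wy wy' addr0.
have : N ((y \- y') \- bochner_int X I (fun t r => phi t * (v t \- v' t) r)) = 0.
  by apply: (BI_uniq bX mI Ioo hb b1); apply: aeW => t _; exact: nrmeq_refl.
by move=> /(nrm_eq bX (memB bX my my') m1) <-.
Qed.

(** [z 0] is nearly the average of [u] against a bump [eta q] of mass 1 close to 0. Passing from
    [eta q] to the fixed weight [eta T] changes the weight by a function of mean 0, the derivative
    of a test phi with |phi| <= 2, and so costs at most twice the integral of [mv]; the average
    against [eta T] is bounded by a multiple of the integral of [mu]. *)
Lemma trace_le : exists2 K, 0 <= K & forall u v z mu mv, wDt u v -> C0 X T z ->
  {ae leb, forall t, I t -> N (z t \- u t) = 0} -> intg I mu -> intg I mv ->
  {ae leb, forall t, I t -> N (u t) <= mu t} -> {ae leb, forall t, I t -> N (v t) <= mv t} ->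
  N (z 0) <= K * (\int[leb]_(t in I) mu t + \int[leb]_(t in I) mv t).
Proof.
pose b (e : R) := smooth_bump (e / 3) (2 * e / 3) 0.
have cb e : continuous (b e) by apply: smooth_continuous; exact: smooth_bump_smooth.
have tb e : 0 < e -> e <= T -> test_fun 0 T (b e).
  by move=> e0 eT; apply: smooth_bump_test; [rewrite divr_gt0|lra].
pose c e := \int[leb]_(t in I) b e t.
have Ib e : intg I (b e) by exact: intg_continuous_oo.
have c0 e : 0 < e -> e <= T -> 0 < c e.
  move=> e0 eT; apply: (@Rintegral_gt0 _ I (e / 3) (2 * e / 3)) => //.
  - by move=> x; exact: smooth_bump_ge0.
  - by lra.
  - by move=> x; rewrite /I/= !in_itv/= => /andP[h1 h2]; apply/andP; split; lra.
  - by move=> x; exact: smooth_bump_gt0.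
pose eta e t := (c e)^-1 * b e t.
have ceta e : continuous (eta e) by move=> t; apply: cvgMr; exact: cb.
have teta e : 0 < e -> e <= T -> test_fun 0 T (eta e) by move=> e0 eT; exact/testZ/tb.
have eta0 e t : 0 < e -> e <= T -> 0 <= eta e t.
  by move=> e0 eT; rewrite mulr_ge0 ?smooth_bump_ge0// invr_ge0 ltW// c0.
have ieta e : 0 < e -> e <= T -> \int[leb]_(t in I) eta e t = 1.
  by move=> e0 eT; rewrite RintegralZl// mulVf// gt_eqF// c0.
have Ieta e : intg I (eta e) by exact: intg_continuous_oo.
(* [(c T)^-1] bounds [eta T], bumps being at most 1; the 2 bounds phi, a primitive of the difference
   of two weights of mass 1. *)
pose K := (c T)^-1 + 2.
have cT := c0 T T0 (lexx T).
have K0 : 0 <= K by rewrite addr_ge0// invr_ge0 ltW.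
exists K => // u v z mu mv h /(C0P bX)[mz cz] zu Iu Iv hu hv.
have [Bu Bv htest] := h.
have zT : 0 \in `[0, T] by rewrite in_itv/= lexx ltW.
apply/ler_addgt0Pr => e e0.
have [d d0 hd] := cz 0 zT e e0.
(* The support of [eta q] lies in [0, q], where [z] stays within [e] of [z 0]. *)
pose q := Num.min d T.
have q0 : 0 < q by rewrite lt_min d0.
have qT : q <= T by rewrite ge_min lexx orbT.
have qd : q <= d by rewrite ge_min lexx.
pose om t := eta q t + (-1) * eta T t.
have tom : test_fun 0 T om by apply: testD; [exact: teta|apply: testZ; exact: teta].
have omE t : om t = eta q t - eta T t by rewrite /om mulN1r.
have iom : \int[leb]_(t in I) om t = 0.
  by under eq_Rintegral do rewrite omE; rewrite RintegralB// !ieta// subrr.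
have [phi [tphi dphi bphi]] := test_primitive tom iom.
have phi2 t : `|phi t| <= 2.
  apply: le_trans (bphi t) _.
  apply: (@le_trans _ _ (\int[leb]_(t in I) (eta q t + eta T t))).
    apply: le_Rintegral => //.
    - by apply: (@integrable_norm _ _ _ leb); apply: intg_continuous_oo; exact: test_continuous tom.
    - exact: intgD.
    move=> x _; rewrite omE (le_trans (ler_normB _ _))// !ger0_norm// eta0//.
  by rewrite RintegralD// !ieta//.
have [w [w' [hw hw' ww]]] := htest phi tphi; rewrite dphi in hw.
have [mw mw'] : mem w /\ mem w' by case: hw; case: hw'.
have [wq hq] := Bint_scale bX T0 (ceta q) Bu.
have [wT hT] := Bint_scale bX T0 (ceta T) Bu.
have [mq mT] : mem wq /\ mem wT by case: hq; case: hT.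
have mz0 := mz 0 zT.
have b1 : N w' <= 2 * \int[leb]_(t in I) mv t.
  rewrite -RintegralZl//; apply: (BI_nrm_le bX mI Ioo hw'); first exact: intgZ.
  have mBv := Bint_mem Bv; apply: aeS2 mBv hv => t mBv hv It.
  rewrite nrmZ//; last exact: mBv.
  by rewrite ler_pM ?nrm_ge0//; exact: hv.
have b2 : N wT <= (c T)^-1 * \int[leb]_(t in I) mu t.
  rewrite -RintegralZl//; apply: (BI_nrm_le bX mI Ioo hT); first exact: intgZ.
  have mBu := Bint_mem Bu; apply: aeS2 mBu hu => t mBu hu It.
  rewrite nrmZ//; last exact: mBu.
  rewrite ler_pM ?nrm_ge0//; last exact: hu.
  rewrite ger0_norm ?eta0// /eta ler_piMr ?invr_ge0 ?(ltW cT)//.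
  exact: smooth_bump_le1.
have b3 : N w <= N w'.
  have := nrm_le_sub bX mw (memZ bX (-1) mw').
  rewrite nrmZ// normrN1 mul1r [X in N X + _](_ : _ = w \+ w'); last first.
    by apply/funext => r /=; lra.
  by rewrite ww add0r.
have b4 : N (wq \- wT \- w) = 0.
  apply: (BI_uniq bX mI Ioo (BI_B bX mI hq hT) hw); apply: aeW => t _.
  rewrite [X in N X](_ : _ = fun=> 0) ?nrm0//; apply/funext => r /=; rewrite omE; lra.
have b5 : N (z 0 \- wq) <= e.
  have hz := BI_scale_cst bX T0 (ceta q) mz0; rewrite ieta// in hz.
  have z0E : (fun r => 1 * z 0 r) = z 0 by apply/funext => r; rewrite mul1r.
  rewrite z0E in hz.
  have := BI_nrm_le bX mI Ioo (BI_B bX mI hz hq) (intgZ e mI (Ieta q)).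
  rewrite RintegralZl// ieta// mulr1; apply.
  have mBu := Bint_mem Bu; apply: aeS2 mBu zu => t mBu zu It.
  rewrite [X in N X <= _](_ : _ = fun r => eta q t * (z 0 \- u t) r); last first.
    by apply/funext => r /=; rewrite mulrBr.
  have mut := mBu It; have mzt := mz t (IT It).
  rewrite nrmZ; [|by []|exact: memB]; rewrite ger0_norm ?eta0// mulrC.
  have [td|td] := ltP t q; last first.
    rewrite /eta /b smooth_bump_out ?mulr0 ?mulr0//.
    by rewrite in_itv/= negb_and -!leNgt; apply/orP; right; lra.
  rewrite ler_wpM2r ?eta0//.
  rewrite (le_trans (nrm_triangle bX mz0 mzt mut))// zu// addr0 nrmC//.
  apply: hd; first exact: IT.
  by move: It; rewrite /I/= in_itv/= => /andP[t0 _]; rewrite subr0 gtr0_norm// (lt_le_trans td).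
have Imu0 : 0 <= \int[leb]_(t in I) mu t.
  by apply: Rintegral_ge0_ae => //; apply: aeS hu => t hu It; rewrite (le_trans _ (hu It))// nrm_ge0.
have Imv0 : 0 <= \int[leb]_(t in I) mv t.
  by apply: Rintegral_ge0_ae => //; apply: aeS hv => t hv It; rewrite (le_trans _ (hv It))// nrm_ge0.
have t1 := nrm_le_sub bX mz0 mq.
have t2 := nrm_le_sub bX mq mT.
have t3 := nrm_le_sub bX (memB bX mq mT) mw.
have c1 : 0 <= (c T)^-1 by rewrite invr_ge0 ltW.
rewrite /K; move: b1 b2 b3 b4 b5 t1 t2 t3 Imu0 Imv0 c1.
set A := \int[leb]_(t in I) mu t; set B := \int[leb]_(t in I) mv t.
move: ((c T)^-1) => k; move=> *; nra.
Qed.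

End X.

(** Both integrals of the weak formulation commute with [L] by [BI_bop]. It is meant for [L = Dr j],
    from W^{2,p} to L^p. *)
Lemma wDt_bop X Y (bX : banach X) (bY : banach Y) T L K u v : 0 < T ->
  bop X Y L K -> wDt X T u v -> wDt Y T (fun t => L (u t)) (fun t => L (v t)).
Proof.
move=> T0 bL; set I : set R := `]0, T[%classic => -[Bu Bv h].
have mI : measurable I by exact: measurable_itv.
have Ioo : (leb I < +oo)%E by rewrite /I lebesgue_measure_itv/= lte_fin T0 -EFinD ltry.
split; [exact: (Bint_bop bX bY bL)|exact: (Bint_bop bX bY bL)|].
have key phi z w : Bint X I z -> BI X I (fun t r => phi t * z t r) w ->
    BI Y I (fun t r => phi t * L (z t) r) (L w).
  move=> Bz hw; have mz := Bint_mem Bz.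
  apply: (BI_eq bY (BI_bop bX bY bL mI hw)).
    by apply: aeS mz => t mz It; apply: (memZ bY); apply: (bop_mem bL); exact: mz.
  by apply: aeS mz => t mz It; apply: (bop_scal bL); exact: mz.
move=> phi tphi; have [w [w' [hw hw' ww]]] := h phi tphi.
have [mw mw'] : fmem X w /\ fmem X w' by case: hw; case: hw'.
exists (L w), (L w'); split; [exact: key|exact: key|].
have mL := bop_mem bL mw; have mL' := bop_mem bL mw'; have mww := memD bX mw mw'.
have := bop_add bL mw mw'.
move=> /(nrm_eq bY (bop_mem bL mww) (memD bY mL mL')) <-.
apply/eqP; rewrite eq_le nrm_ge0// andbT.
by rewrite (le_trans (bop_le bL mww))// ww mulr0.
Qed.

End weak_time_derivative.

(** * The spaces L^p and W^{l,p} of an interval *)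

Section Lebesgue_spaces.
Context {R : realType}.
Implicit Types (f g h : R -> R).

Lemma Lnorm_le (p : \bar R) f g : (1 <= p)%E ->
  measurable_fun setT f -> measurable_fun setT g ->
  {ae leb, forall r : R, `|f r| <= `|g r|} ->
  ('N[leb]_p[EFin \o f] <= 'N[leb]_p[EFin \o g])%E.
Proof.
move=> p1 mf mg fg; rewrite unlock; case: p p1 => [r r1| _|//]; last first.
  case: ifPn => // _; apply: le_ess_sup; apply: aeS fg => x; by rewrite /= lee_fin.
have r0 : 0 < r by rewrite (lt_le_trans ltr01).
have mp (k : R -> R) : measurable_fun setT k -> measurable_fun setT (fun x => (`|(EFin \o k) x| `^ r)%E).
  move=> mk; apply: (@measurableT_comp _ _ _ _ _ _ (fun x => x `^ r)%E) => //=.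
    exact: measurable_poweR.
  by do 2 apply: measurableT_comp => //.
apply: gt0_ler_poweR.
- by rewrite invr_ge0 ltW.
- by rewrite in_itv/= leey integral_ge0.
- by rewrite in_itv/= leey integral_ge0.
apply: (@ae_ge0_le_integral _ _ _ leb) => //.
- by move=> x _; exact: poweR_ge0.
- exact: mp.
- by move=> x _; exact: poweR_ge0.
- exact: mp.
apply: aeS fg => x fgx _ /=; rewrite lee_fin ge0_ler_powR ?nnegrE//.
exact: ltW.
Qed.

(** At a positive limit the power is differentiable; the limit 0 is treated apart, by inverting the
    power. *)
Lemma cvg_powR (y : nat -> R) l q : 0 < q -> (forall j, 0 <= y j) ->
  y j @[j --> \oo] --> l -> (y j) `^ q @[j --> \oo] --> l `^ q.
Proof.
move=> q0 y0 yl.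
have : 0 <= l by rewrite -(cvg_lim _ yl)//; apply: limr_ge; [exact: cvgP yl|exact: nearW].
rewrite le_eqVlt => /orP[/eqP l0|l0]; last first.
  have cl : {for l, continuous (fun x => x `^ q)}.
    apply: differentiable_continuous; apply/derivable1_diffP.
    by have [] := is_derive1_powR q l0.
  exact: (@cvg_comp _ _ _ _ _ _ _ _ yl cl).
rewrite -l0 powR0 ?gt_eqF//; apply/cvgr0Pnorm_le => e e0.
have d0 : 0 < e `^ q^-1 by rewrite powR_gt0.
rewrite -l0 in yl; move/cvgr0Pnorm_le : yl => /(_ _ d0); apply: filterS => j.
rewrite !ger0_norm ?powR_ge0// => yj.
have := @ge0_ler_powR _ q (ltW q0) (y j) (e `^ q^-1).
rewrite !nnegrE => /(_ (y0 j) (ltW d0) yj) h; apply: (le_trans h).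
by rewrite -powRrM mulVf ?gt_eqF// powRr1// ltW.
Qed.

Variables (a b : R) (p : \bar R).
Hypotheses (ab : a < b) (p1 : (1 <= p)%E).
Local Notation X := (Lp a b p).
Local Notation N := (nrm X).
Local Notation mem := (fmem X).
Let D : set R := `]a, b[%classic.
Let mD : measurable D. Proof. exact: measurable_itv. Qed.
Let Doo : (leb D < +oo)%E.
Proof. by rewrite /D lebesgue_measure_itv/= lte_fin ab -EFinD ltry. Qed.
Let lebD : fine (leb D) = b - a.
Proof. by rewrite /D lebesgue_measure_itv/= lte_fin ab. Qed.

Lemma LpP f : mem f <-> measurable_fun D f /\ (fnorm X f < +oo)%E.
Proof.
rewrite /=; split.
  move=> /andP[]; rewrite !inE /= => mf nf; split => //.
  exact/(measurable_restrictT _ mD).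
move=> [mf nf]; apply/andP; rewrite !inE; split => //=.
exact/(measurable_restrictT _ mD).
Qed.

Lemma measurable_Lp f : mem f -> measurable_fun D f. Proof. by case/LpP. Qed.

Let mres f : measurable_fun D f -> measurable_fun setT (f \_ D).
Proof. by move=> mf; exact/(measurable_restrictT _ mD). Qed.

Lemma fnorm_Lp_le f g : measurable_fun D f -> measurable_fun D g ->
  {ae leb, forall r, D r -> `|f r| <= `|g r|} -> (fnorm X f <= fnorm X g)%E.
Proof.
move=> mf mg fg; apply: Lnorm_le => //; [exact: mres|exact: mres|].
apply: aeS fg => r fgr; rewrite !patchE; case: ifPn => rD //.
by apply: fgr; rewrite inE in rD.
Qed.

Lemma Lp_le f g : measurable_fun D f -> mem g ->
  {ae leb, forall r, D r -> `|f r| <= `|g r|} -> mem f.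
Proof.
move=> mf /LpP[mg goo] fg; apply/LpP; split => //; apply: le_lt_trans goo.
exact: fnorm_Lp_le.
Qed.

Lemma nrm_Lp_le f g : measurable_fun D f -> mem g ->
  {ae leb, forall r, D r -> `|f r| <= `|g r|} -> N f <= N g.
Proof.
move=> mf mg fg; have mf' := Lp_le mf mg fg.
move/LpP : mf' => [_ foo]; move/LpP : (mg) => [mg' goo].
have f0 k : (0 <= fnorm X k)%E by exact: Lnorm_ge0.
apply: fine_le; rewrite ?ge0_fin_numE//.
exact: fnorm_Lp_le.
Qed.

Lemma Lp_eq_ae f g : measurable_fun D g -> mem f ->
  {ae leb, forall r, D r -> f r = g r} -> mem g /\ N f = N g.
Proof.
move=> mg mf fg; have fg' : {ae leb, forall r, D r -> `|g r| <= `|f r|}.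
  by apply: aeS fg => r + Dr => ->.
have mg' := Lp_le mg mf fg'; split => //.
apply/eqP; rewrite eq_le; apply/andP; split; apply: nrm_Lp_le => //.
  exact: measurable_Lp.
by apply: aeS fg => r + Dr => ->.
Qed.

Lemma Lp_cst (c : R) : mem (cst c).
Proof.
apply/LpP; split; first exact: measurable_cst.
rewrite /= unlock; case: (p) p1 => [r r1|_|//]; last first.
  case: ifPn => // _; apply: (@le_lt_trans _ _ (`|c|%:E)); last exact: ltry.
  apply/ess_supP; apply: aeW => x /=; rewrite lee_fin patchE.
  by case: ifPn => //; rewrite normr0.
apply: poweR_lty.
have r0 : r != 0 by rewrite gt_eqF// (lt_le_trans ltr01).
rewrite (_ : (\int[leb]_x _)%E = (\int[leb]_(x in D) (`|c| `^ r)%:E)%E).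
  by rewrite (@integral_cst _ _ _ leb _ mD) lte_mul_pinfty// lee_fin powR_ge0.
rewrite [RHS]integral_mkcond; apply: eq_integral => x _ /=.
rewrite !patchE; case: ifPn => // _; by rewrite normr0 powR0.
Qed.

Lemma Lp_bounded f K : measurable_fun D f -> {ae leb, forall r, D r -> `|f r| <= K} -> mem f.
Proof.
move=> mf fK; apply: (@Lp_le f (cst K)) => //; first exact: Lp_cst.
by apply: aeS fK => r fK Dr; rewrite (le_trans (fK Dr))// ler_norm.
Qed.

Lemma Lnorm_scale c f : mem f ->
  fnorm X (fun r => c * f r) = (`|c|%:E * fnorm X f)%E /\ mem (fun r => c * f r).
Proof.
move=> mf; have E : (fun r => c * f r) \_ D = c \*: (f \_ D).
  apply/funext => r; rewrite !patchE /GRing.scale/= patchE.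
  by case: ifPn => // _; exact: (esym (mulr0 c)).
have h : fnorm X (fun r => c * f r) = (`|c|%:E * fnorm X f)%E.
  have := @LnormZ _ _ _ leb p p1 (Lfun_Sub p1 mf) c.
  by rewrite /= E.
split => //; apply/LpP; split.
  by apply: measurable_funM => //; exact: measurable_Lp.
move/LpP : mf => [_ foo]; rewrite h lte_mul_pinfty//.
Qed.

Lemma Lp_add f g : mem f -> mem g ->
  (fnorm X (f \+ g)%R <= fnorm X f + fnorm X g)%E /\ mem (f \+ g).
Proof.
move=> /LpP[mf foo] /LpP[mg goo].
have E : (f \+ g) \_ D = (f \_ D) \+ (g \_ D).
  apply/funext => r; rewrite /= !patchE; case: ifPn => // _; by rewrite addr0.
have h : (fnorm X (f \+ g)%R <= fnorm X f + fnorm X g)%E.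
  rewrite /= E; apply: eminkowski => //; exact: mres.
split => //; apply/LpP; split; first exact: measurable_funD.
by rewrite (le_lt_trans h)// lte_add_pinfty.
Qed.

Let f0 k : (0 <= fnorm X k)%E. Proof. exact: Lnorm_ge0. Qed.

Let NE f : mem f -> fnorm X f = (N f)%:E.
Proof. by move=> /LpP[_ foo]; rewrite fineK// ge0_fin_numE. Qed.

Lemma nrm_Lp_eq0 f : mem f -> N f = 0 -> {ae leb, forall r, D r -> f r = 0}.
Proof.
move=> mf Nf; have f00 : fnorm X f = 0%E by rewrite NE// Nf.
have p0 : (0 < p)%E by exact: lt_le_trans p1.
have := @Lnorm_eq0_eq0 _ _ _ leb (EFin \o (f \_ D)) p _ p0 f00.
have mf' : measurable_fun setT (EFin \o f \_ D).
  by apply/measurable_EFinP; apply: mres; exact: measurable_Lp.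
move=> /(_ mf'); apply: aeS => r /(_ Logic.I) /= [] + Dr.
by rewrite patchE mem_set.
Qed.

(* Young's inequality |f| <= 1 + |f|^p is enough, after normalisation *)
Lemma Lp_L1 f : mem f -> intg D f /\ \int[leb]_(r in D) `|f r| <= (b - a + 1) * N f.
Proof.
move=> mf; have mfD := measurable_Lp mf; have ba0 : 0 < b - a by rewrite subr_gt0.
have bnd g c : measurable_fun D g -> {ae leb, forall r, D r -> `|g r| <= c} ->
    intg D g /\ \int[leb]_(r in D) `|g r| <= c * (b - a).
  move=> mg gc; have Ic := intg_cst c mD Doo.
  have Ig : intg D g by exact: (intg_le_ae mD mg Ic).
  split => //; rewrite -lebD -(@Rintegral_cst _ _ _ leb _ mD).
  apply: le_Rintegral_ae => //; exact: (@integrable_norm _ _ _ leb).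
have N0 : 0 <= N f by rewrite fine_ge0.
move: N0; rewrite le_eqVlt => /orP[/eqP Nf0|Nf0].
  have [|If h] := bnd f 0 mfD.
    by apply: aeS (nrm_Lp_eq0 mf (esym Nf0)) => r + Dr => /(_ Dr) ->; rewrite normr0.
  by split => //; rewrite -Nf0 mulr0; rewrite mul0r in h.
have [Ey|[q Eq]] : p = +oo%E \/ exists q, p = q%:E.
- by case: (p) p1 => [q _|_|//]; [right; exists q|left].
- have h : {ae leb, forall r, D r -> `|f r| <= N f}.
    have := ess_sup_ge leb (abse \o (EFin \o f \_ D)).
    apply: aeS => r + Dr; have := NE mf; rewrite /= Ey unlock /=.
    rewrite (_ : (0 < leb setT)%E = true); last first.
      apply: (@lt_le_trans _ _ (leb D)); last by apply: le_leb.
      by rewrite /D lebesgue_measure_itv/= lte_fin ab -EFinD lte_fin subr_gt0.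
    by move=> ->; rewrite patchE mem_set//= lee_fin -Ey.
  have [If hf] := bnd f (N f) mfD h; split => //.
  by apply: (le_trans hf); rewrite mulrC ler_wpM2r// ?(ltW Nf0)// lerDl.
have q1 : 1 <= q by rewrite -lee_fin -Eq.
have q0 : 0 < q by rewrite (lt_le_trans ltr01).
have qn0 : q != 0 by rewrite gt_eqF.
have Ir : (\int[leb]_(x in D) (`|f x| `^ q)%:E = ((N f) `^ q)%:E)%E.
  have := @poweR_Lnorm _ _ _ leb (EFin \o (f \_ D)) q qn0.
  rewrite -Eq -[X in (X `^ q)%E]/(fnorm X f) NE//= => ->.
  rewrite integral_mkcond; apply: eq_integral => x _ /=.
  rewrite !patchE; case: ifPn => // _; by rewrite normr0 powR0.
have mr : measurable_fun D (fun x => `|f x| `^ q).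
  apply: (@measurableT_comp _ _ _ _ _ _ (@powR R ^~ q)) => //.
  exact: measurableT_comp.
have Ifr : intg D (fun x => `|f x| `^ q).
  apply/integrableP; split; first exact/measurable_EFinP.
  rewrite (_ : (\int[leb]_(x in D) _)%E = (\int[leb]_(x in D) (`|f x| `^ q)%:E)%E).
    by rewrite Ir ltry.
  by apply: eq_integral => x _ /=; rewrite ger0_norm ?powR_ge0.
have Ir' : \int[leb]_(x in D) (`|f x| `^ q) = N f `^ q by rewrite /Rintegral Ir.
have I1 := intg_cst 1 mD Doo.
pose k := fun x => N f * (1 + (N f `^ q)^-1 * (`|f x| `^ q)).
have Ikk := intgZ (N f `^ q)^-1 mD Ifr.
have Ik : intg D k by apply: intgZ => //; exact: (intgD mD I1 Ikk).
have Nq0 : 0 < N f `^ q by rewrite powR_gt0.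
have fk x : `|f x| <= k x.
  have E : `|f x| = N f * (`|f x| / N f) by rewrite mulrC divfK// gt_eqF.
  have y0 : 0 <= `|f x| / N f by rewrite divr_ge0// ltW.
  rewrite /k {2}E (powRM _ (ltW Nf0) y0) mulrA mulVf ?gt_eqF// mul1r {1}E ler_pM2l//.
  have [y1|y1] := leP (`|f x| / N f) 1; first by rewrite (le_trans y1)// lerDl powR_ge0.
  apply: (@le_trans _ _ ((`|f x| / N f) `^ q)); last by rewrite lerDr.
  by rewrite -{1}(powRr1 y0) ler_powR// ltW.
have If : intg D f.
  by apply: (intg_le_ae mD mfD Ik); apply: aeW => x _; exact: fk.
split => //; apply: (@le_trans _ _ (\int[leb]_(x in D) k x)).
  apply: le_Rintegral => //; exact: (@integrable_norm _ _ _ leb).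
rewrite RintegralZl//; last exact: (intgD mD I1 Ikk).
rewrite (@RintegralD _ _ _ leb _ _ _ mD I1 Ikk) RintegralZl// Ir' mulVf ?gt_eqF//.
by rewrite (@Rintegral_cst _ _ _ leb _ mD) mul1r lebD mulrC.
Qed.

(** For finite p this is Fatou's lemma for |h j|^p; for p infinite each bound holds off a null set,
    and countably many null sets are discarded at once. Completeness can then be proved for all p
    alike. *)
Lemma Lp_fatou (h : nat -> R -> R) f c : (forall j, mem (h j)) -> measurable_fun D f ->
  {ae leb, forall r, D r -> h j r @[j --> \oo] --> f r} ->
  (forall j, N (h j) <= c) -> mem f /\ N f <= c.
Proof.
move=> mh mf hf hc.
have c0 : 0 <= c by rewrite (le_trans _ (hc 0%N))// fine_ge0.
suff fc : (fnorm X f <= c%:E)%E.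
  have mf' : mem f by apply/LpP; split => //; exact: le_lt_trans fc (ltry _).
  by split => //; rewrite -lee_fin -NE.
have hcE j : (fnorm X (h j) <= c%:E)%E by rewrite NE// lee_fin.
have [Ey|[q Eq]] : p = +oo%E \/ exists q, p = q%:E.
- by case: (p) p1 => [q _|_|//]; [right; exists q|left].
- rewrite /= Ey unlock /=; case: ifPn => [T0|_]; last by rewrite lee_fin.
  apply/ess_supP.
  have : {ae leb, forall r : R, forall j, `|(h j \_ D) r| <= c}.
    apply: ae_foralln => j; have := hcE j; rewrite /= Ey unlock /= T0 => /ess_supP.
    by apply: aeS => r; rewrite /= lee_fin.
  apply: aeS2 hf => r hfr hjr; rewrite /= lee_fin !patchE; case: ifPn => [rD|_]; last by rewrite normr0.
  have := hfr _; rewrite inE in rD => /(_ rD)/cvg_norm hl.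
  rewrite -(cvg_lim _ hl)//; apply: limr_le; first exact: cvgP hl.
  by apply: nearW => j; have := hjr j; rewrite patchE mem_set.
have q1 : 1 <= q by rewrite -lee_fin -Eq.
have q0 : 0 < q by rewrite (lt_le_trans ltr01).
have qn0 : q != 0 by rewrite gt_eqF.
have E k : (fnorm X k `^ q = \int[leb]_(x in D) (`|k x| `^ q)%:E)%E.
  have := @poweR_Lnorm _ _ _ leb (EFin \o (k \_ D)) q qn0.
  rewrite -Eq -[X in (X `^ q)%E]/(fnorm X k) => ->.
  rewrite [RHS]integral_mkcond; apply: eq_integral => x _ /=.
  rewrite !patchE; case: ifPn => // _; by rewrite normr0 powR0.
have mr (k : R -> R) : measurable_fun D k -> measurable_fun D (fun x => (`|k x| `^ q)%:E).
  move=> mk; apply/measurable_EFinP.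
  apply: (@measurableT_comp _ _ _ _ _ _ (@powR R ^~ q)) => //.
  exact: measurableT_comp.
suff fq : (fnorm X f `^ q <= (c `^ q)%:E)%E.
  have : ((fnorm X f `^ q) `^ q^-1 <= (c `^ q)%:E `^ q^-1)%E.
    apply: gt0_ler_poweR => //; rewrite ?in_itv/= ?leey ?andbT ?poweR_ge0//.
      by rewrite invr_ge0 ltW.
    by rewrite lee_fin powR_ge0.
  by rewrite -poweRrM mulfV// poweRe1// -poweR_EFin -poweRrM mulfV// poweRe1.
rewrite E.
have [Z [mZ Z0 hZ]] := hf.
(* With the indicator the sequence converges at every point of [D], so the lower limit in Fatou's
   lemma is an explicit function. *)
pose g j x := ((`|h j x| `^ q)%:E * (\1_(~` Z) x)%:E)%E.
have mg j : measurable_fun D (g j).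
  apply: emeasurable_funM; first by apply: mr; exact: measurable_Lp.
  by apply/measurable_EFinP; apply: measurable_indic; exact: measurableC.
have g0 j x : D x -> (0 <= g j x)%E.
  by move=> _; rewrite mule_ge0// lee_fin ?powR_ge0.
have gl x : D x -> limn_einf (g ^~ x) = ((`|f x| `^ q)%:E * (\1_(~` Z) x)%:E)%E.
  move=> Dx; apply: (cvg_limn_einf_sup _).1.
  have [Zx|nZx] := pselect (Z x).
    rewrite indicE memNset ?mule0//.
    rewrite (_ : (fun j => _) = cst 0%E); first exact: cvg_cst.
    by apply/funext => j; rewrite /g indicE memNset ?mule0//.
  rewrite indicE mem_set// mule1.
  rewrite (_ : (fun j => _) = fun j => (`|h j x| `^ q)%:E); last first.
    by apply/funext => j; rewrite /g indicE mem_set ?mule1.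
  apply: cvg_EFin; first exact: nearW.
  have hx : h j x @[j --> \oo] --> f x.
    by apply: contrapT => nh; apply: nZx; apply: hZ => /=; apply: contra_not nh; exact.
  apply: cvg_powR => //; exact: cvg_norm hx.
have -> : (\int[leb]_(x in D) (`|f x| `^ q)%:E = \int[leb]_(x in D) limn_einf (g ^~ x))%E.
  have glm : measurable_fun D (fun x => ((`|f x| `^ q)%:E * (\1_(~` Z) x)%:E)%E).
    apply: emeasurable_funM; first exact: mr.
    by apply/measurable_EFinP; apply: measurable_indic; exact: measurableC.
  transitivity (\int[leb]_(x in D) ((`|f x| `^ q)%:E * (\1_(~` Z) x)%:E))%E; last first.
    by apply: eq_integral => x; rewrite inE => Dx; rewrite gl.
  apply: ae_eq_integral => //; first exact: mr.
  exists Z; split => // x /= /not_implyP[Dx h1]; apply: contrapT => nZ; apply: h1.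
  by rewrite indicE mem_set// mule1.
apply: le_trans (@fatou _ _ _ leb _ mD _ mg g0) _.
rewrite limn_einf_lim; apply: lime_le; first exact: is_cvg_einfs.
apply: nearW => n; apply: (@le_trans _ _ (\int[leb]_(x in D) g n x)%E).
  by apply: ereal_inf_lbound; exists n => /=.
apply: (@le_trans _ _ (\int[leb]_(x in D) (`|h n x| `^ q)%:E)%E).
  apply: le_integral_lower => //.
  - by move=> x; rewrite mule_ge0// lee_fin ?powR_ge0.
  apply: aeW => x Dx; rewrite /g -[leRHS]mule1 lee_wpmul2l// ?lee_fin ?powR_ge0//.
rewrite -E NE// poweR_EFin lee_fin ge0_ler_powR ?nnegrE ?(ltW q0)//.
by rewrite fine_ge0.
Qed.

(** Riesz-Fischer. A fast subsequence [g] converges almost everywhere since its increments are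
    summable in L^1; [Lp_fatou], applied to [f i - g j] as [j] grows, turns the Cauchy bound into
    convergence in norm. *)
Lemma Lp_complete (f : nat -> R -> R) : (forall i, mem (f i)) ->
  (forall e, 0 < e -> exists M, forall i j, (M <= i)%N -> (M <= j)%N -> N (f i \- f j) <= e) ->
  exists2 w, mem w & forall e, 0 < e -> exists M, forall i, (M <= i)%N -> N (f i \- w) <= e.
Proof.
move=> mf fC.
have mB g h : mem g -> mem h -> mem (g \- h).
  by move=> mg mh; rewrite subfunE; apply: (Lp_add _ _).2 => //; exact: (Lnorm_scale _ _).2.
have C0 : 0 < b - a + 1 by rewrite ltr_wpDl// subr_ge0 ltW.
have e0 (i : nat) : 0 < 2 ^- i / (b - a + 1) by rewrite divr_gt0// invr_gt0 exprn_gt0.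
have /choice[M hM] : forall i : nat, exists M, forall k l, (M <= k)%N -> (M <= l)%N ->
    N (f k \- f l) <= 2 ^- i / (b - a + 1) by move=> i; exact: fC.
(* Indices of the subsequence, strictly increasing and with [phi i] beyond [M i]: consecutive terms
   are within 2^-i/(b - a + 1) in L^p, hence within 2^-i in L^1 by [Lp_L1]. *)
pose phi := fix phi (i : nat) := match i with
  | 0%N => M 0%N | i'.+1 => maxn (M i'.+1) (phi i').+1 end.
have phiM i : (M i <= phi i)%N by case: i => [|i] //=; exact: leq_maxl.
have phiS i : (phi i < phi i.+1)%N by rewrite /= leq_maxr.
have phi_ge i : (i <= phi i)%N.
  by elim: i => [//|i ih]; exact: leq_ltn_trans ih (phiS i).
pose g i := f (phi i).
pose m i x := `|g i.+1 x - g i x|.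
have mg i : mem (g i) by exact: mf.
have L i := Lp_L1 (mB _ _ (mg i.+1) (mg i)).
have Im i : intg D (m i).
  by apply: (@integrable_norm _ _ _ leb); have [] := L i.
have mi i : \int[leb]_(x in D) m i x <= 2 ^- i.
  apply: le_trans (L i).2 _; rewrite mulrC -ler_pdivlMr//; apply: hM => //.
  by rewrite (leq_trans (phiM i))// ltnW.
have := summable_ae mD Im (fun i t => normr_ge0 _) mi.
move=> [Z [mZ Z0 hZ]].
have gc x : D x -> ~ Z x -> cvgn (g ^~ x).
  move=> Dx nZ; have : cvgn (series (fun i => m i x)).
    by apply: contrapT => nh; apply: nZ; apply: hZ => /=; apply: contra_not nh; exact.
  move=> hs; have hs' : cvgn (series (fun i => g i.+1 x - g i x)).
    exact: normed_cvg hs.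
  have E : g ^~ x = fun i => g 0%N x + series (fun i => g i.+1 x - g i x) i.
    by apply/funext => i; rewrite /series/= telescope_sumr// addrC subrK.
  rewrite E; apply: is_cvgD => //; exact: is_cvg_cst.
(* The indicator makes the sequence converge at every point of [D], to 0 on [Z], so that the limit
   is measurable. *)
pose w x := lim ((g j x * \1_(~` Z) x) @[j --> \oo]).
have wE x : D x -> g j x * \1_(~` Z) x @[j --> \oo] --> w x.
  move=> Dx; have [Zx|nZx] := pselect (Z x).
    rewrite /w; under eq_fun do rewrite indicE memNset// mulr0.
    rewrite (_ : (fun j => _) = cst 0); first by rewrite lim_cst//; exact: cvg_cst.
    by [].
  rewrite /w indicE mem_set//.
  rewrite (_ : (fun j => _) = g ^~ x); last by apply/funext => j; rewrite mulr1.
  exact: gc.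
have mw : measurable_fun D w.
  apply: (@measurable_fun_cvg _ _ _ _ (fun j x => g j x * \1_(~` Z) x)) => // j.
  apply: measurable_funM; first by apply: measurable_Lp.
  by apply: measurable_indic; exact: measurableC.
have gw : {ae leb, forall x, D x -> g j x @[j --> \oo] --> w x}.
  exists Z; split => // x /= /not_implyP[Dx nh]; apply: contrapT => nZ; apply: nh.
  have := wE x Dx; rewrite indicE mem_set//.
  by rewrite (_ : (fun j => _ * _) = g ^~ x)//; apply/funext => j; rewrite mulr1.
have key e : 0 < e -> exists M, forall i, (M <= i)%N ->
    mem (f i \- w) /\ N (f i \- w) <= e.
  move=> e1; have [K hK] := fC e e1; exists K => i Ki.
  apply: (@Lp_fatou (fun j => f i \- g (j + K)%N)).
  - by move=> j; exact: mB.
  - apply: measurable_funB => //; exact: measurable_Lp.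
  - apply: aeS gw => x gw Dx; apply: cvgB; first exact: cvg_cst.
    by apply: (cvg_comp _ _ (cvg_addnr K)) (gw Dx).
  - by move=> j; apply: hK => //; rewrite (leq_trans _ (phi_ge _))// leq_addl.
have [K hK] := key 1 ltr01.
have [mKw _] := hK K (leqnn _).
exists w.
  rewrite (_ : w = f K \- (f K \- w)); first exact: mB.
  by apply/funext => r /=; lra.
move=> e e1; have [K' hK'] := key e e1; exists K' => i /hK' [].
by [].
Qed.

Lemma Lp_banach : banach X.
Proof.
split.
- exact: Lp_cst.
- by move=> f g mf mg; exact: (Lp_add mf mg).2.
- by move=> c f mf; exact: (Lnorm_scale c mf).2.
- exact: f0.
- by move=> f /LpP[].
- by move=> f g mf mg; exact: (Lp_add mf mg).1.
- by move=> c f mf; exact: (Lnorm_scale c mf).1.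
- exact: Lp_complete.
Qed.

End Lebesgue_spaces.

Section Rintegral_linear.
Context {R : realType}.
Implicit Types (D : set R) (f g : R -> R).

Lemma RintD D f g : measurable D -> intg D f -> intg D g ->
  \int[leb]_(x in D) (f x + g x) = \int[leb]_(x in D) f x + \int[leb]_(x in D) g x.
Proof. by move=> mD If Ig; rewrite (@RintegralD _ _ _ leb _ _ _ mD If Ig). Qed.

Lemma RintB D f g : measurable D -> intg D f -> intg D g ->
  \int[leb]_(x in D) (f x - g x) = \int[leb]_(x in D) f x - \int[leb]_(x in D) g x.
Proof. by move=> mD If Ig; rewrite (@RintegralB _ _ _ leb _ _ _ mD If Ig). Qed.

Lemma RintZ D f c : measurable D -> intg D f ->
  \int[leb]_(x in D) (c * f x) = c * \int[leb]_(x in D) f x.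
Proof. by move=> mD If; rewrite RintegralZl. Qed.

Lemma Rint0 D : \int[leb]_(x in D) (0 : R) = 0.
Proof. by rewrite /Rintegral integral0. Qed.

End Rintegral_linear.

(** * Weak derivatives and Sobolev spaces *)

Section weak_derivatives.
Context {R : realType}.
Implicit Types (f g h phi : R -> R).

Variables (a b : R) (p : \bar R).
Hypotheses (ab : a < b) (p1 : (1 <= p)%E).
Local Notation X := (Lp a b p).
Local Notation N := (nrm X).
Let D : set R := `]a, b[%classic.
Let mD : measurable D. Proof. exact: measurable_itv. Qed.
Let bX : banach X. Proof. exact: Lp_banach. Qed.

Lemma intg_Lp f : fmem X f -> intg D f.
Proof. by move=> mf; have [] := Lp_L1 ab p1 mf. Qed.

Lemma intg_locally f : intg D f -> locally_integrable D f.
Proof. by move=> If; apply: open_integrable_locally => //; exact: interval_open. Qed.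

Lemma Lp_locally f : fmem X f -> locally_integrable D f.
Proof. by move=> mf; apply: intg_locally; exact: intg_Lp. Qed.

Lemma intg_Lp_test f phi : fmem X f -> test_fun a b phi -> intg D (fun x => f x * phi x).
Proof. by move=> mf; apply: intg_test; exact: Lp_locally. Qed.

Lemma weak_deriv_uniq j f g h : is_weak_deriv a b j f g -> is_weak_deriv a b j f h ->
  {ae leb, forall r : R, r \in `]a, b[ -> g r = h r}.
Proof.
move=> [lg hg] [lh hh].
have : {ae leb, forall r : R, r \in `]a, b[ -> (g \- h) r = 0}.
  apply: fundamental_lemma; first exact: locally_integrableB.
  move=> phi tphi; rewrite (_ : (fun x => _) = (fun x => g x * phi x) \- (fun x => h x * phi x)).
    rewrite (RintB mD (intg_test lg tphi) (intg_test lh tphi)).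
    have := hg phi tphi; rewrite (hh phi tphi) => E.
    have /eqP : (-1) ^+ j * \int[leb]_(x in `]a, b[) (g x * phi x) =
      (-1) ^+ j * \int[leb]_(x in `]a, b[) (h x * phi x) by [].
    by rewrite -subr_eq0 -mulrBr mulf_eq0 signr_eq0/= => /eqP.
  by apply/funext => x /=; rewrite mulrBl.
by apply: aeS => r + rD => /(_ rD) /eqP; rewrite /= subr_eq0 => /eqP.
Qed.

Lemma weak_derivD j f f' g g' : fmem X f -> fmem X f' ->
  is_weak_deriv a b j f g -> is_weak_deriv a b j f' g' ->
  is_weak_deriv a b j (f \+ f') (g \+ g').
Proof.
move=> mf mf' [lg hg] [lg' hg']; split; first exact: locally_integrableD.
move=> phi tphi; have tj := test_derive1n j tphi.
rewrite (_ : (fun x => (f \+ f') x * _) =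
  (fun x => f x * derive1n j phi x) \+ (fun x => f' x * derive1n j phi x)); last first.
  by apply/funext => x /=; rewrite mulrDl.
rewrite (RintD mD (intg_Lp_test mf tj) (intg_Lp_test mf' tj)).
rewrite hg// hg'// -mulrDr; congr (_ * _).
rewrite -(RintD mD (intg_test lg tphi) (intg_test lg' tphi)).
by congr Rintegral; apply/funext => x /=; rewrite mulrDl.
Qed.

Lemma weak_derivZ j c f g : fmem X f -> is_weak_deriv a b j f g -> fmem X g ->
  is_weak_deriv a b j (fun r => c * f r) (fun r => c * g r).
Proof.
move=> mf [lg hg] mg; split; first by apply: Lp_locally; exact: memZ.
move=> phi tphi; have tj := test_derive1n j tphi.
rewrite (_ : (fun x => c * f x * _) = fun x => c * (f x * derive1n j phi x)); last first.
  by apply/funext => x /=; rewrite mulrA.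
rewrite (_ : (fun x => c * g x * _) = fun x => c * (g x * phi x)); last first.
  by apply/funext => x /=; rewrite mulrA.
rewrite (RintZ _ mD (intg_Lp_test mf tj)).
by rewrite (RintZ _ mD (intg_test lg tphi)) hg// mulrCA.
Qed.

Lemma weak_deriv0 f : fmem X f -> is_weak_deriv a b 0 f f.
Proof. by move=> mf; split => [|phi tphi]; [exact: Lp_locally|rewrite expr0 mul1r]. Qed.

(** Both sides of the weak formulation are continuous for the L^p norm, because tests and their
    derivatives are bounded and L^p embeds in L^1. *)
Lemma weak_deriv_lim j (f g : nat -> R -> R) f' g' :
  (forall i, fmem X (f i)) -> (forall i, fmem X (g i)) -> fmem X f' -> fmem X g' ->
  (forall i, is_weak_deriv a b j (f i) (g i)) ->
  (forall e, 0 < e -> exists i, N (f i \- f') <= e /\ N (g i \- g') <= e) ->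
  is_weak_deriv a b j f' g'.
Proof.
move=> mf mg mf' mg' fg lim; split; first exact: Lp_locally.
move=> phi tphi; have tj := test_derive1n j tphi.
have [K K0 hK] := test_bounded tphi; have [J J0 hJ] := test_bounded tj.
have C0 : 0 < b - a + 1 by rewrite ltr_wpDl// subr_ge0 ltW.
have key h h' psi M : test_fun a b psi -> 0 <= M -> (forall x, `|psi x| <= M) ->
    fmem X h -> fmem X h' ->
    `|\int[leb]_(x in D) (h x * psi x) - \int[leb]_(x in D) (h' x * psi x)| <=
      M * ((b - a + 1) * N (h \- h')).
  move=> tpsi M0 hM mh mh'.
  rewrite -(RintB mD (intg_Lp_test mh tpsi) (intg_Lp_test mh' tpsi)).
  have [I1 I2] := Lp_L1 ab p1 (memB bX mh mh').
  apply: (@le_trans _ _ (\int[leb]_(x in D) (M * `|(h \- h') x|))).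
    apply: le_norm_Rintegral_ae => //.
    - by apply: intgB => //; exact: intg_Lp_test.
    - by apply: intgZ => //; exact: (@integrable_norm _ _ _ leb).
    - by apply: aeW => x _ /=; rewrite -mulrBl normrM mulrC ler_wpM2r.
  rewrite (RintZ _ mD); last exact: (@integrable_norm _ _ _ leb).
  exact: ler_wpM2l.
apply/eqP; rewrite -subr_eq0 -normr_eq0 eq_le normr_ge0 andbT.
apply/ler_addgt0Pl => e e0; rewrite addr0.
have M0 : 0 < (b - a + 1) * (J + K + 1) by rewrite mulr_gt0// ltr_wpDl// addr_ge0.
have [i [fi gi]] := lim (e / ((b - a + 1) * (J + K + 1))) (divr_gt0 e0 M0).
have h1 := key _ _ _ _ tj J0 hJ (mf i) mf'; have h2 := key _ _ _ _ tphi K0 hK (mg i) mg'.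
have [_ /(_ phi tphi) E] := fg i.
set u := \int[leb]_(x in _) _ in h1; set u' := \int[leb]_(x in _) _ in h1.
set v := \int[leb]_(x in _) _ in h2; set v' := \int[leb]_(x in _) _ in h2.
rewrite -/u -/v in E; rewrite -/u' -/v'.
rewrite (_ : u' - _ = - (u - u') + (-1) ^+ j * (v - v')); last by rewrite E; ring.
apply: (le_trans (ler_normD _ _)); rewrite normrN normrMsign.
apply: (le_trans (lerD h1 h2)).
have c0 : 0 <= b - a + 1 by exact: ltW.
apply: (@le_trans _ _ (J * ((b - a + 1) * (e / ((b - a + 1) * (J + K + 1)))) +
   K * ((b - a + 1) * (e / ((b - a + 1) * (J + K + 1)))))).
  by apply: lerD; apply: ler_wpM2l => //; exact: ler_wpM2l.
rewrite -mulrDl mulrCA mulrA mulrC -mulrA -mulrCA.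
rewrite (_ : _ * _ = (J + K) * e / (J + K + 1)); last first.
  by field; rewrite !gt_eqF// ltr_wpDl// addr_ge0.
rewrite ler_pdivrMr ?ltr_wpDl ?addr_ge0// mulrC ler_wpM2l ?(ltW e0)//.
by rewrite lerDl.
Qed.

Section sobolev.
Variable l : nat.
Local Notation W := (Wlp a b l p).

(** The derivative picked by [Dr] is a priori only locally integrable; it belongs to L^p because it
    agrees almost everywhere with the one provided by the membership in W^{l,p}. *)
Lemma Wlp_weak_deriv f j : fmem W f -> (j <= l)%N ->
  is_weak_deriv a b j f (Dr a b j f) /\ fmem X (Dr a b j f).
Proof.
move=> [mf h] jl; have [g mg fg] := h j jl.
have fD : is_weak_deriv a b j f (Dr a b j f).
  by apply: (@xgetPex _ (cst 0) [set g | is_weak_deriv a b j f g]); exists g.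
split => //; have [[mDf _ _] _] := fD.
by have [] := Lp_eq_ae p1 mDf mg (weak_deriv_uniq fg fD).
Qed.

Lemma Wlp_Lp f : fmem W f -> fmem X f. Proof. by case. Qed.

Lemma Wlp_Dr f j g : fmem W f -> (j <= l)%N -> is_weak_deriv a b j f g ->
  {ae leb, forall r : R, r \in `]a, b[ -> Dr a b j f r = g r}.
Proof. by move=> mf jl; apply: weak_deriv_uniq; exact: (Wlp_weak_deriv mf jl).1. Qed.

Lemma WlpP f : fmem X f -> (forall j, (j <= l)%N ->
  exists2 g, fmem X g & is_weak_deriv a b j f g) -> fmem W f.
Proof. by []. Qed.

Lemma Wlp_add f g : fmem W f -> fmem W g -> fmem W (f \+ g).
Proof.
move=> mf mg; apply: WlpP; first by apply: memD => //; exact: Wlp_Lp.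
move=> j jl; have [h1 h2] := Wlp_weak_deriv mf jl; have [h3 h4] := Wlp_weak_deriv mg jl.
by exists (Dr a b j f \+ Dr a b j g); [exact: memD|apply: weak_derivD => //; exact: Wlp_Lp].
Qed.

Lemma Dr_add f g j : fmem W f -> fmem W g -> (j <= l)%N ->
  {ae leb, forall r : R, r \in `]a, b[ -> Dr a b j (f \+ g) r = Dr a b j f r + Dr a b j g r}.
Proof.
move=> mf mg jl; apply: (Wlp_Dr (Wlp_add mf mg) jl).
by apply: weak_derivD; [exact: Wlp_Lp|exact: Wlp_Lp|exact: (Wlp_weak_deriv mf jl).1
  |exact: (Wlp_weak_deriv mg jl).1].
Qed.

Lemma Wlp_scale c f : fmem W f -> fmem W (fun r => c * f r).
Proof.
move=> mf; apply: WlpP; first by apply: memZ => //; exact: Wlp_Lp.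
move=> j jl; have [h1 h2] := Wlp_weak_deriv mf jl.
by exists (fun r => c * Dr a b j f r); [exact: memZ|apply: weak_derivZ => //; exact: Wlp_Lp].
Qed.

Lemma Dr_scale c f j : fmem W f -> (j <= l)%N ->
  {ae leb, forall r : R, r \in `]a, b[ -> Dr a b j (fun r => c * f r) r = c * Dr a b j f r}.
Proof.
move=> mf jl; apply: (Wlp_Dr (Wlp_scale c mf) jl).
have [h1 h2] := Wlp_weak_deriv mf jl.
by apply: weak_derivZ => //; exact: Wlp_Lp.
Qed.

Lemma Dr_sub f g j : fmem W f -> fmem W g -> (j <= l)%N ->
  {ae leb, forall r : R, r \in `]a, b[ -> Dr a b j (f \- g) r = Dr a b j f r - Dr a b j g r}.
Proof.
move=> mf mg jl; rewrite (subfunE f g).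
apply: aeS2 (Dr_add mf (Wlp_scale (-1) mg) jl) (Dr_scale (-1) mg jl) => r h1 h2 rD.
by rewrite h1// h2// mulN1r.
Qed.

Lemma Lp_ae f g : fmem X f -> fmem X g ->
  {ae leb, forall r : R, r \in `]a, b[ -> f r = g r} -> fnorm X f = fnorm X g.
Proof.
move=> mf mg fg; rewrite !nrmE//.
by rewrite (Lp_eq_ae p1 (measurable_Lp mg) mf fg).2.
Qed.

Let Dm f j : fmem W f -> (j < l.+1)%N -> fmem X (Dr a b j f).
Proof. by move=> mf jl; exact: (Wlp_weak_deriv mf jl).2. Qed.

Lemma Wlp_banach : banach W.
Proof.
split.
- apply: WlpP => [|j jl]; first exact: (mem0 bX).
  exists (fun=> 0); first exact: (mem0 bX).
  split; first by apply: Lp_locally; exact: (mem0 bX).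
  move=> phi tphi; rewrite (_ : (fun x => _) = fun=> 0); last first.
    by apply/funext => x; rewrite mul0r.
  rewrite (_ : (fun x => 0 * phi x) = fun=> 0); last first.
    by apply/funext => x; rewrite mul0r.
  by rewrite Rint0 mulr0.
- exact: Wlp_add.
- by move=> c f; exact: Wlp_scale.
- by move=> f; apply: sume_ge0 => j _; exact: (fnorm_ge0 bX).
- move=> f mf; rewrite /= lte_sum_pinfty// => j _.
  exact: (fnorm_lty bX (Dm mf (ltn_ord j))).
- move=> f g mf mg; rewrite /= -big_split/=; apply: lee_sum => j _.
  have h := Dm mf (ltn_ord j); have k := Dm mg (ltn_ord j).
  apply: le_trans (fnormD bX h k); rewrite le_eqVlt; apply/orP; left; apply/eqP.
  refine (Lp_ae (Dm (Wlp_add mf mg) (ltn_ord j)) (memD bX h k) _).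
  exact (Dr_add mf mg (ltn_ord j)).
- move=> c f mf; rewrite /= ge0_sume_distrr; last by move=> j _; exact: (fnorm_ge0 bX).
  apply: eq_bigr => j _; have h := Dm mf (ltn_ord j).
  transitivity (fnorm X (fun r => c * Dr a b j f r)); last exact: fnormZ.
  refine (Lp_ae (Dm (Wlp_scale c mf) (ltn_ord j)) (memZ bX c h) _).
  exact (Dr_scale c mf (ltn_ord j)).
move=> f mf fC.
have NW g : fmem W g -> nrm W g = \sum_(j < l.+1) N (Dr a b j g).
  move=> mg; rewrite /nrm/= (eq_bigr (fun j : 'I_l.+1 => (N (Dr a b j g))%:E)) ?sumEFin// => j _.
  exact: nrmE bX _ (Dm mg (ltn_ord j)).
have NDr j g h : fmem W g -> fmem W h -> (j <= l)%N ->
    N (Dr a b j (g \- h)) = N (Dr a b j g \- Dr a b j h).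
  move=> mg mh jl; rewrite /nrm (Lp_ae (g := Dr a b j g \- Dr a b j h))//.
  + by rewrite subfunE; apply: Dm => //; apply: Wlp_add => //; exact: Wlp_scale.
  + by apply: memB => //; exact: Dm.
  + exact: Dr_sub.
have mB g h : fmem W g -> fmem W h -> fmem W (g \- h).
  by move=> mg mh; rewrite subfunE; apply: Wlp_add => //; exact: Wlp_scale.
have Nj g j : fmem W g -> (j <= l)%N -> N (Dr a b j g) <= nrm W g.
  move=> mg jl; rewrite NW// (bigD1 (Ordinal (jl : (j < l.+1)%N)))//= lerDl.
  by apply: sumr_ge0 => i _; exact: (nrm_ge0 bX).
(* [w j] is the limit of the j-th derivatives. The limit in W^{l,p} will be [w 0], with [w j] as its
   j-th weak derivative by [weak_deriv_lim]. The family is total in [j], hence the default value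
   above [l]. *)
have /choice[w hw] : forall j : nat, exists w, (j <= l)%N -> fmem X w /\ forall e, 0 < e ->
    exists M, forall i, (M <= i)%N -> N (Dr a b j (f i) \- w) <= e.
  move=> j; have [jl|_] := leqP j l; last by exists (cst 0).
  have [|e e0|w mw hw] := fcomplete bX (f := fun i => Dr a b j (f i)); last by exists w.
    by move=> i; exact: Dm.
  have [M hM] := fC e e0; exists M => i k Mi Mk.
  by rewrite -NDr//; apply: le_trans (Nj _ _ _ jl) (hM _ _ Mi Mk); exact: mB.
have lim e : 0 < e -> exists M, forall i, (M <= i)%N -> forall j, (j <= l)%N ->
    N (Dr a b j (f i) \- w j) <= e.
  move=> e0; have /choice[M hM] : forall j : nat, exists M, (j <= l)%N -> forall i,
      (M <= i)%N -> N (Dr a b j (f i) \- w j) <= e.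
    move=> j; have [jl|_] := leqP j l; last by exists 0%N.
    by have [_ /(_ e e0) [M hM]] := hw j jl; exists M.
  exists (\max_(j < l.+1) M j) => i hi j jl; apply: hM => //.
  by apply: leq_trans hi; rewrite (leq_bigmax (Ordinal (jl : (j < l.+1)%N))).
have D0 i : {ae leb, forall r : R, r \in `]a, b[ -> Dr a b 0 (f i) r = f i r}.
  by apply: Wlp_Dr => //; apply: weak_deriv0; exact: Wlp_Lp.
have w0 : fmem X (w 0%N) by have [] := hw 0%N (leq0n l).
have wd j : (j <= l)%N -> is_weak_deriv a b j (w 0%N) (w j).
  move=> jl; have [mw _] := hw j jl.
  apply: (@weak_deriv_lim j f (fun i => Dr a b j (f i))) => //.
  + by move=> i; exact: Wlp_Lp.
  + by move=> i; exact: Dm.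
  + by move=> i; exact: (Wlp_weak_deriv (mf i) jl).1.
  move=> e e0; have [M hM] := lim e e0; exists M; split; last exact: hM.
  have <- : N (Dr a b 0 (f M) \- w 0%N) = N (f M \- w 0%N); last exact: hM.
  rewrite /nrm (Lp_ae (g := f M \- w 0%N))//.
  + by apply: memB => //; exact: Dm.
  + by apply: memB => //; exact: Wlp_Lp.
  + by apply: aeS (D0 M) => r E rD /=; rewrite E.
have mw : fmem W (w 0%N).
  by apply: WlpP => // j jl; exists (w j); [have [] := hw j jl|exact: wd].
exists (w 0%N) => // e e0.
have [M hM] := lim (e / l.+1%:R) (divr_gt0 e0 (ltr0Sn _ _)); exists M => i Mi.
rewrite NW; last exact: mB.
have E : \sum_(j < l.+1) e / l.+1%:R = e.
  by rewrite sumr_const card_ord -[LHS]mulr_natr divfK// pnatr_eq0.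
rewrite -[leRHS]E; apply: ler_sum => j _; rewrite NDr//; last exact: (ltn_ord j).
apply: le_trans (hM i Mi j (ltn_ord j)); rewrite le_eqVlt; apply/orP; left; apply/eqP.
rewrite /nrm (Lp_ae (g := Dr a b j (f i) \- w j))//.
+ by apply: memB => //; exact: Dm (ltn_ord j).
+ by apply: memB => //; [exact: Dm (ltn_ord j)|have [] := hw j (ltn_ord j)].
by apply: aeS (Wlp_Dr mw (ltn_ord j : (j <= l)%N) (wd j (ltn_ord j))) => r E' rD /=; rewrite E'.
Qed.

Lemma nrm_WlpE f : fmem W f -> nrm W f = \sum_(j < l.+1) N (Dr a b j f).
Proof.
move=> mf; rewrite /nrm/= (eq_bigr (fun j : 'I_l.+1 => (N (Dr a b j f))%:E)) ?sumEFin// => j _.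
exact: nrmE bX _ (Dm mf (ltn_ord j)).
Qed.

Lemma Dr_bop j : (j <= l)%N -> bop W X (Dr a b j) 1.
Proof.
move=> jl; split => //.
- by move=> f mf; exact: (Wlp_weak_deriv mf jl).2.
- move=> f mf; rewrite mul1r nrm_WlpE// (bigD1 (Ordinal (jl : (j < l.+1)%N)))//= lerDl.
  by apply: sumr_ge0 => i _; exact: (nrm_ge0 bX).
- move=> f g mf mg; have h := Dm mf (jl : (j < l.+1)%N); have k := Dm mg (jl : (j < l.+1)%N).
  have m := Dm (Wlp_add mf mg) (jl : (j < l.+1)%N).
  rewrite -(nrm0 bX) /nrm; congr fine; apply: Lp_ae.
  + by apply: memB => //; exact: memD.
  + exact: (mem0 bX).
  + by apply: aeS (Dr_add mf mg jl) => r E rD /=; rewrite E// subrr.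
- move=> c f mf; have h := Dm mf (jl : (j < l.+1)%N).
  have m := Dm (Wlp_scale c mf) (jl : (j < l.+1)%N).
  rewrite -(nrm0 bX) /nrm; congr fine; apply: Lp_ae.
  + by apply: memB => //; exact: memZ.
  + exact: (mem0 bX).
  + by apply: aeS (Dr_scale c mf jl) => r E rD /=; rewrite E// subrr.
Qed.

Lemma Wlp_Dr0 f : fmem W f -> {ae leb, forall r : R, r \in `]a, b[ -> Dr a b 0 f r = f r}.
Proof. by move=> mf; apply: Wlp_Dr => //; apply: weak_deriv0; exact: Wlp_Lp. Qed.

Lemma nrm_Lp_Wlp f : fmem W f -> N f <= nrm W f.
Proof.
move=> mf; have := bop_le (Dr_bop (leq0n l)) mf; rewrite mul1r; apply: le_trans.
rewrite /nrm (Lp_ae (g := f))//; [exact: (Dm mf)|exact: Wlp_Lp|exact: Wlp_Dr0].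
Qed.

Lemma Dr_iter j f : fmem W f -> (j < l)%N ->
  is_weak_deriv a b 1 (Dr a b j f) (Dr a b j.+1 f).
Proof.
move=> mf jl; have [[_ h1] _] := Wlp_weak_deriv mf (ltnW jl).
have [[lg h2] _] := Wlp_weak_deriv mf jl; split => // phi tphi.
have := h1 _ (test_derive1 tphi); rewrite -derive1Sn => h2'.
have := h2 _ tphi; rewrite (_ : derive1n _ _ = derive1n j (derive1 phi)); last first.
  by rewrite derive1Sn.
rewrite h1; last exact: test_derive1.
rewrite exprS -mulrA => E; rewrite expr1.
apply: (mulfI (_ : (-1) ^+ j != 0)); first by rewrite signr_eq0.
by rewrite E mulrCA.
Qed.

End sobolev.
End weak_derivatives.

(** * Absolutely continuous functions *)

Section primitives.
Context {R : realType}.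
Implicit Types (f g h phi alpha beta : R -> R) (a b c e x y t : R).

(** Asking for derivative and continuity from some [e < a] on makes [a] an interior point, so
    nothing one-sided remains to be checked there. *)
Lemma FTC_oo F f e a x : e < a -> a < x ->
  (forall y, e < y -> is_derive y 1 F (f y)) -> (forall y, e < y -> {for y, continuous f}) ->
  intg `]a, x[ f /\ F x - F a = \int[leb]_(t in `]a, x[) f t.
Proof.
move=> ea ax dF cf.
have cw : {within `[a, x], continuous f}.
  apply: continuous_in_subspaceT => y; rewrite inE/= in_itv/= => /andP[ay _].
  by apply: cf; exact: lt_le_trans ea ay.
have Icc : intg `[a, x] f.
  by apply: continuous_compact_integrable => //; exact: segment_compact.
have Ioo : intg `]a, x[ f.
  by apply: (@integrableS _ _ _ leb _ _ _ _ _ _ Icc) => //; exact: subset_itv_oo_cc.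
have Ioc : intg `]a, x] f.
  by apply: (@integrableS _ _ _ leb _ _ _ _ _ _ Icc) => //; exact: subset_itv_oc_cc.
have cF y : e < y -> {for y, continuous F}.
  move=> ey; apply: differentiable_continuous; apply/derivable1_diffP.
  by have [] := dF y ey.
split => //; rewrite Rintegral_itv_bndo_bndc// Rintegral_itv_obnd_cbnd//.
rewrite /Rintegral (@continuous_FTC2 _ f F a x ax cw)//.
- split.
  + move=> y; rewrite in_itv/= => /andP[ay _].
    by have [] := dF y (lt_trans ea ay).
  + by apply: cvg_at_right_filter; exact: cF.
  + by apply: cvg_at_left_filter; apply: cF; exact: lt_trans ax.
- move=> y; rewrite in_itv/= => /andP[ay _]; rewrite derive1E.
  by have [_ ->] := dF y (lt_trans ea ay).
Qed.

Definition prim a f x : R := \int[leb]_(t in `]a, x[) f t.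

(** [prim a f] is constant to the left of [a] and so in general not differentiable at [a]; a
    primitive started at [e] and normalised at [a] is, and the two agree to the right of [a]. *)
Lemma prim_continuous_has_deriv a e f : e < a -> continuous f ->
  exists F, [/\ F a = 0, forall x, a < x -> F x = prim a f x &
    forall y, e < y -> is_derive y 1 F (f y)].
Proof.
move=> ea cf; exists (fun x => \int[leb]_(t in `[e, x]) f t - \int[leb]_(t in `[e, a]) f t).
have dF y : e < y -> is_derive y 1 (fun x => \int[leb]_(t in `[e, x]) f t -
    \int[leb]_(t in `[e, a]) f t) (f y).
  move=> ey; have y1 : y < y + 1 by rewrite ltrDl.
  have [dF F'] := @continuous_FTC1_closed R f e y (y + 1) y1 (intg_continuous _ _ cf) ey (cf y).
  have F'' : 'D_1 (fun x => \int[leb]_(t in `[e, x]) f t) y = f y by rewrite -derive1E F'.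
  have h : is_derive y 1 (fun x => \int[leb]_(t in `[e, x]) f t) (f y) by exact: (DeriveDef dF F'').
  rewrite -[f y]subr0; apply: is_deriveB.
split => //; first by rewrite subrr.
move=> x ax.
have [_] := FTC_oo ea ax dF (fun y _ => cf y); rewrite /prim => <-.
by rewrite subrr subr0.
Qed.

Section on_interval.
Variables (a b : R) (ab : a < b).
Let D : set R := `]a, b[%classic.
Let mD : measurable D. Proof. exact: measurable_itv. Qed.
Let Doo : (leb D < +oo)%E.
Proof. by rewrite /D lebesgue_measure_itv/= lte_fin ab -EFinD ltry. Qed.

Lemma itvW x : x <= b -> `]a, x[ `<=` D.
Proof. by move=> xb; apply: subset_itvW. Qed.

Lemma intg_itvW f x : x <= b -> intg D f -> intg `]a, x[ f.
Proof. by move=> xb If; apply: (@integrableS _ _ _ leb _ _ _ mD _ (itvW xb) If). Qed.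

Lemma prim_le f x : x <= b -> intg D f -> `|prim a f x| <= \int[leb]_(t in D) `|f t|.
Proof.
move=> xb If; apply: le_trans (@le_normr_Rintegral _ _ _ leb _ _ _ (intg_itvW xb If)) _ => //.
apply: le_Rintegral_subset => //; first exact: itvW.
exact: (@integrable_norm _ _ _ leb).
Qed.

Lemma primB f g x : x <= b -> intg D f -> intg D g -> prim a (f \- g) x = prim a f x - prim a g x.
Proof. by move=> xb If Ig; apply: RintB => //; exact: intg_itvW. Qed.

Lemma measurable_prim f : intg D f -> measurable_fun D (prim a f).
Proof.
move=> If; pose f' := f \_ D.
have If' : intg `[a, b] f' by apply: intg_patch => //; exact: subset_itv_oo_cc.
have c := parameterized_integral_continuous (ltW ab) If'.
apply: (@eq_measurable_fun _ _ _ _ _ (fun x => parameterized_integral leb a x f')); last first.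
  apply: (@measurable_funS _ _ _ _ `[a, b]%classic) => //; first exact: subset_itv_oo_cc.
  by apply: subspace_continuous_measurable_fun.
move=> x; rewrite inE => xD; have /andP[ax xb] : a < x < b by rewrite /D/= in_itv in xD.
have Ix : intg `]a, x] f.
  apply: (@integrableS _ _ _ leb _ _ _ mD _ _ If) => //.
  by apply: subset_itvl; rewrite bnd_simp.
rewrite /parameterized_integral /prim /f' -Rintegral_mkcondr.
rewrite (_ : `[a, x] `&` D = `]a, x]%classic); last first.
  rewrite /D; apply/seteqP; split=> t /=; rewrite !in_itv/=.
    by move=> [/andP[_ tx] /andP[at' _]]; rewrite at'.
  by move=> /andP[at' tx]; rewrite (ltW at') tx at' (le_lt_trans tx xb).
by rewrite Rintegral_itv_bndo_bndc//; exact: (intg_itvW (ltW xb) If).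
Qed.

Lemma L1_continuous_dense f e : intg D f -> 0 < e ->
  exists g, [/\ continuous g, intg D g & \int[leb]_(t in D) `|f t - g t| <= e].
Proof.
move=> If e0; have [g [cg Ig h]] := @approximation_continuous_integrable R D f mD Doo If.
have : \int[leb]_(t in D) `|f t - g n t| @[n --> \oo] --> 0.
  apply: fine_cvg; exact: h.
move=> /cvgr0Pnorm_le/(_ _ e0) [n _ /(_ n (leqnn n)) hn].
by exists (g n); split => //; exact: le_trans (ler_norm _) hn.
Qed.

(** G_n H_n is split into G_n h, which converges by domination, and G_n (h - H_n), whose integral is
    at most [K] times the L^1 error. *)
Lemma cvg_Rintegral_mul (E : set R) (G H : nat -> R -> R) g h K : measurable E ->
  (forall n, measurable_fun E (G n)) -> measurable_fun E g ->
  (forall n t, E t -> `|G n t| <= K) -> (forall t, E t -> G n t @[n --> \oo] --> g t) ->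
  (forall n, intg E (H n)) -> intg E h ->
  \int[leb]_(t in E) `|h t - H n t| @[n --> \oo] --> 0 ->
  [/\ intg E (fun t => g t * h t), forall n, intg E (fun t => G n t * H n t) &
  \int[leb]_(t in E) (G n t * H n t) @[n --> \oo] --> \int[leb]_(t in E) (g t * h t)].
Proof.
move=> mE mG mg GK Gg IH Ih Hh.
have Inh := @integrable_norm _ _ _ leb _ _ Ih.
have mh := measurable_intg Ih.
have [|||||Igh cv _] := @cvg_Rintegral_dominated R E (fun n t => G n t * h t)
    (fun t => g t * h t) (fun t => K * `|h t|) mE.
- by move=> n; exact: measurable_funM.
- exact: measurable_funM.
- exact: intgZ.
- by apply: aeW => t Et; apply: cvgMl; exact: Gg.
- by apply: aeW => t Et n; rewrite normrM ler_wpM2r//; exact: GK.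
have IGH n : intg E (fun t => G n t * H n t).
  by apply: (intgM mE (mG n) (IH n)); apply: aeW => t; exact: GK.
have IGh n : intg E (fun t => G n t * h t).
  by apply: (intgM mE (mG n) Ih); apply: aeW => t; exact: GK.
split => //.
rewrite -[X in _ --> X]subr0.
rewrite (_ : (fun n => _) = (fun n => \int[leb]_(t in E) (G n t * h t) -
    \int[leb]_(t in E) (G n t * (h t - H n t)))); last first.
  apply/funext => n; rewrite -RintB//; last first.
    by apply: (intgM mE (mG n) (intgB mE Ih (IH n))); apply: aeW => t; exact: GK.
  by congr Rintegral; apply/funext => t; ring.
apply: cvgB => //.
have K0 : \int[leb]_(t in E) (K * `|h t - H n t|) @[n --> \oo] --> 0.
  rewrite -(mulr0 K) (_ : (fun n => _) = fun n => K * \int[leb]_(t in E) `|h t - H n t|).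
    by apply: cvgMr.
  apply/funext => n; apply: RintZ => //.
  by apply: (@integrable_norm _ _ _ leb); exact: intgB.
apply: norm_cvg0; apply: (squeeze_cvgr _ (cvg_cst 0) K0); apply: nearW => n.
rewrite normr_ge0/=; apply: le_norm_Rintegral_ae => //.
- by apply: (intgM mE (mG n) (intgB mE Ih (IH n))); apply: aeW => t; exact: GK.
- by apply: intgZ => //; apply: (@integrable_norm _ _ _ leb); exact: intgB.
- by apply: aeW => t Et; rewrite normrM ler_wpM2r//; exact: GK.
Qed.

Lemma prim_product_continuous G G' alpha beta a0 c x : has_deriv G G' -> continuous G' ->
  continuous alpha -> continuous beta -> a < x ->
  G (a0 + prim a alpha x) * (c + prim a beta x) = G a0 * c + prim a (fun t =>
    G' (a0 + prim a alpha t) * (c + prim a beta t) * alpha t + G (a0 + prim a alpha t) * beta t) x.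
Proof.
move=> dG cG' ca cb ax; have ea : a - 1 < a by rewrite ltrBlDr ltrDl.
have [A [A0 AE dA]] := prim_continuous_has_deriv ea ca.
have [B [B0 BE dB]] := prim_continuous_has_deriv ea cb.
pose F := (fun y => G (a0 + A y)) * (fun y => c + B y).
pose f y := G' (a0 + A y) * (c + B y) * alpha y + G (a0 + A y) * beta y.
have dA' y : a - 1 < y -> is_derive y 1 (fun y => a0 + A y) (alpha y).
  move=> ey; have := dA y ey => h; rewrite -[alpha y]add0r.
  exact: (@is_deriveD _ _ _ (cst a0) A).
have dB' y : a - 1 < y -> is_derive y 1 (fun y => c + B y) (beta y).
  move=> ey; have := dB y ey => h; rewrite -[beta y]add0r.
  exact: (@is_deriveD _ _ _ (cst c) B).
have dGA y : a - 1 < y -> is_derive y 1 (fun y => G (a0 + A y)) (G' (a0 + A y) * alpha y).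
  by move=> ey; apply: (is_derive1_comp (f := G)); [exact: dG|exact: dA'].
have cvd (k : R -> R) k' y : is_derive y 1 k k' -> {for y, continuous k}.
  by move=> [dk _]; apply: differentiable_continuous; apply/derivable1_diffP.
have dF y : a - 1 < y -> is_derive y 1 F (f y).
  move=> ey; have h1 := dGA y ey; have h2 := dB' y ey.
  have := is_deriveM h1 h2; rewrite /GRing.scale/= => h.
  rewrite /f (_ : _ + _ = G (a0 + A y) * beta y + (c + B y) * (G' (a0 + A y) * alpha y))//.
  by ring.
have cf y : a - 1 < y -> {for y, continuous f}.
  move=> ey; have h1 := cvd _ _ _ (dA' y ey); have h2 := cvd _ _ _ (dB' y ey).
  have h3 := cvd _ _ _ (dGA y ey).
  apply: cvgD; last by apply: cvgM => //; exact: cb.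
  apply: cvgM; last exact: ca.
  apply: cvgM => //.
  exact: (@cvg_comp _ _ _ (fun y => a0 + A y) G' _ _ _ h1 (cG' (a0 + A y))).
have [_ h] := FTC_oo ea ax dF cf.
have FE y : F y = G (a0 + A y) * (c + B y) by [].
rewrite -AE// -BE//; have -> : G a0 * c = F a by rewrite FE A0 B0 !addr0.
rewrite /prim (_ : Rintegral _ _ _ = \int[leb]_(t in `]a, x[) f t).
  by rewrite -h -FE addrC subrK.
apply: eq_Rintegral => t; rewrite inE/= in_itv/= => /andP[at' _].
by rewrite /f AE// BE.
Qed.

Lemma has_deriv_bounded G G' M : has_deriv G G' -> continuous G' ->
  exists2 K, 0 <= K & forall y, `|y| <= M -> `|G y| <= K /\ `|G' y| <= K.
Proof.
move=> dG cG'; have [M0|M0] := ltP M 0.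
  by exists 0 => // y yM; have := normr_ge0 y; rewrite leNgt (le_lt_trans yM).
have cG : continuous G.
  by move=> y; apply: differentiable_continuous; apply/derivable1_diffP; have [] := dG y.
have T0 : 0 < 2 * M + 1 by rewrite ltr_wpDl// mulr_ge0.
have sh (H : R -> R) : continuous H -> exists2 K, 0 <= K & forall y, `|y| <= M -> `|H y| <= K.
  move=> cH; have [|K K0 hK] := @bound_continuous R _ (fun y => H (y - M)) T0.
    move=> y; apply: continuous_comp; last exact: cH.
    by apply: cvgB; [exact: cvg_id|exact: cvg_cst].
  exists K => // y; rewrite ler_norml => /andP[My yM].
  have := hK (y + M); rewrite addrK; apply; rewrite in_itv/=; apply/andP; split; lra.
have [K K0 hK] := sh _ cG; have [K' K'0 hK'] := sh _ cG'.
exists (K + K'); first exact: addr_ge0.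
by move=> y yM; rewrite (le_trans (hK y yM)) ?lerDl// (le_trans (hK' y yM)) ?lerDr.
Qed.

(* By approximation of [alpha] and [beta] in L^1 by continuous functions. With
   [G = expR] this is the method of the integrating factor, with [G = id] it is
   integration by parts. *)
Lemma prim_product G G' alpha beta a0 c x : has_deriv G G' -> continuous G' ->
  intg D alpha -> intg D beta -> a < x <= b ->
  [/\ intg `]a, x[ (fun t => G' (a0 + prim a alpha t) * (c + prim a beta t) * alpha t),
      intg `]a, x[ (fun t => G (a0 + prim a alpha t) * beta t) &
  G (a0 + prim a alpha x) * (c + prim a beta x) = G a0 * c +
   (\int[leb]_(t in `]a, x[) (G' (a0 + prim a alpha t) * (c + prim a beta t) * alpha t) +
   \int[leb]_(t in `]a, x[) (G (a0 + prim a alpha t) * beta t))].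
Proof.
move=> dG cG' Ia Ib /andP[ax xb].
have cG : continuous G.
  by move=> y; apply: differentiable_continuous; apply/derivable1_diffP; have [] := dG y.
have dense h : intg D h -> exists g : nat -> R -> R, [/\ forall n, continuous (g n),
    forall n, intg D (g n), forall n, \int[leb]_(t in D) `|h t - g n t| <= 1 &
    \int[leb]_(t in D) `|h t - g n t| @[n --> \oo] --> 0].
  move=> Ih; have /choice[g hg] : forall n : nat, exists g, [/\ continuous g, intg D g &
      \int[leb]_(t in D) `|h t - g t| <= n.+1%:R^-1].
    by move=> n; apply: L1_continuous_dense.
  exists g; split => [n|n|n|]; [by case: (hg n)|by case: (hg n)| |].
    by case: (hg n) => _ _ h1; rewrite (le_trans h1)// invf_le1// ler1n.
  apply: (squeeze_cvgr _ (cvg_cst 0) cvg_harmonic); apply: nearW => n.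
  by rewrite Rintegral_ge0//=; case: (hg n).
have [al [cal Ial al1 al0]] := dense _ Ia; have [be [cbe Ibe be1 be0]] := dense _ Ib.
have prc h (g : nat -> R -> R) y : y <= b -> intg D h -> (forall n, intg D (g n)) ->
    \int[leb]_(t in D) `|h t - g n t| @[n --> \oo] --> 0 ->
    prim a (g n) y @[n --> \oo] --> prim a h y.
  move=> yb Ih Ig hg; apply/cvgrPdist_le => e e0.
  move/cvgr0Pnorm_le : hg => /(_ e e0); apply: filterS => n.
  rewrite -primB// => h1; apply: le_trans (prim_le yb (intgB mD Ih (Ig n))) _.
  exact: le_trans (ler_norm _) h1.
have prb h (g : nat -> R -> R) y n : y <= b -> intg D h -> (forall n, intg D (g n)) ->
    (forall n, \int[leb]_(t in D) `|h t - g n t| <= 1) ->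
    `|prim a (g n) y| <= \int[leb]_(t in D) `|h t| + 1.
  move=> yb Ih Ig hg; rewrite (_ : prim a (g n) y = prim a h y - (prim a h y - prim a (g n) y)).
    rewrite (le_trans (ler_normB _ _))// lerD//; first exact: prim_le.
    by rewrite -primB//; apply: le_trans (prim_le yb (intgB mD Ih (Ig n))) (hg n).
  by lra.
(* As the L^1 errors are at most 1, the primitives of all approximants stay within the bounds [M]
   and [K2], so [G] and [G'] matter only on a bounded interval. *)
pose M := `|a0| + (\int[leb]_(t in D) `|alpha t| + 1).
have [K K0 hK] := @has_deriv_bounded G G' M dG cG'.
pose K2 := `|c| + (\int[leb]_(t in D) `|beta t| + 1).
have K20 : 0 <= K2 by rewrite addr_ge0// addr_ge0// Rintegral_ge0.
have bA n t : t <= b -> `|a0 + prim a (al n) t| <= M.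
  by move=> tb; rewrite (le_trans (ler_normD _ _))// lerD2l prb.
have bB n t : t <= b -> `|c + prim a (be n) t| <= K2.
  by move=> tb; rewrite (le_trans (ler_normD _ _))// lerD2l prb.
have cA t : t <= b -> a0 + prim a (al n) t @[n --> \oo] --> a0 + prim a alpha t.
  by move=> tb; apply: cvgD; [exact: cvg_cst|exact: prc].
have cB t : t <= b -> c + prim a (be n) t @[n --> \oo] --> c + prim a beta t.
  by move=> tb; apply: cvgD; [exact: cvg_cst|exact: prc].
have sub := itvW xb.
have mE : measurable (`]a, x[%classic : set R) by exact: measurable_itv.
have mp h k : intg D h -> measurable_fun `]a, x[ (fun t => k + prim a h t).
  move=> Ih; apply: measurable_funD; first exact: measurable_cst.
  exact: (measurable_funS mD sub (measurable_prim Ih)).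
have mc (H : R -> R) h k : continuous H -> intg D h ->
    measurable_fun `]a, x[ (fun t => H (k + prim a h t)).
  move=> cH Ih; apply: (@measurableT_comp _ _ _ _ _ _ H); last exact: mp.
  exact: measurable_continuous.
have tE t : `]a, x[%classic t -> t <= b.
  by rewrite /= in_itv/= => /andP[_ tx]; rewrite (le_trans (ltW tx)).
have subI h (g : nat -> R -> R) : intg D h -> (forall n, intg D (g n)) ->
    \int[leb]_(t in D) `|h t - g n t| @[n --> \oo] --> 0 ->
    \int[leb]_(t in `]a, x[) `|h t - g n t| @[n --> \oo] --> 0.
  move=> Ih Ig hg; apply: (squeeze_cvgr _ (cvg_cst 0) hg); apply: nearW => n.
  rewrite Rintegral_ge0//=; apply: le_Rintegral_subset => //.
  by apply: (@integrable_norm _ _ _ leb); exact: intgB.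
have cvH (H : R -> R) t : continuous H -> t <= b ->
    H (a0 + prim a (al n) t) @[n --> \oo] --> H (a0 + prim a alpha t).
  by move=> cH tb; apply: (cvg_comp _ _ (cA t tb)); exact: cH.
have [|||||||I1 I1n c1] := @cvg_Rintegral_mul _
  (fun n t => G' (a0 + prim a (al n) t) * (c + prim a (be n) t)) al
  (fun t => G' (a0 + prim a alpha t) * (c + prim a beta t)) alpha (K * K2) mE.
- by move=> n; apply: measurable_funM; [exact: mc|exact: mp].
- by apply: measurable_funM; [exact: mc|exact: mp].
- move=> n t /tE tb; rewrite normrM ler_pM// ?bB//.
  by have [] := hK _ (bA n t tb).
- by move=> t /tE tb; apply: cvgM; [exact: cvH|exact: cB].
- by move=> n; exact: intg_itvW.
- exact: intg_itvW.
- exact: subI.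
have [|||||||I2 I2n c2] := @cvg_Rintegral_mul _
  (fun n t => G (a0 + prim a (al n) t)) be (fun t => G (a0 + prim a alpha t)) beta K mE.
- by move=> n; exact: mc.
- exact: mc.
- by move=> n t /tE tb; have [] := hK _ (bA n t tb).
- by move=> t /tE tb; exact: cvH.
- by move=> n; exact: intg_itvW.
- exact: intg_itvW.
- exact: subI.
split => //.
have L : G (a0 + prim a (al n) x) * (c + prim a (be n) x) @[n --> \oo] -->
    G (a0 + prim a alpha x) * (c + prim a beta x) by apply: cvgM; [exact: cvH|exact: cB].
have L' : G (a0 + prim a (al n) x) * (c + prim a (be n) x) @[n --> \oo] --> G a0 * c +
   (\int[leb]_(t in `]a, x[) (G' (a0 + prim a alpha t) * (c + prim a beta t) * alpha t) +
   \int[leb]_(t in `]a, x[) (G (a0 + prim a alpha t) * beta t)).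
  rewrite (_ : (fun n => _) = fun n => G a0 * c + (\int[leb]_(t in `]a, x[)
      (G' (a0 + prim a (al n) t) * (c + prim a (be n) t) * al n t) +
     \int[leb]_(t in `]a, x[) (G (a0 + prim a (al n) t) * be n t))).
    by apply: cvgD; [exact: cvg_cst|exact: cvgD].
  apply/funext => n; rewrite (prim_product_continuous _ _ dG cG' (cal n) (cbe n) ax).
  by congr (_ + _); exact: (RintD mE (I1n n) (I2n n)).
exact: (cvg_unique _ L L').
Qed.

End on_interval.
End primitives.

(** * Primitives and the space W^{1,p} *)

Section sobolev_primitives.
Context {R : realType}.
Implicit Types (f g h k phi alpha beta : R -> R) (c e x t : R).
Variables (a b : R) (ab : a < b).
Let D : set R := `]a, b[%classic.
Let mD : measurable D. Proof. exact: measurable_itv. Qed.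
Let Doo : (leb D < +oo)%E.
Proof. by rewrite /D lebesgue_measure_itv/= lte_fin ab -EFinD ltry. Qed.
Let lebD : fine (leb D) = b - a.
Proof. by rewrite /D lebesgue_measure_itv/= lte_fin ab. Qed.
Let inD x : D x -> a < x <= b.
Proof. by rewrite /D/= in_itv/= => /andP[-> /ltW]. Qed.
Let leD x : D x -> x <= b. Proof. by move=> /inD/andP[]. Qed.

Lemma intg_bounded f K : measurable_fun D f -> {ae leb, forall t, D t -> `|f t| <= K} -> intg D f.
Proof. by move=> mf fK; apply: (intg_le_ae mD mf (intg_cst K mD Doo)). Qed.

Lemma intg_prim h : intg D h -> intg D (prim a h).
Proof.
move=> Ih; apply: (@intg_bounded _ (\int[leb]_(t in D) `|h t|) (measurable_prim ab Ih)).
by apply: aeW => t /leD tb; exact: prim_le.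
Qed.

(** [prim_product] with [G = expR]. It is applied with -alpha to exhibit the solution formula as a
    primitive, and with alpha to bring an arbitrary solution to that formula. *)
Lemma expR_prim_solve alpha beta c : intg D alpha -> intg D beta ->
  let h := fun t => expR (prim a alpha t) * ((c + prim a beta t) * alpha t + beta t) in
  intg D h /\ forall x, D x -> expR (prim a alpha x) * (c + prim a beta x) = c + prim a h x.
Proof.
move=> Ia Ib h.
have key x : a < x <= b -> intg `]a, x[ h /\
    expR (prim a alpha x) * (c + prim a beta x) = c + prim a h x.
  move=> ax; have [I1 I2] := prim_product ab 0 c (@is_derive_expR R) (@continuous_expR R) Ia Ib ax.
  have hE : h = (fun t => expR (0 + prim a alpha t) * (c + prim a beta t) * alpha t +
      expR (0 + prim a alpha t) * beta t).
    by apply/funext => t; rewrite /h add0r; ring.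
  have mE : measurable (`]a, x[%classic : set R) by exact: measurable_itv.
  rewrite -(RintD mE I1 I2) hE expR0 mul1r add0r => ->; split => //.
  exact: (intgD mE I1 I2).
split; last by move=> x /inD ax; exact: (key x ax).2.
by apply: (key b _).1; rewrite ab lexx.
Qed.

(** Integration by parts, that is [prim_product] with [G = id] and the derivative of phi for
    [alpha]; the boundary terms vanish because phi is 0 at [a] and [b]. *)
Lemma prim_weak_deriv h c : intg D h -> is_weak_deriv a b 1 (fun x => c + prim a h x) h.
Proof.
move=> Ih; split; first exact: intg_locally.
move=> phi tphi; rewrite expr1 mulN1r; have sphi := test_smooth tphi.
have dphi := smooth_has_deriv sphi; have tphi' := test_derive1 tphi.
have cphi' := test_continuous tphi'; have [_ [c1 [d1 [ac1 d1b hphi]]]] := tphi.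
have phia : phi a = 0 by apply: hphi; rewrite in_itv/= leNgt ac1.
have phib : phi b = 0 by apply: hphi; rewrite in_itv/= andbC leNgt d1b.
have phiE t : a < t -> 0 + prim a (derive1 phi) t = phi t.
  move=> at'; have a1 : a - 1 < a by rewrite ltrBlDr ltrDl.
  have [_] := FTC_oo a1 at' (fun y _ => dphi y) (fun y _ => cphi' y).
  by rewrite /prim => <-; rewrite phia subr0 add0r.
have did : has_deriv (@id R) (cst 1) by move=> x; exact: is_derive_id.
have ax : a < b <= b by rewrite ab lexx.
have c1' : continuous (cst 1 : R -> R) by move=> x; exact: cvg_cst.
have [I1 I2] := prim_product ab 0 c did c1' (intg_continuous_oo a b cphi') Ih ax.
rewrite phiE// phib mul0r mul0r add0r => /eqP; rewrite eq_sym addr_eq0 => /eqP E.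
rewrite (_ : Rintegral _ _ _ = \int[leb]_(t in D) (cst 1 (0 + prim a (derive1 phi) t) * (c + prim a h t) * derive1 phi t)).
  rewrite E; congr (- _); apply: eq_Rintegral => t; rewrite inE => /inD/andP[at' _].
  by rewrite phiE// mulrC.
by congr Rintegral; apply/funext => t; rewrite mul1r.
Qed.

(** Du Bois-Reymond's lemma. The difference [f0] between [f] and the primitive of [h] annihilates
    derivatives of tests. A test minus its mass times the fixed test [w] of mass 1 is such a
    derivative, so [f0 - c] annihilates every test. *)
Lemma weak_deriv_prim f h : intg D f -> intg D h -> is_weak_deriv a b 1 f h ->
  exists c, {ae leb, forall t, D t -> f t = c + prim a h t}.
Proof.
move=> If Ih [_ fh]; have ab' := ab.
pose c1 := (2 * a + b) / 3; pose d1 := (a + 2 * b) / 3.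
have ac : a < c1 by rewrite /c1; lra.
have cd : c1 < d1 by rewrite /c1 /d1; lra.
have db : d1 < b by rewrite /d1; lra.
pose w0 := smooth_bump c1 d1 0; have tw0 : test_fun a b w0 by exact: smooth_bump_test.
have It phi : test_fun a b phi -> intg D phi.
  by move=> tphi; apply: intg_continuous_oo; exact: test_continuous tphi.
have J0 : 0 < \int[leb]_(x in D) w0 x.
  apply: (@Rintegral_gt0 R D c1 d1) => //; first exact: It.
  - by move=> x; exact: smooth_bump_ge0.
  - by apply: subset_itvW; exact: ltW.
  - by move=> x; exact: smooth_bump_gt0.
set J := Rintegral _ _ _ in J0; pose w x := J^-1 * w0 x.
have tw : test_fun a b w by exact: testZ.
have w1 : \int[leb]_(x in D) w x = 1 by rewrite RintZ ?It// mulVf// gt_eqF.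
pose f0 t := f t - prim a h t.
have Ip := intg_prim Ih; have If0 : intg D f0 by exact: intgB.
have If0t k phi : intg D k -> test_fun a b phi -> intg D (fun t => k t * phi t).
  by move=> Ik tphi; apply: intg_test => //; exact: intg_locally.
have f0' psi : test_fun a b psi -> \int[leb]_(t in D) (f0 t * derive1 psi t) = 0.
  move=> tpsi; have t' := test_derive1 tpsi.
  rewrite (_ : (fun t => _) = fun t => f t * derive1 psi t - prim a h t * derive1 psi t).
    rewrite (RintB mD (If0t _ _ If t') (If0t _ _ Ip t')).
    have [_ /(_ psi tpsi) E] := prim_weak_deriv 0 Ih.
    have E' := fh psi tpsi; rewrite -E in E'.
    rewrite E' -RintB//; last 2 first.
    - rewrite (_ : (fun x => _) = fun t => prim a h t * derive1 psi t); first exact: If0t.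
      by apply/funext => t; rewrite add0r.
    - exact: If0t.
    rewrite (_ : (fun x => _) = fun=> 0) ?Rint0//; apply/funext => t.
    by rewrite add0r subrr.
  by apply/funext => t; rewrite /f0 mulrBl.
(* The only candidate: as [w] has mass 1, this is the value of [f0] once [f0] is constant. *)
pose c := \int[leb]_(t in D) (f0 t * w t).
exists c; have Ic := intg_cst c mD Doo.
have Ig : intg D (f0 \- cst c) by exact: intgB.
have : {ae leb, forall t : R, t \in `]a, b[ -> (f0 \- cst c) t = 0}.
  apply: fundamental_lemma; first exact: intg_locally.
  move=> phi tphi; pose J' := \int[leb]_(t in D) phi t.
  have tp : test_fun a b (fun x => phi x + - J' * w x) by apply: testD => //; exact: testZ.
  have [|psi [tpsi psi' _]] := test_primitive tp.
    have Iw := It _ tw.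
    rewrite (RintD mD (It _ tphi) (intgZ (- J') mD Iw)) RintZ// w1 mulr1.
    by rewrite -/J' subrr.
  have := f0' psi tpsi; rewrite psi'.
  rewrite (_ : (fun t => _) = fun t => f0 t * phi t + - J' * (f0 t * w t)); last first.
    by apply/funext => t; ring.
  have I1 := If0t _ _ If0 tphi; have I2 := If0t _ _ If0 tw.
  rewrite (RintD mD I1 (intgZ _ mD I2)) RintZ// -/c => E.
  rewrite (_ : (fun x => _) = fun x => f0 x * phi x - c * phi x); last first.
    by apply/funext => t /=; rewrite mulrBl.
  rewrite (RintB mD I1 (intgZ _ mD (It _ tphi))) RintZ ?It// -/J'.
  by rewrite -[RHS]E; ring.
by apply: aeS => t + Dt => /(_ Dt) /eqP; rewrite /= subr_eq0 /f0 subr_eq => /eqP.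
Qed.

Variables (p : \bar R) (p1 : (1 <= p)%E).
Local Notation X := (Lp a b p).
Local Notation W1 := (Wlp a b 1 p).
Local Notation N := (nrm X).
Let bX : banach X. Proof. exact: Lp_banach. Qed.

Lemma W1_prim c h : fmem X h -> fmem W1 (fun t => c + prim a h t) /\
  {ae leb, forall t, D t -> Dr a b 1 (fun t => c + prim a h t) t = h t}.
Proof.
move=> mh; have Ih := intg_Lp ab p1 mh.
have wd := prim_weak_deriv c Ih.
have mX : fmem X (fun t => c + prim a h t).
  apply: (Lp_bounded ab p1 (K := `|c| + \int[leb]_(t in D) `|h t|)).
    by apply: measurable_funD; [exact: measurable_cst|exact: measurable_prim].
  by apply: aeW => t /leD tb; rewrite (le_trans (ler_normD _ _))// lerD2l prim_le.
have mW : fmem W1 (fun t => c + prim a h t).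
  apply: WlpP => // -[_|[_|//]]; last by exists h.
  by exists (fun t => c + prim a h t) => //; exact: (weak_deriv0 ab p1).
by split => //; exact: Wlp_Dr mW _ wd.
Qed.

Lemma W1_AC f : fmem W1 f -> exists c, {ae leb, forall t, D t -> f t = c + prim a (Dr a b 1 f) t}.
Proof.
move=> mf; have [h1 h2] := Wlp_weak_deriv p1 mf (leqnn 1).
by apply: weak_deriv_prim h1; [exact: (intg_Lp ab p1 (Wlp_Lp mf))|exact: (intg_Lp ab p1 h2)].
Qed.

Lemma nrm_Dr l j f : fmem (Wlp a b l p) f -> (j <= l)%N -> N (Dr a b j f) <= nrm (Wlp a b l p) f.
Proof. by move=> mf jl; have := bop_le (Dr_bop ab p1 jl) mf; rewrite mul1r. Qed.

(** The primitive of the derivative [h] is bounded by the L^1 norm of [h], and the constant [c] is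
    bounded by averaging [f] minus this primitive over the interval. [Lp_L1] controls the L^1 norms,
    with its constant [d]. *)
Lemma W1_sup : exists2 C, 0 <= C & forall f, fmem W1 f ->
  {ae leb, forall t, D t -> `|f t| <= C * nrm W1 f}.
Proof.
pose d := b - a + 1; have ba : 0 < b - a by rewrite subr_gt0.
have d0 : 0 <= d by rewrite addr_ge0// ltW.
exists ((b - a)^-1 * d + 2 * d) => [|f mf].
  by rewrite addr_ge0 ?mulr_ge0// invr_ge0 ltW.
have [c fc] := W1_AC mf; have [h1 h2] := Wlp_weak_deriv p1 mf (leqnn 1).
set h := Dr a b 1 f in fc h1 h2; have [Ih hN] := Lp_L1 ab p1 h2.
have [If fN] := Lp_L1 ab p1 (Wlp_Lp mf).
have Nh : N h <= nrm W1 f by exact: nrm_Dr.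
have Nf := nrm_Lp_Wlp ab p1 mf.
pose H := \int[leb]_(t in D) `|h t|.
have HN : H <= d * nrm W1 f by apply: (le_trans hN); rewrite ler_wpM2l.
have fN' : \int[leb]_(t in D) `|f t| <= d * nrm W1 f by apply: (le_trans fN); rewrite ler_wpM2l.
have : (b - a) * `|c| <= \int[leb]_(t in D) (`|f t| + H).
  have Inf := @integrable_norm _ _ _ leb _ _ If; have IH := intg_cst H mD Doo.
  have -> : (b - a) * `|c| = `|\int[leb]_(t in D) (cst c t)|.
    rewrite (@Rintegral_cst _ _ _ leb _ mD) normrM mulrC; congr (_ * _).
    by rewrite lebD ger0_norm// ltW.
  apply: le_norm_Rintegral_ae => //; [exact: intg_cst|exact: (intgD mD Inf IH)|].
  apply: aeS fc => t + Dt => /(_ Dt) E /=; rewrite (_ : c = f t - prim a h t); last by rewrite E addrK.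
  by rewrite (le_trans (ler_normB _ _))// lerD2l prim_le// leD.
have -> : \int[leb]_(t in D) (`|f t| + H) = \int[leb]_(t in D) `|f t| + (b - a) * H.
  rewrite (RintD mD (@integrable_norm _ _ _ leb _ _ If) (intg_cst H mD Doo)); congr (_ + _).
  rewrite (@Rintegral_cst _ _ _ leb _ mD) mulrC; congr (_ * _).
  by rewrite lebD.
move=> hc; have {}hc : `|c| <= (b - a)^-1 * (d * nrm W1 f) + H.
  rewrite -(ler_pM2l ba) mulrDr mulVKf ?gt_eqF//.
  by apply: (le_trans hc); rewrite lerD2r.
apply: aeS fc => t + Dt => /(_ Dt) ->; rewrite (le_trans (ler_normD _ _))//.
have hp : `|prim a h t| <= H by apply: prim_le => //; exact: leD.
apply: (le_trans (lerD hc hp)).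
rewrite (_ : (_ + _ * d) * nrm W1 f = (b - a)^-1 * (d * nrm W1 f) + (d * nrm W1 f + d * nrm W1 f)).
  by rewrite -addrA lerD2l lerD.
by ring.
Qed.

Lemma Lp_mul f g K : measurable_fun D f -> {ae leb, forall t, D t -> `|f t| <= K} -> 0 <= K ->
  fmem X g -> fmem X (fun t => f t * g t) /\ N (fun t => f t * g t) <= K * N g.
Proof.
move=> mf fK K0 mg; have mKg := memZ bX K mg; have mg' := measurable_Lp mg.
have mfg : measurable_fun D (fun t => f t * g t) by exact: measurable_funM.
have h : {ae leb, forall t, D t -> `|f t * g t| <= `|K * g t|}.
  by apply: aeS fK => t fK Dt; rewrite !normrM ler_wpM2r// (le_trans (fK Dt))// ler_norm.
split; first exact: (Lp_le p1 mfg mKg h).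
by rewrite -{1}(ger0_norm K0) -(nrmZ bX)//; exact: nrm_Lp_le.
Qed.

(** The identity x^-1 = x (x^2)^-1, true also at 0 where the inverse is 0 by convention, reduces the
    claim to the measurability of real powers. *)
Lemma measurable_inv f : measurable_fun D f -> measurable_fun D (fun t => (f t)^-1).
Proof.
move=> mf; rewrite (_ : (fun t => _) = fun t => f t * ((f t ^+ 2) `^ (-1))); last first.
  apply/funext => t; rewrite powR_inv1 ?sqr_ge0// expr2 invfM mulrA.
  by have [->|f0] := eqVneq (f t) 0; rewrite ?invr0 ?mulr0// mulfV// mul1r.
apply: measurable_funM => //.
apply: (@measurableT_comp _ _ _ _ _ _ (@powR R ^~ (-1))) => //.
exact: measurable_funX.
Qed.

End sobolev_primitives.

(** * The equation without convolution *)

Section base_problem.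
Context {R : realType}.
Implicit Types (f g h k F G : R -> R) (c t : R).
Variables (a b : R) (p : \bar R) (ab : a < b) (p1 : (1 <= p)%E).
Let D : set R := `]a, b[%classic.
Let mD : measurable D. Proof. exact: measurable_itv. Qed.
Let Doo : (leb D < +oo)%E.
Proof. by rewrite /D lebesgue_measure_itv/= lte_fin ab -EFinD ltry. Qed.
Let leD x : D x -> x <= b. Proof. by rewrite /D/= in_itv/= => /andP[_ /ltW]. Qed.
Local Notation X := (Lp a b p).
Local Notation W1 := (Wlp a b 1 p).
Local Notation N := (nrm X).
Let bX : banach X. Proof. exact: Lp_banach. Qed.

Variables (lambda q s : R -> R) (m : R).
Hypotheses (Il : intg D lambda) (mq : fmem X q) (ms : fmem X s) (m0 : 0 < m).
Hypothesis qm : {ae leb, forall t, D t -> m <= `|q t|}.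
Let alpha t := s t / q t.
Hypothesis kappa0 : \int[leb]_(t in D) (lambda t * expR (- prim a alpha t)) != 0.

Let L_div G : fmem X G -> fmem X (fun t => G t / q t) /\ N (fun t => G t / q t) <= m^-1 * N G.
Proof.
move=> mG; rewrite (_ : (fun t => _) = fun t => (q t)^-1 * G t); last first.
  by apply/funext => t; rewrite mulrC.
apply: (Lp_mul ab p1) => //.
- exact: (measurable_inv (measurable_Lp mq)).
- by apply: aeS qm => t + Dt => /(_ Dt) h; rewrite normfV lef_pV2// posrE// (lt_le_trans m0).
- by rewrite invr_ge0 ltW.
Qed.

Let malpha : fmem X alpha. Proof. exact: (L_div ms).1. Qed.
Let Ialpha : intg D alpha. Proof. exact: intg_Lp malpha. Qed.
Let Lam := \int[leb]_(t in D) `|alpha t|.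
Let K := expR Lam.

Let K1 t : D t -> `|expR (prim a alpha t)| <= K /\ `|expR (- prim a alpha t)| <= K.
Proof.
move=> /leD tb; have := prim_le tb Ialpha; rewrite -/Lam ler_norml => /andP[h1 h2].
by rewrite !ger0_norm ?expR_ge0// !ler_expR h2 lerNl.
Qed.

Let mE : measurable_fun D (fun t => expR (prim a alpha t)).
Proof.
apply: (@measurableT_comp _ _ _ _ _ _ (@expR R)); last exact: measurable_prim.
exact: measurable_expR.
Qed.

Let mE' : measurable_fun D (fun t => expR (- prim a alpha t)).
Proof.
apply: (@measurableT_comp _ _ _ _ _ _ (@expR R)); first exact: measurable_expR.
by apply: measurable_funN; exact: measurable_prim.
Qed.

Let IE F : intg D F -> intg D (fun t => expR (prim a alpha t) * F t).
Proof. by move=> IF; apply: (intgM (K := K) mD mE IF); apply: aeW => t /K1[]. Qed.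

(** Variation of constants for k' + alpha k = F with k(a) = c. The equation k' q + k s = G takes
    this form after division by [q], with F = G / q. *)
Let sol c F t := expR (- prim a alpha t) * (c + prim a (fun t => expR (prim a alpha t) * F t) t).

Let K0 : 0 <= K. Proof. exact: expR_ge0. Qed.

Let primE_le F t : intg D F -> t <= b ->
  `|prim a (fun t => expR (prim a alpha t) * F t) t| <= K * \int[leb]_(t in D) `|F t|.
Proof.
move=> IF tb; apply: (le_trans (prim_le tb (IE IF))).
have InF := @integrable_norm _ _ _ leb _ _ IF.
rewrite -RintZ//; apply: le_Rintegral_ae => //.
- by apply: (@integrable_norm _ _ _ leb); exact: IE.
- exact: intgZ.
- by apply: aeW => r Dr; rewrite normrM ler_wpM2r//; have [] := K1 Dr.
Qed.

Let sol_le c F t : intg D F -> D t -> `|sol c F t| <= K * (`|c| + K * \int[leb]_(t in D) `|F t|).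
Proof.
move=> IF Dt; rewrite normrM ler_pM//; first by have [] := K1 Dt.
by rewrite (le_trans (ler_normD _ _))// lerD2l primE_le// leD.
Qed.

Let msol c F : intg D F -> measurable_fun D (sol c F).
Proof.
move=> IF; apply: measurable_funM; first exact: mE'.
by apply: measurable_funD; [exact: measurable_cst|apply: measurable_prim; [exact: ab|exact: IE]].
Qed.

Let J F := \int[leb]_(t in D) (lambda t * sol 0 F t).
Let kappa := \int[leb]_(t in D) (lambda t * expR (- prim a alpha t)).

Let IlE : intg D (fun t => lambda t * expR (- prim a alpha t)).
Proof.
rewrite (_ : (fun t => _) = fun t => expR (- prim a alpha t) * lambda t); last first.
  by apply/funext => t; rewrite mulrC.
by apply: (intgM (K := K)) => //; apply: aeW => t /K1[].
Qed.

Let Ilsol c F : intg D F -> intg D (fun t => lambda t * sol c F t).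
Proof.
move=> IF; rewrite (_ : (fun t => _) = fun t => sol c F t * lambda t); last first.
  by apply/funext => t; rewrite mulrC.
by apply: (intgM mD (msol c IF) Il); apply: aeW => t; exact: sol_le.
Qed.

(** The dependence on [c] is affine with slope [kappa]; as [kappa] is not 0, the integral condition
    determines [c]. *)
Let lambda_sol c F : intg D F ->
  \int[leb]_(t in D) (lambda t * sol c F t) = c * kappa + J F.
Proof.
move=> IF; rewrite /kappa -RintZ// -(RintD mD (intgZ c mD IlE) (Ilsol 0 IF)).
by congr Rintegral; apply/funext => t; rewrite /sol; ring.
Qed.

Let J_le F : intg D F -> `|J F| <= (K * K * \int[leb]_(t in D) `|lambda t|) * \int[leb]_(t in D) `|F t|.
Proof.
move=> IF; have Inl := @integrable_norm _ _ _ leb _ _ Il.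
set I := \int[leb]_(t in D) `|F t|.
rewrite (_ : _ * I = \int[leb]_(t in D) (K * K * I * `|lambda t|)); last first.
  by rewrite RintZ//; ring.
apply: le_norm_Rintegral_ae => //; [exact: Ilsol|exact: intgZ|].
apply: aeW => t Dt; rewrite normrM mulrC ler_wpM2r//.
by rewrite (le_trans (sol_le 0 IF Dt))// normr0 add0r mulrA.
Qed.

(** [expR_prim_solve] with -alpha exhibits the solution formula [k0] as [c] plus the primitive of F
    - k0 alpha, which is in L^p because [k0] is bounded. This yields both membership in W^{1,p} and
    the equation; [c] is read off from [lambda_sol]. *)
Lemma base_exists G c0 : fmem X G -> exists k, [/\ fmem W1 k,
  {ae leb, forall t, D t -> Dr a b 1 k t * q t + k t * s t = G t} &
  \int[leb]_(t in D) (lambda t * k t) = c0].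
Proof.
move=> mG; pose F t := G t / q t.
have [mF _] := L_div mG; have IF : intg D F by exact: intg_Lp mF.
pose c := (c0 - J F) / kappa; pose k0 := sol c F.
have Nalpha : intg D (fun t => - alpha t).
  by rewrite (_ : (fun t => _) = fun t => -1 * alpha t);
    [exact: intgZ|apply/funext => t; rewrite mulN1r].
have primN t : D t -> prim a (fun t => - alpha t) t = - prim a alpha t.
  move=> Dt; rewrite (_ : (fun t => _) = fun t => -1 * alpha t);
    last by apply/funext => r; rewrite mulN1r.
  by rewrite /prim RintZ ?mulN1r//; apply: intg_itvW Ialpha; exact: leD.
have [_ h] := expR_prim_solve ab c Nalpha (IE IF).
have mk0 : fmem X k0.
  by apply: (Lp_bounded ab p1 (msol c IF)); apply: aeW => t; exact: sol_le.
have mak : fmem X (fun t => k0 t * alpha t).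
  have h' t : D t -> `|k0 t| <= K * (`|c| + K * \int[leb]_(t in D) `|F t|) by exact: sol_le.
  have h'' : {ae leb, forall t, `]a, b[%classic t -> `|sol c F t| <=
      K * (`|c| + K * \int[leb]_(t in D) `|F t|)} by apply: aeW.
  have [] // := Lp_mul ab p1 (msol c IF) h'' _ malpha.
  by rewrite mulr_ge0// addr_ge0// mulr_ge0// Rintegral_ge0.
pose H t := F t - k0 t * alpha t.
have mH : fmem X H by exact: (memB bX mF mak).
have kE t : D t -> k0 t = c + prim a H t.
  move=> Dt; have := h t Dt; rewrite primN// -/(sol c F t) -/(k0 t) => ->; congr (_ + _).
  apply: eq_Rintegral => r; rewrite inE/= in_itv/= => /andP[ar rt].
  have Dr' : D r by rewrite /D/= in_itv/= ar (lt_le_trans rt)// leD.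
  rewrite primN// mulrDr mulrA -/(sol c F r) /H /k0 mulrN addrC; congr (_ - _).
  by rewrite mulrA -expRD addNr expR0 mul1r.
have [mk Dk] := W1_prim ab p1 c mH.
exists (fun t => c + prim a H t); split => //.
- apply: aeS2 qm Dk => t qm' Dk Dt; rewrite Dk// -kE// /H /F /alpha.
  have q0 : q t != 0 by rewrite -normr_gt0 (lt_le_trans m0)// qm'.
  by field.
- transitivity (\int[leb]_(t in D) (lambda t * k0 t)).
    by apply: eq_Rintegral => t; rewrite inE => Dt; rewrite kE.
  by rewrite lambda_sol// /c divfK// subrK.
Qed.

(** Multiplication by the integrating factor shows that an arbitrary solution is [sol c F] for some
    [c], and the integral condition bounds [c]. The estimate therefore holds for every solution and
    contains uniqueness at a fixed time. *)
Lemma base_bound : exists2 C, 0 <= C & forall k G, fmem W1 k -> fmem X G ->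
  {ae leb, forall t, D t -> Dr a b 1 k t * q t + k t * s t = G t} ->
  nrm W1 k <= C * (N G + `|\int[leb]_(t in D) (lambda t * k t)|).
Proof.
pose d := b - a + 1; have d0 : 0 <= d by rewrite addr_ge0// subr_ge0 ltW.
pose L := \int[leb]_(t in D) `|lambda t|.
have L0 : 0 <= L by exact: Rintegral_ge0.
have im0 : 0 <= m^-1 by rewrite invr_ge0 ltW.
(* As multiples of V = N G + |g|, the constants [A1], [A2] and [A3] bound the L^1 norm of F = G / q,
   the constant [c], and the supremum of |k|. *)
pose A1 := d * m^-1.
have A10 : 0 <= A1 by exact: mulr_ge0.
pose A2 := `|kappa|^-1 * (1 + K * K * L * A1).
have A20 : 0 <= A2 by rewrite mulr_ge0 ?invr_ge0// addr_ge0// !mulr_ge0.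
pose A3 := K * (A2 + K * A1).
have A30 : 0 <= A3 by rewrite mulr_ge0// addr_ge0// mulr_ge0.
exists (A3 * N (cst 1) + (m^-1 + A3 * N alpha)).
  by rewrite !addr_ge0// mulr_ge0// nrm_ge0.
move=> k G mk mG kG; set g := \int[leb]_(t in D) (lambda t * k t).
pose V := N G + `|g|; have NG0 := nrm_ge0 bX G.
have V0 : 0 <= V by rewrite addr_ge0.
pose F t := G t / q t.
have [mF NF] := L_div mG; have [IF hF] := Lp_L1 ab p1 mF.
set I := \int[leb]_(t in D) `|F t| in hF.
have IA : I <= A1 * V.
  apply: (le_trans hF); rewrite /A1 -mulrA ler_wpM2l// (le_trans NF)// ler_wpM2l//.
  by rewrite lerDl.
have [c kc] := W1_AC ab p1 mk; have [h1 h2] := Wlp_weak_deriv p1 mk (leqnn 1).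
set h := Dr a b 1 k in kc h1 h2 kG; have Ih : intg D h by exact: intg_Lp h2.
have [_ E] := expR_prim_solve ab c Ialpha Ih.
have kE t : D t -> c + prim a h t = sol c F t.
  move=> Dt; rewrite /sol -[LHS]mul1r -expR0 -(addNr (prim a alpha t)) expRD -mulrA E//.
  congr (_ * (_ + _)); apply: Rintegral_ae_eq => //.
  - apply: measurable_intg; apply: intg_itvW (leD Dt) _.
    by have [] := expR_prim_solve ab c Ialpha Ih.
  - by apply: measurable_intg; apply: intg_itvW (leD Dt) _; exact: IE.
  apply: aeS3 kc kG qm => r kc kG qm'; rewrite /= in_itv/= => /andP[ar rt].
  have Dr' : D r by rewrite /D/= in_itv/= ar (lt_le_trans rt)// leD.
  rewrite -kc// /F -kG// /alpha; congr (_ * _).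
  have q0 : q r != 0 by rewrite -normr_gt0 (lt_le_trans m0)// qm'.
  by field.
have k_sol : {ae leb, forall t, D t -> k t = sol c F t}.
  by apply: aeS kc => t kc Dt; rewrite kc// kE.
have gE : g = c * kappa + J F.
  rewrite -lambda_sol//; apply: Rintegral_ae_eq => //.
  - apply: measurable_funM; first exact: measurable_intg Il.
    by apply: measurable_Lp; exact: Wlp_Lp mk.
  - by apply: measurable_intg; exact: Ilsol.
  - by apply: aeS k_sol => t ks Dt; rewrite ks.
have cA : `|c| <= A2 * V.
  have k0 : 0 < `|kappa| by rewrite normr_gt0.
  have -> : c = (g - J F) / kappa by rewrite gE addrK mulfK.
  rewrite normrM normfV mulrC -mulrA ler_wpM2l ?invr_ge0//.
  apply: (le_trans (ler_normB _ _)); rewrite mulrDl mul1r lerD//.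
    by rewrite lerDr.
  by apply: (le_trans (J_le IF)); rewrite -(mulrA _ A1) ler_wpM2l// !mulr_ge0.
have kA : {ae leb, forall t, D t -> `|k t| <= A3 * V}.
  apply: aeS k_sol => t ks Dt; rewrite ks//; apply: (le_trans (sol_le c IF Dt)).
  rewrite /A3 -mulrA ler_wpM2l// mulrDl lerD// -mulrA ler_wpM2l//.
have m1 : fmem X (cst 1) by exact: (Lp_cst ab p1 1).
have Nk : N k <= A3 * V * N (cst 1).
  have -> : A3 * V * N (cst 1) = N (fun t => A3 * V * cst 1 t).
    by rewrite (nrmZ bX (A3 * V) m1) ger0_norm// mulr_ge0.
  apply: nrm_Lp_le => //.
  - by apply: measurable_Lp; exact: Wlp_Lp mk.
  - exact: (memZ bX (A3 * V) m1).
  - by apply: aeS kA => t kA Dt; rewrite mulr1 (le_trans (kA Dt))// ler_norm.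
have [mka Nka] := Lp_mul ab p1 (measurable_Lp (Wlp_Lp mk)) kA (mulr_ge0 A30 V0) malpha.
have Nh : N h <= m^-1 * V + A3 * V * N alpha.
  have -> : N h = N (F \- (fun t => k t * alpha t)).
    congr fine; apply: Lp_ae => //; first exact: memB.
    apply: aeS2 kG qm => r kG qm' Dr'; rewrite /= /F -kG// /alpha.
    have q0 : q r != 0 by rewrite -normr_gt0 (lt_le_trans m0)// qm'.
    by field.
  apply: (le_trans (nrmB bX mF mka)); rewrite lerD//; apply: (le_trans NF).
  by rewrite ler_wpM2l// lerDl.
rewrite (nrm_WlpE ab p1 mk) big_ord_recl big_ord1/=.
have -> : N (Dr a b 0 k) = N k.
  congr fine; apply: Lp_ae => //.
  - by have [] := Wlp_weak_deriv p1 mk (leq0n 1).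
  - exact: Wlp_Lp mk.
  - exact: (Wlp_Dr0 ab p1 mk).
rewrite mulrDl lerD//; first by rewrite mulrAC.
by apply: (le_trans Nh); rewrite mulrDl lerD// mulrAC.
Qed.

End base_problem.

(** * The convolution term *)

Section bilinear.
Context {R : realType}.
Implicit Types (f g h k v : R -> R).
Variables (a b : R) (p : \bar R) (n : nat).
Hypotheses (a0 : 0 < a) (ab : a < b) (p1 : (1 <= p)%E).
Let D : set R := `]a, b[%classic.
Let mD : measurable D. Proof. exact: measurable_itv. Qed.
Local Notation X := (Lp a b p).
Local Notation W1 := (Wlp a b 1 p).
Local Notation W2 := (Wlp a b 2 p).
Local Notation N := (nrm X).
Let bX : banach X. Proof. exact: Lp_banach. Qed.
Let bW1 : banach W1. Proof. exact: Wlp_banach. Qed.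
Let bW2 : banach W2. Proof. exact: Wlp_banach. Qed.

Lemma Lp_sub_ae0 f g : fmem X f -> fmem X g ->
  {ae leb, forall t : R, t \in `]a, b[ -> f t = g t} -> N (f \- g) = 0.
Proof.
move=> mf mg fg; rewrite -(nrm0 bX); congr fine.
apply: (Lp_ae ab p1); [exact: memB|exact: mem0|].
by apply: aeS fg => t E Dt /=; rewrite E// subrr.
Qed.

Lemma Lp_sub_eq0 f g : fmem X f -> fmem X g -> N (f \- g) = 0 ->
  {ae leb, forall t : R, t \in `]a, b[ -> f t = g t}.
Proof.
move=> mf mg fg; have := nrm_Lp_eq0 p1 (memB bX mf mg) fg.
by apply: aeS => t + Dt => /(_ Dt) /eqP; rewrite /= subr_eq0 => /eqP.
Qed.

Lemma Dr1_W1 v : fmem W2 v -> fmem W1 (Dr a b 1 v) /\ nrm W1 (Dr a b 1 v) <= nrm W2 v.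
Proof.
move=> mv; have [h1 m1] := Wlp_weak_deriv p1 mv (isT : (1 <= 2)%N).
have [h2 m2] := Wlp_weak_deriv p1 mv (leqnn 2).
have h12 := Dr_iter p1 mv (isT : (1 < 2)%N).
have mW : fmem W1 (Dr a b 1 v).
  apply: WlpP => // -[_|[_|//]]; last by exists (Dr a b 2 v).
  by exists (Dr a b 1 v) => //; exact: (weak_deriv0 ab p1 m1).
split => //; rewrite !nrm_WlpE// !big_ord_recl !big_ord0 /= !addr0.
have [_ m0] := Wlp_weak_deriv p1 mW (leq0n 1).
have [_ m3] := Wlp_weak_deriv p1 mW (leqnn 1).
have -> : N (Dr a b 0 (Dr a b 1 v)) = N (Dr a b 1 v).
  by congr fine; apply: Lp_ae => //; exact: (Wlp_Dr0 ab p1 mW).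
have -> : N (Dr a b (bump 0 0) (Dr a b 1 v)) = N (Dr a b 2 v).
  by congr fine; apply: Lp_ae => //; exact: (Wlp_Dr p1 mW (leqnn 1) h12).
by rewrite lerDr (nrm_ge0 bX).
Qed.

(** Bound for the coefficient (n - 1)/r of [radial] on ]a, b[, finite since [0 < a]. *)
Let c1 := `|n%:R - 1| / a.
Let c10 : 0 <= c1. Proof. by rewrite divr_ge0// ltW. Qed.

Lemma radial_Lp v1 v2 : fmem X v1 -> fmem X v2 -> fmem X (radial n v1 v2) /\
  N (radial n v1 v2) <= N v2 + c1 * N v1.
Proof.
move=> m1 m2; have mc : measurable_fun D (fun r : R => (n%:R - 1) * r^-1).
  apply: measurable_funM; first exact: measurable_cst.
  by apply: measurable_inv; exact: measurable_id.
have [|m3 N3] := @Lp_mul R a b ab p p1 _ v1 c1 mc _ c10 m1.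
  apply: aeW => t /=; rewrite in_itv/= => /andP[at' _]; rewrite normrM /c1 ler_wpM2l//.
  by rewrite normfV lef_pV2 ?posrE// ?(le_trans (ltW at') (ler_norm _))// normr_gt0 gt_eqF// (lt_trans a0).
rewrite (_ : radial n v1 v2 = v2 \+ (fun r => (n%:R - 1) * r^-1 * v1 r))//.
split; first exact: memD.
by apply: (le_trans (nrmD bX m2 m3)); rewrite lerD2l.
Qed.

(** With v = D_t u(s, .) this is the integrand of the convolution, with v = u(0, .) it gives the
    local terms of the equation, so one set of estimates serves both. *)
Definition kuint k v : R -> R := fun r =>
  Dr a b 1 k r * Dr a b 1 v r + k r * radial n (Dr a b 1 v) (Dr a b 2 v) r.

(** Each product has one bounded and one L^p factor: [Dr 1 v] is in W^{1,p}, hence bounded, against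
    [Dr 1 k], and [k] is bounded against the radial term. *)
Lemma kuint_le : exists2 C, 0 <= C & forall k v, fmem W1 k -> fmem W2 v ->
  fmem X (kuint k v) /\ N (kuint k v) <= C * nrm W1 k * nrm W2 v.
Proof.
have [C C0 hC] := W1_sup ab p1.
exists (C + C * (1 + c1)) => [|k v mk mv]; first by rewrite addr_ge0// mulr_ge0// addr_ge0.
have [m1 N1] := Dr1_W1 mv; have [_ m2] := Wlp_weak_deriv p1 mv (leqnn 2).
have [_ m1'] := Wlp_weak_deriv p1 mv (isT : (1 <= 2)%N).
have [_ mk1] := Wlp_weak_deriv p1 mk (leqnn 1).
have [mr Nr] := radial_Lp m1' m2.
have Nk0 := nrm_ge0 bW1 k; have Nv0 := nrm_ge0 bW2 v.
have [] := Lp_mul ab p1 (measurable_Lp m1') _ _ mk1 (K := C * nrm W2 v).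
- apply: aeS (hC _ m1) => t h Dt; rewrite (le_trans (h Dt))// ler_wpM2l//.
- exact: mulr_ge0.
move=> m3 N3; have [] := Lp_mul ab p1 (measurable_Lp (Wlp_Lp mk)) (hC _ mk) _ mr.
  exact: mulr_ge0.
move=> m4 N4.
rewrite (_ : kuint k v = (fun r => Dr a b 1 v r * Dr a b 1 k r) \+
  (fun r => k r * radial n (Dr a b 1 v) (Dr a b 2 v) r)); last first.
  by apply/funext => r; rewrite /kuint /= [X in X + _]mulrC.
split; first exact: memD.
apply: (le_trans (nrmD bX m3 m4)); rewrite !mulrDl; apply: lerD.
  apply: (le_trans N3); rewrite mulrAC ler_wpM2r// ler_wpM2l//.
  exact: (nrm_Dr ab p1).
apply: (le_trans N4); rewrite [leRHS](_ : _ = C * nrm W1 k * ((1 + c1) * nrm W2 v)); last by ring.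
rewrite ler_wpM2l ?mulr_ge0// (le_trans Nr)// mulrDl mul1r lerD//.
  exact: (nrm_Dr ab p1).
by rewrite ler_wpM2l//; exact: (nrm_Dr ab p1).
Qed.

Lemma kuint_subl k k' v : fmem W1 k -> fmem W1 k' ->
  {ae leb, forall t : R, t \in `]a, b[ -> kuint (k \- k') v t = kuint k v t - kuint k' v t}.
Proof.
move=> mk mk'; apply: aeS (Dr_sub ab p1 mk mk' (leqnn 1)) => t h Dt.
by rewrite /kuint h//=; ring.
Qed.

Lemma kuint_addr k v v' : fmem W2 v -> fmem W2 v' ->
  {ae leb, forall t : R, t \in `]a, b[ -> kuint k (v \+ v') t = kuint k v t + kuint k v' t}.
Proof.
move=> mv mv'; apply: aeS2 (Dr_add ab p1 mv mv' (isT : (1 <= 2)%N)) (Dr_add ab p1 mv mv' (leqnn 2)).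
by move=> t h1 h2 Dt; rewrite /kuint /radial h1// h2//; ring.
Qed.

Lemma kuint_scaler k c v : fmem W2 v ->
  {ae leb, forall t : R, t \in `]a, b[ -> kuint k (fun r => c * v r) t = c * kuint k v t}.
Proof.
move=> mv; apply: aeS2 (Dr_scale ab p1 c mv (isT : (1 <= 2)%N)) (Dr_scale ab p1 c mv (leqnn 2)).
by move=> t h1 h2 Dt; rewrite /kuint /radial h1// h2//; ring.
Qed.

Lemma kuint_bop : exists2 C, 0 <= C &
  (forall k, fmem W1 k -> bop W2 X (kuint k) (C * nrm W1 k)) /\
  (forall k k' v, fmem W1 k -> fmem W1 k' -> fmem W2 v ->
    N (kuint k v \- kuint k' v) <= C * nrm W1 (k \- k') * nrm W2 v).
Proof.
have [C C0 hC] := kuint_le; exists C => //; split.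
  move=> k mk; split.
  - by rewrite mulr_ge0// nrm_ge0.
  - by move=> v mv; exact: (hC k v mk mv).1.
  - by move=> v mv; exact: (hC k v mk mv).2.
  - move=> v v' mv mv'; apply: Lp_sub_ae0.
    + by apply: (hC _ _ mk _).1; exact: memD.
    + by apply: memD => //; exact: (hC _ _ mk _).1.
    + exact: kuint_addr.
  - move=> c v mv; apply: Lp_sub_ae0.
    + by apply: (hC _ _ mk _).1; exact: memZ.
    + by apply: memZ => //; exact: (hC _ _ mk _).1.
    + exact: kuint_scaler.
move=> k k' v mk mk' mv; have mkk := memB bW1 mk mk'.
have [m1 h] := hC _ _ mkk mv; apply: le_trans h; rewrite le_eqVlt; apply/orP; left.
have [m2 _] := hC _ _ mk mv; have [m3 _] := hC _ _ mk' mv.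
apply/eqP/esym; congr fine; apply: (Lp_ae ab p1) => //; first exact: memB.
exact: kuint_subl.
Qed.

End bilinear.

(** * Bounds and continuity of the convolution *)

Section convolution.
Context {R : realType}.
Implicit Types (k v : R -> R -> R) (t : R) (mu : R -> R).
Variables (a b : R) (p : \bar R) (n : nat).
Hypotheses (a0 : 0 < a) (ab : a < b) (p1 : (1 <= p)%E).
Local Notation X := (Lp a b p).
Local Notation W1 := (Wlp a b 1 p).
Local Notation W2 := (Wlp a b 2 p).
Local Notation N := (nrm X).
Let bX : banach X. Proof. exact: Lp_banach. Qed.
Let bW1 : banach W1. Proof. exact: Wlp_banach. Qed.
Let bW2 : banach W2. Proof. exact: Wlp_banach. Qed.
Variables (T C : R) (T0 : 0 < T) (C0' : 0 <= C).
Local Notation Kk := (kuint a b n).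
Hypothesis Kop : forall k : R -> R, fmem W1 k -> bop W2 X (Kk k) (C * nrm W1 k).
Hypothesis Ksub : forall k k' v : R -> R, fmem W1 k -> fmem W1 k' -> fmem W2 v ->
  N (Kk k v \- Kk k' v) <= C * nrm W1 (k \- k') * nrm W2 v.

Let Ioo (c d : R) : (leb `]c, d[%classic < +oo)%E.
Proof.
rewrite lebesgue_measure_itv/= lte_fin; case: ifPn => // _; by rewrite -EFinD ltry.
Qed.

Lemma C0_mem X' k t : C0 X' T k -> t \in `[0, T] -> fmem X' (k t).
Proof. by move=> h /h[]. Qed.

Lemma C0_unif (Y : fspace) k : banach Y -> C0 Y T k -> forall e, 0 < e -> exists2 d, 0 < d &
  forall s t, s \in `[0, T] -> t \in `[0, T] -> `|s - t| < d -> nrm Y (k s \- k t) <= e.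
Proof.
move=> bY /(C0P bY)[mk ck]; apply: heine => //.
- by move=> s t sT tT; apply: nrmC => //; exact: mk.
- by move=> s t r sT tT rT; apply: nrm_triangle => //; exact: mk.
Qed.

Lemma C0_bounded (Y : fspace) k : banach Y -> C0 Y T k ->
  exists2 M, 0 <= M & forall t, t \in `[0, T] -> nrm Y (k t) <= M.
Proof.
move=> bY /(C0P bY)[mk ck].
(* Clamping to [0, T] extends the norm of [k t] to a continuous function on the whole line, the form
   in which [bound_continuous] takes it. *)
pose cl t : R := Num.max 0 (Num.min t T).
have clT t : cl t \in `[0, T].
  by rewrite in_itv/= /cl le_max lexx/= ge_max (ltW T0)/= ge_min lexx orbT.
have cln t : t \in `[0, T] -> cl t = t.
  by rewrite in_itv/= /cl => /andP[t0 tT]; rewrite (min_idPl tT) (max_idPr t0).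
have cld s t : `|cl s - cl t| <= `|s - t|.
  rewrite /cl /Num.max /Num.min; have := T0.
  have := ler_norm (s - t); have := ler_norm (t - s); rewrite distrC ler_norml.
  by repeat case: ifPn; rewrite -?leNgt => *; apply/andP; split; lra.
have [|M M0 hM] := @bound_continuous R T (fun t => nrm Y (k (cl t))) T0.
  move=> t; apply/cvgrPdist_le => e e0; have [d d0 hd] := ck (cl t) (clT t) e e0.
  exists d => //= s ds; rewrite (le_trans (nrm_dist bY _ _))//; [exact: mk|exact: mk|].
  rewrite nrmC//; [|exact: mk|exact: mk]; apply: hd => //.
  by rewrite (le_lt_trans (cld _ _))// distrC.
exists M => // t tT; have := hM t tT; rewrite cln//; apply: le_trans; exact: ler_norm.
Qed.

Section kernel.
Variables (k v : R -> R -> R) (ck : C0 W1 T k) (Bv : Bint W2 `]0, T[ v).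

Let sT t s : t \in `[0, T] -> s \in `[0, t] -> s \in `[0, T] /\ t - s \in `[0, T].
Proof. by rewrite !in_itv/= => /andP[t0 tT] /andP[s0 st]; split; apply/andP; split; lra. Qed.

(** The operators [Kk (k (t - s))] depend uniformly continuously on s because [k] does on [0, T], so
    [Bint_step] applies on ]0, t[. *)
Lemma kconv_Bint t : t \in `[0, T] -> Bint X `]0, t[ (fun s => Kk (k (t - s)) (v s)).
Proof.
move=> tT; have [t0 tT'] : 0 <= t /\ t <= T by move: tT; rewrite in_itv/= => /andP[].
(* On the empty interval ]0, 0[ the integral is 0; [Bint_step] asks for positive length. *)
move: t0; rewrite le_eqVlt => /orP[/eqP t0|t0].
  exists (fun r => fine (leb `]0, t[%classic) * 0).
  apply: (BI_ext bX (BI_cst bX (measurable_itv _) (Ioo 0 t) (mem0 bX))).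
  by apply: aeW => s; rewrite -t0 /= in_itv/= => /andP[h1 h2]; have := lt_trans h1 h2; rewrite ltxx.
have sub : `]0, t[ `<=` `]0, T[ by apply: subset_itvl; rewrite bnd_simp.
have Bv' := Bint_sub bW2 (measurable_itv _) (Ioo 0 T) (measurable_itv _) sub Bv.
have [M M0 hM] := C0_bounded bW1 ck.
apply: (@Bint_step R W2 X bW2 bX t (C * M) (fun s => Kk (k (t - s))) t0 _ _ v Bv').
  move=> s st; have [_ tsT] := sT tT st; have [h1 h2 h3 h4 h5] := Kop (C0_mem ck tsT).
  split => //; first exact: mulr_ge0.
  move=> f mf; apply: (le_trans (h3 f mf)); rewrite ler_wpM2r ?nrm_ge0// ler_wpM2l// hM//.
move=> e e0; have C1 : 0 < C + 1 by rewrite ltr_wpDl.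
have [d d0 hd] := C0_unif bW1 ck (divr_gt0 e0 C1).
exists d => // s r st rt sr y my; have [_ h1] := sT tT st; have [_ h2] := sT tT rt.
apply: (le_trans (Ksub (C0_mem ck h1) (C0_mem ck h2) my)); rewrite ler_wpM2r ?nrm_ge0//.
have h : nrm W1 (k (t - s) \- k (t - r)) <= e / (C + 1).
  apply: hd => //; rewrite (_ : t - s - (t - r) = - (s - r)); first by rewrite normrN.
  by ring.
apply: (@le_trans _ _ (C * (e / (C + 1)))); first by rewrite ler_wpM2l.
by rewrite mulrCA ger_pMr// ler_pdivrMr// mul1r lerDl.
Qed.

(* Defs.convolution, with the time derivative of u replaced by a given [v] *)
Definition kconv t : R -> R := bochner_int X `]0, t[ (fun s => Kk (k (t - s)) (v s)).

Lemma kconv_BI t : t \in `[0, T] -> BI X `]0, t[ (fun s => Kk (k (t - s)) (v s)) (kconv t).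
Proof. by move=> tT; apply: (Bint_bochner_int bX (measurable_itv _) (Ioo 0 t)); exact: kconv_Bint. Qed.

Lemma kconv_mem t : t \in `[0, T] -> fmem X (kconv t).
Proof. by move=> tT; have [] := kconv_BI tT. Qed.

(* the weight turns the last integral into a small factor when [omega] is large *)
Lemma kconv_le mu M omega t : t \in `[0, T] -> intg `]0, T[ mu -> (forall s, 0 <= mu s) ->
  {ae leb, forall s, `]0, T[%classic s -> nrm W2 (v s) <= mu s} ->
  0 <= M -> 0 <= omega -> (forall s, s \in `[0, T] -> nrm W1 (k s) <= M * expR (omega * s)) ->
  N (kconv t) <= C * M * expR (omega * t) * \int[leb]_(s in `]0, T[) (expR (- (omega * s)) * mu s).
Proof.
move=> tT Imu mu0 vmu M0 om0 kM.
have [t0 tT'] : 0 <= t /\ t <= T by move: tT; rewrite in_itv/= => /andP[].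
have sub : `]0, t[ `<=` `]0, T[ by apply: subset_itvl; rewrite bnd_simp.
have Ie : intg `]0, T[ (fun s => expR (- (omega * s)) * mu s).
  apply: (intgM (K := 1)) => //.
    apply: measurable_continuous => s; apply: continuous_comp; last exact: continuous_expR.
    by apply: cvgN; apply: cvgMr; exact: cvg_id.
  apply: aeW => s; rewrite /= in_itv/= => /andP[s0 _]; rewrite ger0_norm ?expR_ge0//.
  by rewrite -[leRHS]expR0 ler_expR oppr_le0 mulr_ge0// ltW.
have Ie' : intg `]0, t[ (fun s => expR (- (omega * s)) * mu s).
  by apply: (@integrableS _ _ _ leb _ _ _ _ _ _ Ie).
have E0 : 0 <= expR (omega * t) by exact: expR_ge0.
pose m s := C * M * expR (omega * t) * (expR (- (omega * s)) * mu s).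
have Im : intg `]0, t[ m by exact: intgZ.
apply: (@le_trans _ _ (\int[leb]_(s in `]0, t[) m s)).
  apply: (BI_nrm_le bX _ _ (kconv_BI tT) Im) => //.
  apply: aeS2 vmu (Bint_mem Bv) => s h mvs st.
  have s0t : s \in `[0, t] by apply: subset_itv_oo_cc.
  have [_ tsT] := sT tT s0t; have sI := sub _ st.
  apply: (le_trans (bop_le (Kop (C0_mem ck tsT)) (mvs sI))).
  rewrite /m -!mulrA ler_wpM2l//.
  apply: (@le_trans _ _ ((M * expR (omega * (t - s))) * mu s)).
    by apply: ler_pM; rewrite ?nrm_ge0 ?kM ?h.
  by rewrite mulrBr expRD !mulrA.
rewrite RintZ// ler_wpM2l ?mulr_ge0//.
apply: le_Rintegral_subset => // s.
by rewrite mulr_ge0// expR_ge0.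
Qed.

(** For t' <= t the difference consists of the integral over ]0, t'[ of the kernel for k(t - s) -
    k(t' - s), small by uniform continuity of [k], and of an integral over [t', t[, small by
    absolute continuity of the integral of [mu]. *)
Lemma kconv_C0 : C0 X T kconv.
Proof.
apply/(C0P bX); split; first exact: kconv_mem.
have [mu [Imu mu0 vmu _]] := Bint_nrm bW2 (measurable_itv _) (Ioo 0 T) Bv.
have [M M0 hM] := C0_bounded bW1 ck.
set I := \int[leb]_(s in `]0, T[) mu s.
have I0 : 0 <= I by exact: Rintegral_ge0.
(* the integrands on ]0, t[ and ]0, t'[, t' <= t, are compared on ]0, T[ *)
have key e : 0 < e -> exists2 d, 0 < d & forall t' t, t' \in `[0, T] -> t \in `[0, T] ->
    t' <= t -> t - t' < d -> N (kconv t \- kconv t') <= e.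
  move=> e0.
  have C1 : 0 < 2 * (C * I + 1) by rewrite mulr_gt0// ltr_wpDl// mulr_ge0.
  have [d1 d10 hd1] := C0_unif bW1 ck (divr_gt0 e0 C1).
  set e1 := e / _ in hd1.
  have C2 : 0 < 2 * (C * M + 1) by rewrite mulr_gt0// ltr_wpDl// mulr_ge0.
  have mI : measurable (`]0, T[%classic : set R) by exact: measurable_itv.
  have [d2 d20 hd2] := Rintegral_abs_continuous mI Imu (divr_gt0 e0 C2).
  set e2 := e / _ in hd2.
  exists (Num.min d1 d2) => [|t' t t'T tT tt' tdt]; first by rewrite lt_min d10.
  have [td1 td2] : t - t' < d1 /\ t - t' < d2 by move: tdt; rewrite lt_min => /andP[].
  have [t'0 t'T'] : 0 <= t' /\ t' <= T by move: t'T; rewrite in_itv/= => /andP[].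
  have [t0 tT'] : 0 <= t /\ t <= T by move: tT; rewrite in_itv/= => /andP[].
  have sub r : r <= T -> `]0, r[ `<=` `]0, T[ by move=> rT; apply: subset_itvl; rewrite bnd_simp.
  have h1 := BI_extend bX mI (measurable_itv _) (sub _ tT') (kconv_BI tT).
  have h2 := BI_extend bX mI (measurable_itv _) (sub _ t'T') (kconv_BI t'T).
  have h := BI_B bX mI h1 h2.
  pose A : set R := `[t', t[%classic `&` `]0, T[%classic.
  have mA : measurable A by apply: measurableI; exact: measurable_itv.
  have Im1 : intg `]0, T[ (fun s => C * e1 * mu s) by exact: intgZ.
  have ImA : intg `]0, T[ (mu \_ A).
    apply: intg_patch => //; first by move=> s [].
    by apply: (@integrableS _ _ _ leb _ _ _ mI _ _ Imu) => // s [].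
  have Im2 := intgZ (C * M) mI ImA.
  apply: (le_trans (BI_nrm_le bX mI (Ioo 0 T) h (intgD mI Im1 Im2) _)).
    apply: aeS2 vmu (Bint_mem Bv) => s h0 mvs sI; rewrite /= -(h0 sI).
    have {}mvs := mvs sI; have s0 : 0 < s by move: sI; rewrite /= in_itv/= => /andP[].
    have inE' r : (s \in (`]0, r[%classic : set R)) = (s < r).
      by apply/idP/idP; rewrite ?inE /= in_itv/= s0.
    have e10 : 0 <= C * e1 by rewrite mulr_ge0// /e1 ltW// divr_gt0.
    rewrite !patchE !indicE !inE'.
    have [st'|st'] := ltP s t'.
      rewrite (lt_le_trans st' tt').
      have s1 : s \in `[0, t] by rewrite in_itv/= (ltW s0) (ltW (lt_le_trans st' tt')).
      have s2 : s \in `[0, t'] by rewrite in_itv/= (ltW s0) ltW.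
      have [_ tsT] := sT tT s1; have [_ t'sT] := sT t'T s2.
      rewrite memNset/=; last by move=> [/=]; rewrite in_itv/= leNgt st'.
      rewrite mulr0 addr0 (_ : _ \- _ = Kk (k (t - s)) (v s) \- Kk (k (t' - s)) (v s)); last first.
        by apply/funext => r /=; rewrite !mul1r.
      apply: (le_trans (Ksub (C0_mem ck tsT) (C0_mem ck t'sT) mvs)).
      rewrite ler_wpM2r ?nrm_ge0// ler_wpM2l//; apply: hd1 => //.
      by rewrite (_ : t - s - (t' - s) = t - t') ?ger0_norm ?subr_ge0//; lra.
    have [st|ts] := ltP s t; last first.
      rewrite (_ : _ \- _ = fun=> 0); last by apply/funext => r /=; rewrite !mul0r subrr.
      rewrite (nrm0 bX); apply: addr_ge0; first exact: (mulr_ge0 e10 (nrm_ge0 bW2 _)).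
      by apply: mulr_ge0; [exact: mulr_ge0|case: ifPn].
    rewrite mem_set/=; last by split => //=; rewrite in_itv/= st' st.
    have s1 : s \in `[0, t] by rewrite in_itv/= (ltW s0) ltW.
    have [_ tsT] := sT tT s1.
    rewrite (_ : _ \- _ = Kk (k (t - s)) (v s)); last first.
      by apply/funext => r /=; rewrite mul1r mul0r subr0.
    apply: (le_trans (bop_le (Kop (C0_mem ck tsT)) mvs)).
    rewrite -(h0 sI); apply: (@le_trans _ _ (C * M * nrm W2 (v s))).
      by rewrite ler_wpM2r ?nrm_ge0// ler_wpM2l// hM.
    by rewrite lerDr mulr_ge0// (nrm_ge0 bW2).
  rewrite (RintD mI Im1 Im2) !RintZ// -/I.
  have -> : \int[leb]_(s in `]0, T[) (mu \_ A) s = \int[leb]_(s in A) mu s.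
    by rewrite -Rintegral_mkcondr; congr Rintegral; rewrite /A setIC -setIA setIid.
  have hA : \int[leb]_(s in A) mu s <= e2.
    apply: ltW; rewrite (_ : Rintegral _ _ _ = \int[leb]_(s in A) `|mu s|); last first.
      by apply: eq_Rintegral => s _; rewrite ger0_norm.
    apply: hd2 => //; first by move=> s [].
    apply: (@le_lt_trans _ _ (leb `[t', t[%classic)).
      by apply: le_leb => // s [].
    rewrite lebesgue_measure_itv/= lte_fin; case: ifPn => _; last by rewrite lte_fin.
    by rewrite -EFinD lte_fin.
  have H1 : C * e1 * I <= e / 2.
    rewrite /e1 (_ : C * (e / _) * I = e / 2 * (C * I / (C * I + 1))); last first.
      by field; rewrite gt_eqF// ltr_wpDl// mulr_ge0.
    rewrite ger_pMr ?divr_gt0// ler_pdivrMr ?mul1r ?lerDl//.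
    by rewrite ltr_wpDl// mulr_ge0.
  have H2 : C * M * e2 <= e / 2.
    rewrite /e2 (_ : C * M * (e / _) = e / 2 * (C * M / (C * M + 1))); last first.
      by field; rewrite gt_eqF// ltr_wpDl// mulr_ge0.
    rewrite ger_pMr ?divr_gt0// ler_pdivrMr ?mul1r ?lerDl//.
    by rewrite ltr_wpDl// mulr_ge0.
  rewrite [leRHS](_ : e = e / 2 + e / 2); last by lra.
  apply: lerD => //; apply: le_trans H2; rewrite ler_wpM2l// mulr_ge0//.
move=> t tT e e0; have [d d0 hd] := key e e0; exists d => // s sT' std.
have [st|ts] := leP s t.
  rewrite nrmC//; [|exact: kconv_mem|exact: kconv_mem].
  by apply: hd => //; rewrite -(ger0_norm (_ : 0 <= t - s)) ?subr_ge0// distrC.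
apply: hd => //; first exact: ltW.
by rewrite -(ger0_norm (_ : 0 <= s - t))// subr_ge0 ltW.
Qed.

End kernel.

Lemma kconv_subl k k' v t : C0 W1 T k -> C0 W1 T k' -> Bint W2 `]0, T[ v -> t \in `[0, T] ->
  C0 W1 T (fun t => k t \- k' t) ->
  N (kconv (fun t => k t \- k' t) v t \- (kconv k v t \- kconv k' v t)) = 0.
Proof.
move=> ck ck' Bv tT cd.
have mI : measurable (`]0, t[%classic : set R) by exact: measurable_itv.
have tT' : t <= T by move: tT; rewrite in_itv/= => /andP[].
have sub : `]0, t[ `<=` `]0, T[ by apply: subset_itvl; rewrite bnd_simp.
apply: (BI_uniq bX mI (Ioo 0 t) (kconv_BI cd Bv tT) (BI_B bX mI (kconv_BI ck Bv tT) (kconv_BI ck' Bv tT))).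
apply: aeS (Bint_mem Bv) => s mvs st.
have tsT : t - s \in `[0, T].
  by move: st tT; rewrite /= !in_itv/= => /andP[s0 st] /andP[h1 h2]; apply/andP; split; lra.
have m1 := C0_mem ck tsT; have m2 := C0_mem ck' tsT; have mv := mvs (sub _ st).
apply: (Lp_sub_ae0 ab p1).
- exact: (bop_mem (Kop (C0_mem cd tsT)) mv).
- by apply: memB => //; [exact: (bop_mem (Kop m1) mv)|exact: (bop_mem (Kop m2) mv)].
- by apply: (kuint_subl _ ab p1).
Qed.

Lemma kconv_subr k v v' t : C0 W1 T k -> Bint W2 `]0, T[ v -> Bint W2 `]0, T[ v' ->
  Bint W2 `]0, T[ (fun t => v t \- v' t) -> t \in `[0, T] ->
  N (kconv k (fun t => v t \- v' t) t \- (kconv k v t \- kconv k v' t)) = 0.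
Proof.
move=> ck Bv Bv' Bd tT.
have mI : measurable (`]0, t[%classic : set R) by exact: measurable_itv.
have tT' : t <= T by move: tT; rewrite in_itv/= => /andP[].
have sub : `]0, t[ `<=` `]0, T[ by apply: subset_itvl; rewrite bnd_simp.
apply: (BI_uniq bX mI (Ioo 0 t) (kconv_BI ck Bd tT) (BI_B bX mI (kconv_BI ck Bv tT) (kconv_BI ck Bv' tT))).
apply: aeS2 (Bint_mem Bv) (Bint_mem Bv') => s mvs mvs' st.
have tsT : t - s \in `[0, T].
  by move: st tT; rewrite /= !in_itv/= => /andP[s0 st] /andP[h1 h2]; apply/andP; split; lra.
have m1 := C0_mem ck tsT; have mv := mvs (sub _ st); have mv' := mvs' (sub _ st).
exact: (bop_sub bW2 bX (Kop m1) mv mv').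
Qed.

End convolution.

(** * Abstract Volterra equations *)

Section volterra.
Context {R : realType}.
Implicit Types (X Y : fspace (R:=R)) (k : R -> R -> R) (t : R).

Lemma pow2_small (c e : R) : 0 <= c -> 0 < e -> exists j : nat, c * 2 ^- j <= e.
Proof.
move=> c0 e0; exists (Num.truncn (c / e)); set j := Num.truncn _.
have h : c / e < 2 ^+ j.
  apply: (lt_le_trans (truncnS_gt (c / e))).
  by rewrite -natrX ler_nat ltn_expl.
by rewrite ler_pdivrMr ?exprn_gt0// mulrC -ler_pdivrMr// ltW.
Qed.

Lemma le_pow2 (x y c : R) : 0 <= c -> (forall j : nat, x <= y + c * 2 ^- j) -> x <= y.
Proof.
move=> c0 h; apply/ler_addgt0Pr => e e0; have [j hj] := pow2_small c0 e0.
by apply: (le_trans (h j)); rewrite lerD2l.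
Qed.

(** The map M -> A + M/2 has the fixed point 2A, and its iterates from [M0] are at most 2A + M0
    2^-j. Any finite initial bound, such as the one given by compactness, can thus be improved to
    one depending on [A] only. *)
Lemma half_iterate (P : R -> Prop) (f w : R -> R) (M0 A : R) : 0 <= M0 -> 0 <= A ->
  (forall t, P t -> 0 <= w t) -> (forall t, P t -> f t <= M0 * w t) ->
  (forall M, 0 <= M -> (forall t, P t -> f t <= M * w t) ->
    forall t, P t -> f t <= (A + M / 2) * w t) ->
  forall t, P t -> f t <= 2 * A * w t.
Proof.
move=> M00 A0 w0 f0 h.
have key (j : nat) : forall t, P t -> f t <= (2 * A + M0 * 2 ^- j) * w t.
  elim: j => [|j ih] t Pt.
    rewrite expr0 invr1 mulr1 (le_trans (f0 t Pt))// ler_wpM2r ?w0//.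
    by rewrite lerDr mulr_ge0.
  have p0 : 0 <= M0 * 2 ^- j by rewrite mulr_ge0// invr_ge0 exprn_ge0.
  have M1 : 0 <= 2 * A + M0 * 2 ^- j by rewrite addr_ge0// mulr_ge0.
  apply: (le_trans (h _ M1 ih t Pt)); rewrite ler_wpM2r ?w0// exprS invfM.
  by rewrite le_eqVlt; apply/orP; left; apply/eqP; field.
move=> t Pt; apply: (@le_pow2 _ _ (M0 * w t)) => [|j].
  by rewrite mulr_ge0// w0.
by rewrite (mulrAC M0) -mulrDl key.
Qed.

Section C0_ops.
Variables (X : fspace (R:=R)) (bX : banach X) (T : R).

Lemma C0_sub k k' : C0 X T k -> C0 X T k' -> C0 X T (fun t => k t \- k' t).
Proof.
move=> /(C0P bX)[mk ck] /(C0P bX)[mk' ck']; apply/(C0P bX); split.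
  by move=> t tT; apply: memB => //; [exact: mk|exact: mk'].
move=> t tT e e0; have e2 : 0 < e / 2 by rewrite divr_gt0.
have [d d0 hd] := ck t tT _ e2; have [d' d'0 hd'] := ck' t tT _ e2.
exists (Num.min d d') => [|s sT]; first by rewrite lt_min d0.
rewrite lt_min => /andP[h1 h2].
rewrite (_ : _ \- _ = (k s \- k t) \- (k' s \- k' t)); last by apply/funext => r /=; ring.
have ms := mk s sT; have mt := mk t tT; have ms' := mk' s sT; have mt' := mk' t tT.
apply: (le_trans (nrmB bX (memB bX ms mt) (memB bX ms' mt'))).
by rewrite [leRHS](_ : e = e / 2 + e / 2); [apply: lerD; [exact: hd|exact: hd']|lra].
Qed.

Lemma C0_cst f : fmem X f -> C0 X T (fun=> f).
Proof.
move=> mf; apply/(C0P bX); split => // t tT e e0; exists 1 => // s _ _.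
by rewrite nrmeq_refl// ltW.
Qed.

Lemma C0_uniform_lim (K : nat -> R -> R -> R) k : (forall j, C0 X T (K j)) ->
  (forall t, t \in `[0, T] -> fmem X (k t)) ->
  (forall e, 0 < e -> exists j, forall t, t \in `[0, T] -> nrm X (K j t \- k t) <= e) ->
  C0 X T k.
Proof.
move=> cK mk lim; apply/(C0P bX); split => // t tT e e0.
have e3 : 0 < e / 3 by rewrite divr_gt0.
have [j hj] := lim _ e3; have /(C0P bX)[mK cKj] := cK j.
have [d d0 hd] := cKj t tT _ e3; exists d => // s sT std.
have ms := mK s sT; have mt := mK t tT.
apply: (le_trans (nrm_triangle bX (mk s sT) ms (mk t tT))).
rewrite [leRHS](_ : e = e / 3 + (e / 3 + e / 3)); last by lra.
apply: lerD; first by rewrite nrmC ?hj//; exact: mk.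
apply: (le_trans (nrm_triangle bX ms mt (mk t tT))).
by apply: lerD; [exact: hd|exact: hj].
Qed.

End C0_ops.

(* [Sol f G c] is an equation for f with data G and c, to be solved at each time;
   [Gam k] is a memory term. *)
Variables (Y X : fspace (R:=R)) (bY : banach Y) (bX : banach X) (T B om : R).
Variables (Sol : (R -> R) -> (R -> R) -> R -> Prop) (Gam : (R -> R -> R) -> R -> R -> R).
Hypotheses (T0 : 0 < T) (B0 : 0 < B) (om0 : 0 <= om).
Hypothesis Sol_mem : forall f G c, Sol f G c -> fmem Y f /\ fmem X G.
Hypothesis Sol_ex : forall G c, fmem X G -> exists f, Sol f G c.
Hypothesis Sol_sub : forall f G c f' G' c', Sol f G c -> Sol f' G' c' ->
  Sol (f \- f') (G \- G') (c - c').
Hypothesis Sol_le : forall f G c, Sol f G c -> nrm Y f <= B * (nrm X G + `|c|).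
Hypothesis Sol_lim : forall f G c, fmem Y f -> fmem X G ->
  (forall e, 0 < e -> exists f' G', [/\ Sol f' G' c, nrm Y (f' \- f) <= e & nrm X (G' \- G) <= e]) ->
  Sol f G c.
Hypothesis Gam_C0 : forall k, C0 Y T k -> C0 X T (Gam k).
Hypothesis Gam_sub : forall k k' t, C0 Y T k -> C0 Y T k' -> t \in `[0, T] ->
  nrm X (Gam (fun t => k t \- k' t) t \- (Gam k t \- Gam k' t)) = 0.
Hypothesis Gam_le : forall k M, C0 Y T k -> 0 <= M ->
  (forall s, s \in `[0, T] -> nrm Y (k s) <= M * expR (om * s)) ->
  forall t, t \in `[0, T] -> B * nrm X (Gam k t) <= M / 2 * expR (om * t).

Let mC0 (Z : fspace (R:=R)) k t : C0 Z T k -> t \in `[0, T] -> fmem Z (k t).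
Proof. by move=> h /h[]. Qed.

Let exp1 t : t \in `[0, T] -> 1 <= expR (om * t).
Proof. by rewrite in_itv/= => /andP[t0 _]; rewrite -[leLHS]expR0 ler_expR mulr_ge0. Qed.

Let expT t : t \in `[0, T] -> expR (om * t) <= expR (om * T).
Proof. by rewrite in_itv/= => /andP[_ tT]; rewrite ler_expR ler_wpM2l. Qed.

(** A weighted bound M for [k] improves to B A + M/2, and [half_iterate] brings it down to 2 B A.
    The right-hand side [H] is tied to [G - Gam k] only up to norm 0, since [Gam] is linear only in
    that sense and the estimate is meant for differences of solutions. *)
Lemma volterra_apriori k H G g A : C0 Y T k -> 0 <= A ->
  (forall t, t \in `[0, T] -> Sol (k t) (H t) (g t)) ->
  (forall t, t \in `[0, T] -> fmem X (G t)) ->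
  (forall t, t \in `[0, T] -> nrm X (H t \- (G t \- Gam k t)) = 0) ->
  (forall t, t \in `[0, T] -> nrm X (G t) + `|g t| <= A) ->
  forall t, t \in `[0, T] -> nrm Y (k t) <= 2 * (B * A) * expR (om * t).
Proof.
move=> ck A0 kS mG HE GA.
have [M M0 hM] := C0_bounded T0 bY ck.
apply: (@half_iterate (fun t => t \in `[0, T]) (fun t => nrm Y (k t)) _ M) => //.
- by rewrite mulr_ge0// ltW.
- by move=> t tT; rewrite (le_trans (hM t tT))// ler_peMr// exp1.
move=> M' M'0 hM' t tT; apply: (le_trans (Sol_le (kS t tT))).
have mGk := mC0 (Gam_C0 ck) tT; have [_ mH] := Sol_mem (kS t tT); have mGt := mG t tT.
rewrite (nrm_eq bX mH (memB bX mGt mGk) (HE t tT)).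
apply: (@le_trans _ _ (B * (nrm X (G t) + `|g t|) + B * nrm X (Gam k t))).
  rewrite -mulrDr ler_wpM2l ?(ltW B0)// addrAC lerD2r; exact: nrmB.
rewrite [leRHS]mulrDl; apply: lerD; last exact: Gam_le.
apply: (@le_trans _ _ (B * A)); first by rewrite ler_wpM2l ?(ltW B0)// GA.
by rewrite ler_peMr ?exp1// mulr_ge0// ltW.
Qed.

(** Solutions are chosen time by time; they depend continuously on time because the difference of
    two of them solves the equation for the differences of the data, to which [Sol_le] applies. *)
Lemma base_C0 G g : C0 X T G ->
  (forall t, t \in `[0, T] -> forall e, 0 < e -> exists2 d, 0 < d &
    forall s, s \in `[0, T] -> `|s - t| < d -> `|g s - g t| <= e) ->
  exists k, C0 Y T k /\ forall t, t \in `[0, T] -> Sol (k t) (G t) (g t).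
Proof.
move=> cG cg; have mG t : t \in `[0, T] -> fmem X (G t) by exact: mC0.
have /choice[k hk] : forall t : R, exists f : R -> R, t \in `[0, T] -> Sol f (G t) (g t).
  move=> t; have [tT|tT] := boolP (t \in `[0, T]); last by exists (cst 0).
  by have [f hf] := Sol_ex (g t) (mG t tT); exists f.
exists k; split => //; apply/(C0P bY); split=> [t tT|t tT e e0].
  by have [] := Sol_mem (hk t tT).
have e2 : 0 < e / (2 * B) by rewrite divr_gt0// mulr_gt0.
have /(C0P bX)[_ cG'] := cG.
have [d d0 hd] := cG' t tT _ e2; have [d' d'0 hd'] := cg t tT _ e2.
exists (Num.min d d') => [|s sT]; first by rewrite lt_min d0.
rewrite lt_min => /andP[h1 h2].
apply: (le_trans (Sol_le (Sol_sub (hk s sT) (hk t tT)))).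
rewrite -ler_pdivlMl//; apply: (le_trans (lerD (hd s sT h1) (hd' s sT h2))).
by rewrite le_eqVlt; apply/orP; left; apply/eqP; field; rewrite gt_eqF.
Qed.

(** [Gam_sub] and [Gam_le] halve the weighted norm of successive increments. The limit is taken at
    each time with an error uniform in time, and [Sol_lim] carries the equation over to it. *)
Lemma volterra_exists G g : C0 X T G ->
  (forall t, t \in `[0, T] -> forall e, 0 < e -> exists2 d, 0 < d &
    forall s, s \in `[0, T] -> `|s - t| < d -> `|g s - g t| <= e) ->
  exists k, C0 Y T k /\ forall t, t \in `[0, T] -> Sol (k t) (G t \- Gam k t) (g t).
Proof.
move=> cG cg; have mG t : t \in `[0, T] -> fmem X (G t) by exact: mC0.
have /choice[Phi hPhi] : forall k : R -> R -> R, exists k' : R -> R -> R, C0 Y T k ->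
    C0 Y T k' /\ forall t, t \in `[0, T] -> Sol (k' t) (G t \- Gam k t) (g t).
  move=> k; have [ck|nck] := pselect (C0 Y T k); last by exists k.
  by have [k' hk'] := base_C0 (C0_sub bX cG (Gam_C0 ck)) cg; exists k'.
pose K (j : nat) := iter j Phi (fun=> fun=> 0 : R).
have cK j : C0 Y T (K j).
  elim: j => [|j ih]; first by apply: (C0_cst bY); exact: mem0.
  exact: (hPhi _ ih).1.
have hK j t : t \in `[0, T] -> Sol (K j.+1 t) (G t \- Gam (K j) t) (g t).
  exact: (hPhi _ (cK j)).2.
pose E j t := K j.+1 t \- K j t.
have cE j : C0 Y T (E j) by apply: C0_sub.
have mGK j t : t \in `[0, T] -> fmem X (Gam (K j) t) by move=> tT; exact: (mC0 (Gam_C0 (cK j)) tT).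
have [M M0 hM] := C0_bounded T0 bY (cE 0%N).
have dE j t : t \in `[0, T] -> nrm Y (E j t) <= M * 2 ^- j * expR (om * t).
  elim: j t => [|j ih] t tT.
    by rewrite expr0 invr1 mulr1 (le_trans (hM t tT))// ler_peMr// exp1.
  apply: (le_trans (Sol_le (Sol_sub (hK j.+1 t tT) (hK j t tT)))).
  rewrite subrr normr0 addr0.
  have mE := mC0 (Gam_C0 (cE j)) tT; have m1 := mGK j.+1 t tT; have m2 := mGK j t tT.
  have -> : nrm X ((G t \- Gam (K j.+1) t) \- (G t \- Gam (K j) t)) = nrm X (Gam (E j) t).
    rewrite (nrm_eq bX mE (memB bX m1 m2)); last exact: Gam_sub.
    by rewrite (nrmC bX m1 m2); congr nrm; apply/funext => r /=; ring.
  have p0 : 0 <= M * 2 ^- j by rewrite mulr_ge0// invr_ge0 exprn_ge0.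
  apply: (le_trans (Gam_le (cE j) p0 ih tT)).
  by rewrite exprS invfM (mulrC 2^-1) mulrA.
(* [W] undoes the weight, turning the geometric decay of the increments into one that is uniform in
   time. *)
pose W := M * expR (om * T); have W0 : 0 <= W by rewrite mulr_ge0// expR_ge0.
have pj (j : nat) : 0 <= 2 ^- j :> R by rewrite invr_ge0 exprn_ge0.
have dE' j t : t \in `[0, T] -> nrm Y (E j t) <= W * 2 ^- j.
  move=> tT; apply: (le_trans (dE j t tT)); rewrite /W mulrAC ler_wpM2r//.
  by rewrite ler_wpM2l// expT.
have mK j t : t \in `[0, T] -> fmem Y (K j t) by exact: mC0.
have dK i d t : t \in `[0, T] -> nrm Y (K (i + d)%N t \- K i t) <= 2 * W * (2 ^- i - 2 ^- (i + d)%N).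
  move=> tT; elim: d => [|d ih]; first by rewrite addn0 nrmeq_refl// subrr mulr0.
  rewrite addnS; apply: (le_trans (nrm_triangle bY (mK _ _ tT) (mK (i + d)%N _ tT) (mK _ _ tT))).
  apply: (le_trans (lerD (dE' (i + d)%N t tT) ih)).
  by rewrite exprS invfM le_eqVlt; apply/orP; left; apply/eqP; field; rewrite !expf_neq0.
have dKi i j t : t \in `[0, T] -> (i <= j)%N -> nrm Y (K j t \- K i t) <= 2 * W * 2 ^- i.
  move=> tT ij; rewrite -(subnKC ij); apply: (le_trans (dK _ _ _ tT)).
  by rewrite ler_wpM2l ?mulr_ge0// gerBl.
have W20 : 0 <= 2 * W by rewrite mulr_ge0.
have /choice[k hk] : forall t : R, exists f : R -> R, t \in `[0, T] -> fmem Y f /\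
    forall e, 0 < e -> exists M, forall i, (M <= i)%N -> nrm Y (K i t \- f) <= e.
  move=> t; have [tT|tT] := boolP (t \in `[0, T]); last by exists (cst 0).
  have [||f mf hf] := fcomplete bY (f := fun i => K i t); last by exists f.
    by move=> i; exact: mK.
  move=> e e0; have e2 : 0 < e / 2 by rewrite divr_gt0.
  have [N hN] := pow2_small W20 e2; exists N => i j Ni Nj.
  apply: (le_trans (nrm_triangle bY (mK i t tT) (mK N t tT) (mK j t tT))).
  rewrite [leRHS](_ : e = e / 2 + e / 2); last by lra.
  apply: lerD; first exact: (le_trans (dKi _ _ _ tT Ni)).
  by rewrite nrmC//; [exact: (le_trans (dKi _ _ _ tT Nj))|exact: mK|exact: mK].
have mk t : t \in `[0, T] -> fmem Y (k t) by move=> /hk[].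
have kK i t : t \in `[0, T] -> nrm Y (K i t \- k t) <= 2 * W * 2 ^- i.
  move=> tT; apply/ler_addgt0Pr => e e0; have [_ /(_ e e0) [N hN]] := hk t tT.
  pose j := maxn i N.
  apply: (le_trans (nrm_triangle bY (mK i t tT) (mK j t tT) (mk t tT))).
  apply: lerD; last by apply: hN; exact: leq_maxr.
  by rewrite nrmC//; [apply: dKi => //; exact: leq_maxl|exact: mK|exact: mK].
have ck : C0 Y T k.
  apply: (C0_uniform_lim bY cK mk) => e e0; have [j hj] := pow2_small W20 e0.
  by exists j => t tT; apply: le_trans (kK j t tT) hj.
exists k; split => // t tT; have mGk := mC0 (Gam_C0 ck) tT.
apply: Sol_lim; [exact: mk|by apply: memB => //; exact: mG|move=> e e0].
(* The summand 1 accounts for the error of the iterate, the other for that of the memory term, which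
   [Gam_le] bounds only after multiplication by [B]. A single index [j] then serves both. *)
have W30 : 0 <= 2 * W * (1 + expR (om * T) / B).
  by rewrite mulr_ge0// addr_ge0// divr_ge0 ?expR_ge0// ltW.
have [j hj] := pow2_small W30 e0.
exists (K j.+1 t), (G t \- Gam (K j) t); split; first exact: hK.
  apply: (le_trans (kK j.+1 t tT)); apply: le_trans hj; rewrite exprS invfM.
  apply: (@le_trans _ _ (2 * W * 2 ^- j)).
    by rewrite ler_wpM2l// ler_piMl// invf_le1// ler1n.
  by rewrite ler_wpM2r// ler_peMr// lerDl divr_ge0 ?expR_ge0// ltW.
have cd := C0_sub bY (cK j) ck; have md := mC0 (Gam_C0 cd) tT.
have -> : nrm X ((G t \- Gam (K j) t) \- (G t \- Gam k t)) = nrm X (Gam (fun t => K j t \- k t) t).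
  rewrite (nrm_eq bX md (memB bX (mGK j t tT) mGk)); last exact: Gam_sub.
  by rewrite (nrmC bX (mGK j t tT) mGk); congr nrm; apply/funext => r /=; ring.
have M2 : 0 <= 2 * W * 2 ^- j by rewrite mulr_ge0.
have h : B * nrm X (Gam (fun t => K j t \- k t) t) <= 2 * W * 2 ^- j / 2 * expR (om * t).
  by apply: (Gam_le cd M2) => // s sT'; rewrite (le_trans (kK j s sT'))// ler_peMr// exp1.
rewrite -(ler_pM2l B0); apply: (le_trans h).
apply: (@le_trans _ _ (B * (2 * W * (1 + expR (om * T) / B) * 2 ^- j))); last first.
  by rewrite ler_wpM2l// ltW.
rewrite [leRHS](_ : _ = 2 * W * 2 ^- j * (B + expR (om * T))); last first.
  by field; rewrite ?expf_neq0 ?gt_eqF.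
rewrite -mulrA ler_wpM2l// mulrC; apply: (@le_trans _ _ (expR (om * T))); last by rewrite lerDr ltW.
by apply: le_trans (expT tT); rewrite ler_piMr ?expR_ge0// invf_le1// ler1n.
Qed.

End volterra.

(** * The inverse problem *)

Section time_derivative.
Context {R : realType}.
Implicit Types (u v f : R -> R -> R) (t s : R).
Variables (X : fspace (R:=R)) (bX : banach X) (T : R) (T0 : 0 < T).
Local Notation N := (nrm X).

Let quot v v' t s : R -> R := fun r => (s - t)^-1 * (v s r - v t r) - v' t r.

Lemma is_DtP v v' : C0 X T v -> is_Dt X T v v' <->
  (forall t, t \in `[0, T] -> fmem X (v' t)) /\
  (forall t, t \in `[0, T] -> forall e, 0 < e -> exists2 d, 0 < d &
    forall s, s \in `[0, T] -> s != t -> `|s - t| < d -> N (quot v v' t s) <= e).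
Proof.
move=> /(C0P bX)[mv _].
have nearE t (P : R -> Prop) : (\forall s \near within `[0, T] t^', P s) <->
    exists2 d, 0 < d & forall s, s \in `[0, T] -> s != t -> `|s - t| < d -> P s.
  split.
    rewrite near_withinE => -[d /= d0 hd]; exists d => // s sT st std.
    by apply: hd => //=; rewrite distrC.
  move=> [d d0 hd]; rewrite near_withinE; exists d => //= s std st sT.
  by apply: hd => //; rewrite distrC.
have mq t s : t \in `[0, T] -> s \in `[0, T] -> fmem X (v' t) -> fmem X (quot v v' t s).
  move=> tT sT mv'; apply: (memB bX (f := fun r => (s - t)^-1 * (v s \- v t) r)) => //.
  by apply: (memZ bX); apply: memB => //; exact: mv.
have P t : t \in `[0, T] -> fmem X (v' t) ->
    (fnorm X (quot v v' t s) @[s --> within `[0, T] t^'] --> 0%E <->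
     forall e, 0 < e -> exists2 d, 0 < d &
       forall s, s \in `[0, T] -> s != t -> `|s - t| < d -> N (quot v v' t s) <= e).
  move=> tT mv'; rewrite (cvg_fnormP bX); last first.
    by apply/nearE; exists 1 => // s sT _ _; exact: mq.
  by split => h e e0; apply/nearE; exact: h.
split=> [h|[h1 h2] t tT].
  split=> [t /h[]//|t tT]; have [h1 h2] := h t tT.
  exact: (P t tT h1).1 h2.
by split; [exact: h1|apply/(P t tT (h1 t tT)); exact: h2].
Qed.

Lemma is_Dt_sub v v' w w' : C0 X T v -> C0 X T w -> is_Dt X T v v' -> is_Dt X T w w' ->
  is_Dt X T (fun t => v t \- w t) (fun t => v' t \- w' t).
Proof.
move=> cv cw /(is_DtP v' cv)[mv' hv] /(is_DtP w' cw)[mw' hw].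
have [[mv _] [mw _]] := ((C0P bX T v).1 cv, (C0P bX T w).1 cw).
apply/(is_DtP _ (C0_sub bX cv cw)); split.
  by move=> t tT; apply: memB => //; [exact: mv'|exact: mw'].
move=> t tT e e0; have e2 : 0 < e / 2 by rewrite divr_gt0.
have [d d0 hd] := hv t tT _ e2; have [d' d'0 hd'] := hw t tT _ e2.
exists (Num.min d d') => [|s sT st]; first by rewrite lt_min d0.
rewrite lt_min => /andP[h1 h2].
have mq k k' : fmem X (k s) -> fmem X (k t) -> fmem X (k' t) -> fmem X (quot k k' t s).
  move=> m1 m2 m3; apply: (memB bX (f := fun r => (s - t)^-1 * (k s \- k t) r)) => //.
  by apply: (memZ bX); exact: memB.
rewrite (_ : quot _ _ _ _ = quot v v' t s \- quot w w' t s); last first.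
  by apply/funext => r; rewrite /quot /=; ring.
apply: (le_trans (nrmB bX (mq v v' (mv s sT) (mv t tT) (mv' t tT)) (mq w w' (mw s sT) (mw t tT) (mw' t tT)))).
by rewrite [leRHS](_ : e = e / 2 + e / 2); [apply: lerD; [exact: hd|exact: hd']|lra].
Qed.

Lemma is_Dt_uniq v v' v'' t : C0 X T v -> is_Dt X T v v' -> is_Dt X T v v'' -> t \in `[0, T] ->
  N (v' t \- v'' t) = 0.
Proof.
move=> cv /(is_DtP v' cv)[m1 h1] /(is_DtP v'' cv)[m2 h2] tT.
have [mv _] := (C0P bX T v).1 cv.
have mq k' s : s \in `[0, T] -> fmem X (k' t) -> fmem X (quot v k' t s).
  move=> sT m3; apply: (memB bX (f := fun r => (s - t)^-1 * (v s \- v t) r)) => //.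
  by apply: (memZ bX); apply: memB => //; exact: mv.
apply/eqP; rewrite eq_le nrm_ge0// andbT; apply/ler_addgt0Pr => e e0; rewrite add0r.
have e2 : 0 < e / 2 by rewrite divr_gt0.
have [d d0 hd] := h1 t tT _ e2; have [d' d'0 hd'] := h2 t tT _ e2.
(* A point of [0, T] close to [t] but different from it: to the right of [t] if [t] is in the left
   half of the interval, to the left otherwise. *)
have [s [sT st sd sd']] : exists s, [/\ s \in `[0, T], s != t, `|s - t| < d & `|s - t| < d'].
  have [t0 tT'] : 0 <= t /\ t <= T by move: tT; rewrite in_itv/= => /andP[].
  pose h := Num.min (Num.min d d') T / 2.
  have m0 : 0 < Num.min (Num.min d d') T by rewrite !lt_min d0 d'0 T0.
  have h0 : 0 < h by rewrite /h divr_gt0.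
  have hm : h < Num.min (Num.min d d') T by rewrite /h ltr_pdivrMr// mulr_natr mulr2n ltrDl.
  move: hm; rewrite !lt_min -andbA => /and3P[hd1 hd2 hT].
  have hT2 : h <= T / 2 by rewrite /h ler_wpM2r ?invr_ge0// ge_min lexx orbT.
  have [tl|tl] := leP t (T / 2).
    exists (t + h); rewrite (addrC t h) addrK gtr0_norm//; split => //.
      by rewrite in_itv/=; apply/andP; split; lra.
    by rewrite gt_eqF// ltrDr.
  exists (t - h); rewrite (_ : t - h - t = - h) ?normrN ?gtr0_norm//; last by lra.
  split => //; first by rewrite in_itv/=; apply/andP; split; lra.
  by rewrite lt_eqF// ltrBlDr ltrDl.
rewrite (_ : v' t \- v'' t = quot v v'' t s \- quot v v' t s); last first.
  by apply/funext => r; rewrite /quot /=; ring.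
apply: (le_trans (nrmB bX (mq _ _ sT (m2 t tT)) (mq _ _ sT (m1 t tT)))).
by rewrite [leRHS](_ : e = e / 2 + e / 2); [apply: lerD; [exact: hd'|exact: hd]|lra].
Qed.

(** The chosen derivative agrees up to norm 0 with the continuous derivative provided by [C1], and
    inherits its continuity. *)
Lemma strong_DtP f : C1 X T f -> is_Dt X T f (strong_Dt X T f) /\ C0 X T (strong_Dt X T f).
Proof.
move=> [cf [f' [hf' cf']]].
have h : is_Dt X T f (strong_Dt X T f).
  by apply: (@xgetPex _ (fun=> cst 0) [set v' | is_Dt X T f v']); exists f'.
split => //; have [mh _] := (is_DtP _ cf).1 h; have [mf' cf''] := (C0P bX T f').1 cf'.
apply/(C0P bX); split => // t tT e e0; have [d d0 hd] := cf'' t tT e e0.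
exists d => // s sT std; have E r : r \in `[0, T] -> N (strong_Dt X T f r \- f' r) = 0.
  by move=> rT; exact: is_Dt_uniq cf h hf' rT.
have ms := mh s sT; have mt := mh t tT; have ms' := mf' s sT; have mt' := mf' t tT.
apply: (le_trans (nrm_triangle bX ms ms' mt)); rewrite E// add0r.
by apply: (le_trans (nrm_triangle bX ms' mt' mt)); rewrite (nrmC bX mt' mt) E// addr0 hd.
Qed.

(** The norm in the hypothesis involves the chosen derivative of the difference, the conclusion the
    difference of the chosen derivatives; uniqueness identifies them up to norm 0. *)
Lemma C1norm_sub f f' d : C1 X T f -> C1 X T f' -> (C1norm X T (fun t => f' t \- f t)%R < d%:E)%E ->
  forall t, t \in `[0, T] -> N (strong_Dt X T f' t \- strong_Dt X T f t) <= d.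
Proof.
move=> Cf Cf' nd t tT.
have [hf cDf] := strong_DtP Cf; have [hf' cDf'] := strong_DtP Cf'.
have cf := Cf.1; have cf' := Cf'.1; have cd := C0_sub bX cf' cf.
have hd := is_Dt_sub cf' cf hf' hf.
have Cd : C1 X T (fun t => f' t \- f t).
  by split => //; exists (fun t => strong_Dt X T f' t \- strong_Dt X T f t); split => //; exact: C0_sub.
have [hs cs] := strong_DtP Cd.
have [ms _] := (C0P bX T _).1 cs; have [md _] := (C0P bX T _).1 (C0_sub bX cDf' cDf).
rewrite -(nrm_eq bX (ms t tT) (md t tT) (is_Dt_uniq cd hs hd tT)).
rewrite -lee_fin -nrmE//; last exact: ms.
have sup0 k : (0 <= C0norm X T k)%E.
  apply: (@le_trans _ _ (fnorm X (k t))); first exact: fnorm_ge0.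
  by apply: ereal_sup_ubound; exists t.
apply: le_trans (ltW nd); apply: (@le_trans _ _ (C0norm X T (strong_Dt X T (fun t => f' t \- f t)))).
  by apply: ereal_sup_ubound; exists t.
by rewrite /C1norm leeDr.
Qed.

End time_derivative.

(** * The trace at time 0 and the mixed derivatives of u *)

Section data.
Context {R : realType}.
Variables (R1 R2 T : R) (n : nat) (p : \bar R).
Hypotheses (hR1 : 0 < R1) (hR12 : R1 < R2) (T0 : 0 < T) (p1 : (1 <= p)%E).
Local Notation X := (Lp R1 R2 p).
Local Notation W1 := (Wlp R1 R2 1 p).
Local Notation W2 := (Wlp R1 R2 2 p).
Local Notation N := (nrm X).
Let bX : banach X. Proof. exact: Lp_banach. Qed.
Let bW1 : banach W1. Proof. exact: Wlp_banach. Qed.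
Let bW2 : banach W2. Proof. exact: Wlp_banach. Qed.
Let mI : measurable (`]0, T[%classic : set R). Proof. exact: measurable_itv. Qed.
Let Ioo : (leb (`]0%R, T[%classic : set R) < +oo)%E.
Proof. by rewrite lebesgue_measure_itv/= lte_fin T0 -EFinD ltry. Qed.

(* otherwise xget picks the zero function, which contradicts the lower bound *)
Lemma rcont_lower_bound h m : 0 < m ->
  (forall r : R, r \in `[R1, R2] -> m <= `|rcont R1 R2 h r|) ->
  {ae leb, forall r : R, r \in `]R1, R2[ -> m <= `|h r|}.
Proof.
move=> m0 hm.
have [ex|nex] := pselect (exists g, {within `[R1, R2], continuous g} /\
    {ae leb, forall r : R, r \in `]R1, R2[ -> g r = h r}).
  have [_ e] : {within `[R1, R2], continuous (rcont R1 R2 h)} /\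
      {ae leb, forall r : R, r \in `]R1, R2[ -> rcont R1 R2 h r = h r}.
    exact: (@xgetPex _ (cst 0) [set g | {within `[R1, R2], continuous g} /\
      {ae leb, forall r : R, r \in `]R1, R2[ -> g r = h r}] ex).
  apply: aeS e => r E rD; rewrite -E//; apply: hm.
  by move: rD; rewrite !in_itv/= => /andP[/ltW -> /ltW ->].
exfalso; have E : rcont R1 R2 h = cst 0.
  by apply: xgetPN => g hg; apply: nex; exists g.
have := hm R1; rewrite in_itv/= lexx (ltW hR12) E /= normr0 => /(_ isT).
by rewrite leNgt m0.
Qed.

(** If [u] had no representative continuous in time, [tcont] would be the default 0 and D_r u(0, .)
    would vanish almost everywhere, against the lower bound. *)
Lemma u0_tcont u m : 0 < m ->
  {ae leb, forall r : R, r \in `]R1, R2[ -> m <= `|Dr R1 R2 1 (u0 R1 R2 T p u) r|} ->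
  C0 W2 T (tcont W2 T u) /\
  {ae leb, forall t : R, t \in `]0, T[ -> nrm W2 (tcont W2 T u t \- u t) = 0}.
Proof.
move=> m0 hm.
have [ex|nex] := pselect (exists z, C0 W2 T z /\
    {ae leb, forall t : R, t \in `]0, T[ -> fnorm W2 (z t \- u t) = 0%E}).
  have [c e] : C0 W2 T (tcont W2 T u) /\
      {ae leb, forall t : R, t \in `]0, T[ -> fnorm W2 (tcont W2 T u t \- u t) = 0%E}.
    exact: (@xgetPex _ (fun=> cst 0) [set z | C0 W2 T z /\
      {ae leb, forall t : R, t \in `]0, T[ -> fnorm W2 (z t \- u t) = 0%E}] ex).
  by split => //; apply: aeS e => t + tT => /(_ tT) E; rewrite /nrm E.
exfalso; have E : u0 R1 R2 T p u = cst 0.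
  rewrite /u0 (_ : tcont _ _ _ = fun=> cst 0)//.
  by apply: xgetPN => z hz; apply: nex; exists z.
have m00 : fmem W2 (fun=> 0) := mem0 bW2.
have d0 : is_weak_deriv R1 R2 1 (fun=> 0) (fun=> 0).
  split; first by apply: (Lp_locally hR12 p1); exact: (mem0 bX).
  move=> phi _; rewrite (_ : (fun x => 0 * derive1n 1 phi x) = fun=> 0); last first.
    by apply/funext => x; rewrite mul0r.
  rewrite (_ : (fun x => 0 * phi x) = fun=> 0); last first.
    by apply/funext => x; rewrite mul0r.
  by rewrite Rint0 mulr0.
have := Wlp_Dr p1 m00 (isT : (1 <= 2)%N) d0; rewrite E in hm.
have {}hm : {ae leb, forall r : R, r \in `]R1, R2[ -> m <= `|Dr R1 R2 1 (fun=> 0) r|} := hm.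
move=> h0; have h : {ae leb, forall r : R, r \in `]R1, R2[ -> False}.
  apply: aeS2 hm h0 => r h1 h2 rD; have := h1 rD; have E' := h2 rD.
  by rewrite E' normr0 leNgt m0.
by have [r rD /(_ rD)] := ae_itv_ex hR12 h.
Qed.

Lemma W11_wDt u : W11 W2 T u -> wDt W2 T u (weak_Dt W2 T u).
Proof.
move=> [Lu [v hv]]; apply: (is_weak_Dt_wDt bW2 T0 Lu).
by apply: (@xgetPex _ (fun=> cst 0) [set v | is_weak_Dt W2 T u v]); exists v.
Qed.

(** By [wDt_bop] the function [Dr j (v t)] is also a weak time derivative of [Dr j (u t)] in L^p;
    uniqueness identifies it with the chosen one for almost every t, and then for almost every r. *)
Lemma DtDr_E u v j : wDt W2 T u v -> (j <= 2)%N ->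
  {ae leb, forall t, `]0, T[%classic t -> fmem X (DtDr R1 R2 T p j u t) /\
    {ae leb, forall r : R, r \in `]R1, R2[ -> DtDr R1 R2 T p j u t r = Dr R1 R2 j (v t) r}}.
Proof.
move=> huv jl; have bop_j := Dr_bop hR12 p1 jl.
have hD := wDt_bop bW2 bX T0 bop_j huv.
have hD' : is_weak_Dt X T (fun t => Dr R1 R2 j (u t)) (DtDr R1 R2 T p j u).
  apply: (@xgetPex _ (fun=> cst 0) [set w | is_weak_Dt X T (fun t => Dr R1 R2 j (u t)) w]).
  by exists (fun t => Dr R1 R2 j (v t)); exact: wDt_is_weak_Dt.
have [Bu _ _] := hD; have LD := Bint_L1 bX mI Ioo Bu.
have hD2 := is_weak_Dt_wDt bX T0 LD hD'.
have [_ B1 _] := hD2; have [_ B2 _] := hD.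
apply: aeS3 (wDt_uniq bX T0 hD2 hD) (Bint_mem B1) (Bint_mem B2) => t h1 h2 h3 tI.
by split; [exact: h2|apply: (Lp_sub_eq0 hR12 p1); [exact: h2|exact: h3|exact: h1]].
Qed.

Variable C : R.
Hypothesis C0' : 0 <= C.
Local Notation Kk := (kuint R1 R2 n).
Hypothesis Kop : forall k : R -> R, fmem W1 k -> bop W2 X (Kk k) (C * nrm W1 k).
Hypothesis Ksub : forall k k' v : R -> R, fmem W1 k -> fmem W1 k' -> fmem W2 v ->
  N (Kk k v \- Kk k' v) <= C * nrm W1 (k \- k') * nrm W2 v.

(** For almost every s the two integrands agree almost everywhere in r by [DtDr_E], so their Bochner
    integrals agree up to norm 0. *)
Lemma convolution_kconv u v k t : wDt W2 T u v -> C0 W1 T k -> t \in `[0, T] ->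
  {ae leb, forall r : R, r \in `]R1, R2[ ->
    convolution R1 R2 T n p u k t r = kconv R1 R2 p n k v t r}.
Proof.
move=> huv ck tT; have [_ Bv _] := huv.
have tT' : t <= T by move: tT; rewrite in_itv/= => /andP[].
have mJ : measurable (`]0, t[%classic : set R) by exact: measurable_itv.
have sub : `]0, t[ `<=` `]0, T[ by apply: subset_itvl; rewrite bnd_simp.
have Joo : (leb (`]0%R, t[%classic : set R) < +oo)%E by apply: le_lt_trans Ioo; exact: le_leb.
have hB := kconv_BI hR12 p1 T0 C0' Kop Ksub ck Bv tT.
pose F s r := Dr R1 R2 1 (k (t - s)) r * DtDr R1 R2 T p 1 u s r +
  k (t - s) r * radial n (DtDr R1 R2 T p 1 u s) (DtDr R1 R2 T p 2 u s) r.
have key : {ae leb, forall s, `]0, t[%classic s -> fmem X (F s) /\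
    N (Kk (k (t - s)) (v s) \- F s) = 0}.
  apply: aeS3 (DtDr_E huv (isT : (1 <= 2)%N)) (DtDr_E huv (leqnn 2)) (Bint_mem Bv) => s h1 h2 h3 sJ.
  have [m1 e1] := h1 (sub _ sJ); have [m2 e2] := h2 (sub _ sJ); have mv := h3 (sub _ sJ).
  have tsT : t - s \in `[0, T].
    by move: sJ tT; rewrite /= !in_itv/= => /andP[s0 st] /andP[q1 q2]; apply/andP; split; lra.
  have mk := C0_mem ck tsT; have mKk := bop_mem (Kop mk) mv.
  have [_ mk1] := Wlp_weak_deriv p1 mk (leqnn 1).
  have KF : {ae leb, forall r : R, r \in `]R1, R2[ -> Kk (k (t - s)) (v s) r = F s r}.
    by apply: aeS2 e1 e2 => r E1 E2 rD; rewrite /kuint /F /radial E1// E2.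
  have mF : fmem X (F s).
    apply: (@Lp_eq_ae _ R1 R2 p p1 (Kk (k (t - s)) (v s)) _ _ mKk KF).1.
    apply: measurable_funD; apply: measurable_funM.
    - exact: measurable_Lp mk1.
    - exact: measurable_Lp m1.
    - exact: measurable_Lp (Wlp_Lp mk).
    apply: measurable_funD; first exact: measurable_Lp m2.
    apply: measurable_funM; last exact: measurable_Lp m1.
    apply: measurable_funM; first exact: measurable_cst.
    by apply: measurable_inv; exact: measurable_id.
  by split => //; exact: Lp_sub_ae0.
have hF : BI X `]0, t[ F (kconv R1 R2 p n k v t).
  by apply: (BI_eq bX hB); apply: aeS key => s hs sJ; have [] := hs sJ.
have BF := Bint_bochner_int bX mJ Joo (ex_intro _ _ hF).
apply: (Lp_sub_eq0 hR12 p1); [by case: BF|by case: hF|].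
apply: (BI_uniq bX mJ Joo BF hF); apply: aeS key => s hs sJ.
exact: (nrmeq_refl bX).
Qed.

End data.

(** Dominated convergence along the integers: exp(-j s) mu(s) tends to 0 for s > 0 and stays below
    mu(s). *)
Lemma exp_weight {R : realType} (T : R) (mu : R -> R) (e : R) : 0 < T ->
  intg `]0, T[ mu -> (forall s, 0 <= mu s) -> 0 < e ->
  exists2 om : R, 0 <= om & \int[leb]_(s in `]0, T[) (expR (- (om * s)) * mu s) <= e.
Proof.
move=> T0 Imu mu0 e0; have mI : measurable (`]0, T[%classic : set R) by exact: measurable_itv.
have [|||||_ cv _] := @cvg_Rintegral_dominated R `]0, T[
  (fun j s => expR (- (j%:R * s)) * mu s) (fun=> 0) mu mI.
- move=> j; apply: measurable_funM; last exact: measurable_intg.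
  apply: measurable_continuous => s; apply: continuous_comp; last exact: continuous_expR.
  by apply: cvgN; apply: cvgMr; exact: cvg_id.
- exact: measurable_cst.
- exact: Imu.
- apply: aeW => s; rewrite /= in_itv/= => /andP[s0 _].
  rewrite -[X in _ --> X](mul0r (mu s)); apply: cvgMl.
  rewrite (_ : (fun j => _) = fun j : nat => expR (- s) ^+ j); last first.
    by apply/funext => j; rewrite -expRM_natl mulrN.
  by apply: cvg_expr; rewrite ger0_norm ?expR_ge0// -[ltRHS]expR0 ltr_expR oppr_lt0.
- apply: aeW => s; rewrite /= in_itv/= => /andP[s0 _] j.
  rewrite ger0_norm ?mulr_ge0 ?expR_ge0// ler_piMl//.
  by rewrite -[leRHS]expR0 ler_expR oppr_le0 mulr_ge0// ltW.
rewrite Rint0 in cv; move/cvgr0Pnorm_le : cv => /(_ _ e0) [j _ /(_ j (leqnn j)) h].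
by exists j%:R => //; apply: le_trans (ler_norm _) h.
Qed.

(** * Existence, uniqueness and continuous dependence *)

Section problem.
Context {R : realType}.
Variables (R1 R2 T : R) (n : nat) (p : \bar R) (lambda : R -> R).
Hypotheses (hR1 : 0 < R1) (hR12 : R1 < R2) (T0 : 0 < T) (p1 : (1 <= p)%E).
Hypothesis hlambda : fmem (Lp R1 R2 (hoelder_conjugate p)) lambda.
Local Notation X := (Lp R1 R2 p).
Local Notation W1 := (Wlp R1 R2 1 p).
Local Notation W2 := (Wlp R1 R2 2 p).
Local Notation N := (nrm X).
Local Notation N1 := (nrm W1).
Local Notation N2 := (nrm W2).
Local Notation Kk := (kuint R1 R2 n).
Local Notation kc := (kconv R1 R2 p n).
Local Notation sol := (is_solution R1 R2 T n p lambda).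
Let D : set R := `]R1, R2[%classic.
Let I : set R := `]0, T[%classic.
Let bX : banach X. Proof. exact: Lp_banach. Qed.
Let bW1 : banach W1. Proof. exact: Wlp_banach. Qed.
Let bW2 : banach W2. Proof. exact: Wlp_banach. Qed.
Let mI : measurable I. Proof. exact: measurable_itv. Qed.
Let mD : measurable D. Proof. exact: measurable_itv. Qed.
Let Ioo : (leb I < +oo)%E.
Proof. by rewrite /I lebesgue_measure_itv/= lte_fin T0 -EFinD ltry. Qed.
Let Il : intg D lambda.
Proof. exact: (intg_Lp hR12 (hoelder_conj_ge1 p1) hlambda). Qed.

(** [lambda] is integrable, as L^{p'} embeds in L^1 on a bounded interval, and [k] is bounded by
    [W1_sup]. *)
Lemma intg_lambda k : fmem W1 k -> intg D (fun r => lambda r * k r).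
Proof.
move=> mk; have [C C0' hC] := W1_sup hR12 p1.
rewrite (_ : (fun r => _) = fun r => k r * lambda r); last by apply/funext => r; rewrite mulrC.
exact: (intgM mD (measurable_Lp (Wlp_Lp mk)) Il (hC _ mk)).
Qed.

Section one_problem.
Variables (u f : R -> R -> R) (g : R -> R).
Hypothesis adm : admissible R1 R2 T n p lambda u f g.

Let z := tcont W2 T u.
Let v := weak_Dt W2 T u.
Let G := strong_Dt X T f.

Let z0E : u0 R1 R2 T p u = z 0. Proof. by []. Qed.

Let lower : exists2 m, 0 < m & {ae leb, forall r : R, r \in `]R1, R2[ -> m <= `|Dr R1 R2 1 (z 0) r|}.
Proof. by case: adm => _ _ _ [m m0 hm] _; exists m => //; exact: rcont_lower_bound hm. Qed.

Lemma tcont_C0 : C0 W2 T z /\ {ae leb, forall t : R, t \in `]0, T[ -> N2 (z t \- u t) = 0}.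
Proof. by have [m m0 hm] := lower; exact: (u0_tcont hR12 p1 m0 hm). Qed.

Lemma weak_Dt_wDt : wDt W2 T u v.
Proof. by case: adm => h _ _ _ _; exact: W11_wDt. Qed.

Let Bv : Bint W2 I v. Proof. by case: weak_Dt_wDt. Qed.
Let mz0 : fmem W2 (z 0).
Proof. by apply: (C0_mem tcont_C0.1); rewrite in_itv/= lexx ltW. Qed.

Lemma strong_Dt_C0 : C0 X T G.
Proof. by case: adm => _ h _ _ _; exact: (strong_DtP bX T0 h).2. Qed.

Let cG := strong_Dt_C0.

Lemma g_continuous t : t \in `[0, T] -> forall e, 0 < e -> exists2 d, 0 < d &
  forall s, s \in `[0, T] -> `|s - t| < d -> `|g s - g t| <= e.
Proof.
case: adm => _ _ cg _ _ tT e e0.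
have := cg t; rewrite /continuous_at /= /nbhs /= /nbhs_subspace; case: ifPn => [_|]; last first.
  by move=> /negP; rewrite inE.
move=> /cvgrPdist_le/(_ e e0); rewrite near_withinE => -[d /= d0 hd].
by exists d => // s sT st; rewrite distrC; apply: hd => //=; rewrite distrC.
Qed.

(* the problem at a fixed time, with the convolution moved to the right-hand side [H] *)
Definition base_sol k H (c : R) := [/\ fmem W1 k, fmem X H,
  {ae leb, forall r : R, r \in `]R1, R2[ -> Kk k (z 0) r = H r} &
  \int[leb]_(r in `]R1, R2[) (lambda r * k r) = c].

Let q := Dr R1 R2 1 (z 0).
Let s := radial n (Dr R1 R2 1 (z 0)) (Dr R1 R2 2 (z 0)).
Let mq : fmem X q. Proof. exact: (Wlp_weak_deriv p1 mz0 (isT : (1 <= 2)%N)).2. Qed.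
Let ms : fmem X s.
Proof. exact: (radial_Lp n hR1 hR12 p1 mq (Wlp_weak_deriv p1 mz0 (leqnn 2)).2).1. Qed.

Let kappa0 : \int[leb]_(t in D) (lambda t * expR (- prim R1 (fun t => s t / q t) t)) != 0.
Proof. by case: adm. Qed.

Let base_ex H c : fmem X H -> exists k, base_sol k H c.
Proof.
move=> mH; have [m m0 hm] := lower.
have [k [mk kH kc]] := base_exists hR12 p1 Il mq ms m0 hm kappa0 c mH.
by exists k; split.
Qed.

Let base_le : exists2 B, 0 < B & forall k H c, base_sol k H c -> N1 k <= B * (N H + `|c|).
Proof.
have [m m0 hm] := lower; have [B B0 hB] := base_bound hR12 p1 Il mq ms m0 hm kappa0.
exists (B + 1) => [|k H c [mk mH kH <-]]; first by rewrite ltr_wpDl.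
by apply: (le_trans (hB k H mk mH kH)); rewrite ler_wpM2r ?lerDl// addr_ge0// nrm_ge0.
Qed.

Lemma base_sol_sub k H c k' H' c' : base_sol k H c -> base_sol k' H' c' ->
  base_sol (k \- k') (H \- H') (c - c').
Proof.
move=> [mk mH kH <-] [mk' mH' kH' <-]; split; [exact: memB|exact: memB| |].
  apply: aeS3 kH kH' (kuint_subl n hR12 p1 (z 0) mk mk') => r h1 h2 h3 rD.
  by rewrite h3// h1// h2.
rewrite -(RintB mD (intg_lambda mk) (intg_lambda mk')).
by congr Rintegral; apply/funext => r /=; rewrite mulrBr.
Qed.

(** This is the hypothesis [Sol_lim] of the abstract equation: [kuint] is continuous in [k], and so
    is the integral of lambda k, by [W1_sup] and the integrability of lambda. *)
Let base_lim k H c : fmem W1 k -> fmem X H ->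
  (forall e, 0 < e -> exists k' H', [/\ base_sol k' H' c, N1 (k' \- k) <= e & N (H' \- H) <= e]) ->
  base_sol k H c.
Proof.
move=> mk mH lim; have [C C0' [Kop Ksub]] := kuint_bop n hR1 hR12 p1.
have [Cs Cs0 hCs] := W1_sup hR12 p1.
have mKk := bop_mem (Kop k mk) mz0; have Nz0 := nrm_ge0 bW2 (z 0).
split => //.
  apply: (Lp_sub_eq0 hR12 p1 mKk mH); apply/eqP; rewrite eq_le nrm_ge0// andbT.
  have A0 : 0 <= C * N2 (z 0) + 1 by rewrite addr_ge0// mulr_ge0.
  apply: (@le_pow2 R _ 0 _ A0) => j; rewrite add0r.
  have e0 : 0 < 2 ^- j :> R by rewrite invr_gt0 exprn_gt0.
  have [k' [H' [[mk' mH' kH' _] h1 h2]]] := lim _ e0.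
  have mKk' := bop_mem (Kop k' mk') mz0.
  apply: (le_trans (nrm_triangle bX mKk mKk' mH)); rewrite mulrDl mul1r; apply: lerD.
    rewrite nrmC//; apply: (le_trans (Ksub _ _ _ mk' mk mz0)).
    by rewrite mulrAC ler_wpM2l// mulr_ge0.
  have <- : N (H' \- H) = N (Kk k' (z 0) \- H); last exact: h2.
  congr fine; apply: (Lp_ae hR12 p1); [exact: memB|exact: memB|].
  by apply: aeS kH' => r E rD /=; rewrite E.
apply/eqP; rewrite -subr_eq0 -normr_eq0 eq_le normr_ge0 andbT.
have Inl := @integrable_norm _ _ _ leb _ _ Il.
have L0 : 0 <= \int[leb]_(r in D) `|lambda r| by exact: Rintegral_ge0.
apply: (@le_pow2 R _ 0 _ (mulr_ge0 Cs0 L0)) => j; rewrite add0r.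
have e0 : 0 < 2 ^- j :> R by rewrite invr_gt0 exprn_gt0.
have [k' [H' [[mk' mH' _ <-] h1 _]]] := lim _ e0; have mkk := memB bW1 mk mk'.
rewrite -(RintB mD (intg_lambda mk) (intg_lambda mk')).
rewrite mulrAC -RintZ//; apply: le_norm_Rintegral_ae => //.
- by apply: intgB => //; exact: intg_lambda.
- exact: intgZ.
apply: aeS (hCs _ mkk) => r h rD; rewrite -mulrBr normrM mulrC ler_wpM2r//.
apply: (le_trans (h rD)); rewrite ler_wpM2l// nrmC//.
Qed.

(** The problem becomes an instance of the abstract Volterra equation; [convolution_kconv] trades
    the mixed derivatives chosen in [convolution] for [v]. *)
Lemma is_solutionP k : sol u f g k <-> C0 W1 T k /\
  forall t, t \in `[0, T] -> base_sol (k t) (G t \- kc k v t) (g t).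
Proof.
have [C C0' [Kop Ksub]] := kuint_bop n hR1 hR12 p1.
have mG t : t \in `[0, T] -> fmem X (G t) by exact: C0_mem.
split=> [[ck h1 h2]|[ck h]].
  split => // t tT; split => //; [exact: C0_mem ck tT| | |exact: h2].
    by apply: memB => //; [exact: mG|exact: (kconv_mem hR12 p1 T0 C0' Kop Ksub ck Bv tT)].
  apply: aeS2 (h1 t tT) (convolution_kconv hR12 T0 p1 C0' Kop Ksub weak_Dt_wDt ck tT).
  move=> r E1 E2 rD /=; have := E1 rD; rewrite (E2 rD) -addrA => E.
  have -> : G t r = strong_Dt X T f t r by [].
  by rewrite -E [X in _ = X - _]addrC addrK.
split => // t tT; have [mk mH kH kg] := h t tT; last by [].
apply: aeS2 kH (convolution_kconv hR12 T0 p1 C0' Kop Ksub weak_Dt_wDt ck tT).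
move=> r E1 E2 rD /=; rewrite (E2 rD) -addrA; have /= E := E1 rD.
have -> : strong_Dt X T f t r = kc k v t r + (G t r - kc k v t r) by rewrite addrC subrK.
by rewrite -E.
Qed.

Lemma problem_consts : exists B C om mu, [/\ 0 < B, 0 <= C, 0 <= om,
   [/\ intg I mu, forall t, 0 <= mu t & {ae leb, forall t, I t -> N2 (v t) <= mu t}] &
   [/\ forall k H c, base_sol k H c -> N1 k <= B * (N H + `|c|),
   forall k : R -> R, fmem W1 k -> bop W2 X (Kk k) (C * N1 k),
   forall k k' v : R -> R, fmem W1 k -> fmem W1 k' -> fmem W2 v ->
     N (Kk k v \- Kk k' v) <= C * N1 (k \- k') * N2 v &
   forall k M, C0 W1 T k -> 0 <= M ->
     (forall s, s \in `[0, T] -> N1 (k s) <= M * expR (om * s)) ->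
     forall t, t \in `[0, T] -> B * N (kc k v t) <= M / 2 * expR (om * t)]].
Proof.
have [C C0' [Kop Ksub]] := kuint_bop n hR1 hR12 p1; have [B B0 hB] := base_le.
have [mu [Imu mu0 vmu _]] := Bint_nrm bW2 mI Ioo Bv.
have BC : 0 < 2 * (B * C + 1) by rewrite mulr_gt0// ltr_wpDl// mulr_ge0// ltW.
(* With this weight the memory term receives the factor B C/(2 (B C + 1)), at most 1/2; the added 1
   keeps the threshold defined when [C] is 0. *)
have [om om0 hom] := exp_weight T0 Imu mu0 (divr_gt0 ltr01 BC).
have vmu' : {ae leb, forall t, I t -> N2 (v t) <= mu t}.
  by apply: aeS vmu => t h tI; rewrite h.
exists B, C, om, mu; split => //; split => // k M ck M0 kM t tT.
have h := kconv_le hR12 p1 T0 C0' Kop Ksub ck Bv tT Imu mu0 vmu' M0 om0 kM.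
apply: (@le_trans _ _ (B * (C * M * expR (om * t) * (1 / (2 * (B * C + 1)))))).
  rewrite ler_wpM2l ?(ltW B0)//; apply: (le_trans h).
  by rewrite ler_wpM2l// mulr_ge0 ?expR_ge0// mulr_ge0.
rewrite [leLHS](_ : _ = (B * C / (B * C + 1)) * (M / 2 * expR (om * t))); last first.
  by field; rewrite gt_eqF// ltr_wpDl// mulr_ge0// ltW.
rewrite ler_piMl ?mulr_ge0 ?expR_ge0 ?divr_ge0// ler_pdivrMr ?mul1r ?lerDl//.
by rewrite ltr_wpDl// mulr_ge0// ltW.
Qed.

Let base_mem k H c : base_sol k H c -> fmem W1 k /\ fmem X H. Proof. by case. Qed.

Lemma solution_exists : exists k, sol u f g k.
Proof.
have [B [C [om [mu [B0 C0' om0 _ [hB Kop Ksub hG]]]]]] := problem_consts.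
have [|||||k [ck hk]] := @volterra_exists R W1 X bW1 bX T B om base_sol (fun k => kc k v)
    T0 B0 om0 _ base_ex _ hB _ _ _ hG G g cG g_continuous.
- exact: base_mem.
- exact: base_sol_sub.
- exact: base_lim.
- by move=> k ck; exact: (kconv_C0 hR12 p1 T0 C0' Kop Ksub ck Bv).
- move=> k k' t ck ck' tT.
  exact: (kconv_subl hR12 p1 T0 C0' Kop Ksub ck ck' Bv tT (C0_sub bW1 ck ck')).
by exists k; apply/is_solutionP.
Qed.

Lemma base_sol_kuint k : fmem W1 k -> fmem X (Kk k (z 0)) ->
  base_sol k (Kk k (z 0)) (\int[leb]_(r in `]R1, R2[) (lambda r * k r)).
Proof. by move=> mk mKk; split => //; apply: aeW. Qed.

(** The a priori estimate without weight, exp(om T) being absorbed in [Q]. It concerns any [d]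
    satisfying the equation with some source [F], and serves both uniqueness and the comparison with
    a perturbed solution. *)
Lemma problem_stable : exists Q C, [/\ 0 <= Q, 0 <= C,
  forall k : R -> R, fmem W1 k -> bop W2 X (Kk k) (C * N1 k),
  forall k k' v : R -> R, fmem W1 k -> fmem W1 k' -> fmem W2 v ->
    N (Kk k v \- Kk k' v) <= C * N1 (k \- k') * N2 v &
  forall d H F c A, C0 W1 T d -> 0 <= A ->
    (forall t, t \in `[0, T] -> base_sol (d t) (H t) (c t)) ->
    (forall t, t \in `[0, T] -> fmem X (F t)) ->
    (forall t, t \in `[0, T] -> N (H t \- (F t \- kc d v t)) = 0) ->
    (forall t, t \in `[0, T] -> N (F t) + `|c t| <= A) ->
    forall t, t \in `[0, T] -> N1 (d t) <= Q * A].
Proof.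
have [B [C [om [mu [B0 C0' om0 _ [hB Kop Ksub hG]]]]]] := problem_consts.
exists (2 * B * expR (om * T)), C; split => //.
  by rewrite mulr_ge0 ?expR_ge0// mulr_ge0// ltW.
move=> d H F c A cd A0 dH mF HF FA t tT.
have cG' k : C0 W1 T k -> C0 X T (kc k v).
  by move=> ck; exact: (kconv_C0 hR12 p1 T0 C0' Kop Ksub ck Bv).
have := @volterra_apriori R W1 X bW1 bX T B om base_sol (fun k => kc k v)
  T0 B0 om0 base_mem hB cG' hG d H F c A cd A0 dH mF HF FA t tT.
move=> h; apply: (le_trans h); rewrite [leRHS](_ : _ = 2 * (B * A) * expR (om * T)); last by ring.
rewrite ler_wpM2l ?mulr_ge0 ?(ltW B0)// ler_expR ler_wpM2l//.
by move: tT; rewrite in_itv/= => /andP[].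
Qed.

(** The difference satisfies the equation with source 0 and integral condition 0, so the estimate
    holds with [A = 0]. *)
Lemma solution_uniq k k' t : sol u f g k -> sol u f g k' -> t \in `[0, T] ->
  N1 (k' t \- k t) = 0.
Proof.
move=> /is_solutionP[ck hk] /is_solutionP[ck' hk'] tT.
have [Q [C [Q0 C0' Kop Ksub hQ]]] := problem_stable.
have cd := C0_sub bW1 ck' ck.
have E3 (a b c d : R -> R) : ((a \- b) \- (a \- c)) \- ((fun=> 0) \- d) = d \- (b \- c).
  by apply/funext => x /=; ring.
apply/eqP; rewrite eq_le nrm_ge0// andbT -[leRHS](mulr0 Q).
apply: (hQ _ (fun t => (G t \- kc k' v t) \- (G t \- kc k v t)) (fun=> fun=> 0) (fun t => g t - g t) 0 cd) => //.
- by move=> r rT; apply: base_sol_sub; [exact: hk'|exact: hk].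
- by move=> r _; exact: (mem0 bX).
- move=> r rT; rewrite E3.
  exact: (kconv_subl hR12 p1 T0 C0' Kop Ksub ck' ck Bv rT cd).
- by move=> r _; rewrite nrm0// subrr normr0 addr0.
Qed.

End one_problem.

(** The norm in the hypothesis involves the chosen derivative of the difference; by uniqueness it
    agrees up to norm 0, at almost every time, with the difference of the chosen derivatives.
    Integrable majorants stand in for norms that need not be measurable. *)
Lemma W11norm_sub u u' d : W11 W2 T u -> W11 W2 T u' ->
  (W11norm W2 T (fun t => u' t \- u t)%R < d%:E)%E ->
  let dv t := weak_Dt W2 T u' t \- weak_Dt W2 T u t in
  exists mu mv, [/\ intg I mu, intg I mv, forall t, 0 <= mu t, forall t, 0 <= mv t &
   [/\ {ae leb, forall t, I t -> N2 (u' t \- u t) <= mu t}, {ae leb, forall t, I t -> N2 (dv t) <= mv t},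
       wDt W2 T (fun t => u' t \- u t) dv & \int[leb]_(t in I) mu t + \int[leb]_(t in I) mv t <= d]].
Proof.
move=> Wu Wu' nd dv; have hd := wDt_sub bW2 (W11_wDt hR12 T0 p1 Wu') (W11_wDt hR12 T0 p1 Wu).
have [Bd Bdv _] := hd.
have Wd : W11 W2 T (fun t => u' t \- u t).
  by split; [exact: Bint_L1|exists dv; exact: wDt_is_weak_Dt].
have hw := W11_wDt hR12 T0 p1 Wd; have [_ Bw _] := hw.
have [mu [Imu mu0 hmu Lu]] := Bint_nrm bW2 mI Ioo Bd.
have [mv [Imv mv0 hmv Lv]] := Bint_nrm bW2 mI Ioo Bw.
exists mu, mv; split; [exact: Imu|exact: Imv|exact: mu0|exact: mv0|split]; last 2 first.
- exact: hd.
- by move: nd; rewrite /W11norm Lu Lv -EFinD lte_fin => /ltW.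
- by apply: aeS hmu => t h tI; rewrite h.
- have hu := wDt_uniq bW2 T0 hw hd.
  apply: aeS3 (aeS2 (fun t h1 h2 => conj h1 h2) hu hmv) (Bint_mem Bw) (Bint_mem Bdv) => t [h1 h2] m1 m2 tI.
  by rewrite -(nrm_eq bW2 (m1 tI) (m2 tI) (h1 tI)) h2.
Qed.

Lemma kuint_sub k w w' : fmem W2 w -> fmem W2 w' ->
  {ae leb, forall r : R, r \in `]R1, R2[ -> Kk k (w \- w') r = Kk k w r - Kk k w' r}.
Proof.
move=> mw mw'; rewrite (subfunE w w').
apply: aeS2 (kuint_addr n hR12 p1 k mw (memZ bW2 (-1) mw')) (kuint_scaler n hR12 p1 k (-1) mw').
by move=> r h1 h2 rD; rewrite h1// h2// mulN1r.
Qed.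

(** The difference k' - k satisfies the unperturbed equation with a source [F] of size delta (1 +
    ||k'||) up to constants. With [M] bounding k, a bound M' for the difference improves to delta c2
    + delta c1 M', so [half_iterate] concludes once delta c1 <= 1/2. *)
Lemma solution_depends u f g : admissible R1 R2 T n p lambda u f g ->
  continuous_dependence R1 R2 T n p lambda u f g.
Proof.
move=> adm eps eps0.
have [Q [C [Q0 C0' Kop Ksub hQ]]] := problem_stable adm.
have [Kt Kt0 hKt] := trace_le bW2 T0.
(* This solution is fixed before delta, which depends on its bound [M]; any other solution [k0] for
   the same data differs from it by norm 0. *)
have [k hk] := solution_exists adm.
have [ck hk'] := (is_solutionP adm k).1 hk.
have E4 (a b c d : R -> R) : (a \- b) \- (c \- d) = (a \- c) \- (b \- d).
  by apply/funext => x /=; ring.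
have E6 (Kz x kv y kv1 kv1' : R) : Kz - (x - kv) =
    Kz - (y - kv1') + (y - x) + (kv1 - kv1') - (kv1 - kv) by ring.
have [M M0 hM] := C0_bounded T0 bW1 ck.
set z := tcont W2 T u; set v := weak_Dt W2 T u in hQ hk' *; set G := strong_Dt X T f in hk' *.
(* [Kt * delta] bounds the change of u(0, .), through [trace_le], and delta that of D_t u in L^1,
   whence Kt + 1. In [c2] the 2 accounts for the changes of D_t f and g, and [M] for the share of k
   in the bound on k'. *)
pose c1 := Q * (C * (Kt + 1)); have c10 : 0 <= c1 by rewrite !mulr_ge0// addr_ge0.
pose c2 := Q * (2 + C * (Kt + 1) * M).
have c20 : 0 <= c2 by rewrite mulr_ge0// addr_ge0// !mulr_ge0// addr_ge0.
(* The first quantity makes delta c1 at most 1/2; the second makes the final bound 2 delta c2 at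
   most eps/2, which leaves a strict inequality for the supremum. *)
pose delta := Num.min (2 * (c1 + 1))^-1 (eps / (4 * (c2 + 1))).
have d0 : 0 < delta.
  by rewrite lt_min invr_gt0 !divr_gt0 ?mulr_gt0 ?ltr_wpDl.
have dc1 : delta * c1 <= 2^-1.
  apply: (@le_trans _ _ ((2 * (c1 + 1))^-1 * c1)); first by rewrite ler_wpM2r// ge_min lexx.
  rewrite mulrC ler_pdivrMr ?mulr_gt0 ?ltr_wpDl// mulrA mulVf// mul1r lerDl//.
have dc2 : 2 * (delta * c2) <= eps / 2.
  apply: (@le_trans _ _ (2 * (eps / (4 * (c2 + 1)) * c2))).
    by rewrite ler_wpM2l// ler_wpM2r// ge_min lexx orbT.
  rewrite [leLHS](_ : _ = eps / 2 * (c2 / (c2 + 1))); last by field; rewrite gt_eqF// ltr_wpDl.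
  rewrite ler_piMr ?divr_ge0 ?(ltW eps0)// ler_pdivrMr ?ltr_wpDl// mul1r lerDl//.
exists delta => // u' f' g' adm' hu hf hg k0 k' hk0 hk1.
have [ck' hk1'] := (is_solutionP adm' k').1 hk1.
have [[z'c z'u] [zc zu]] := (tcont_C0 adm', tcont_C0 adm).
set z' := tcont W2 T u' in z'c z'u; rewrite -/z in zc zu.
set v' := weak_Dt W2 T u' in hk1'.
have T00 : 0 \in `[0, T] by rewrite in_itv/= lexx ltW.
have [mz0 mz'0] := (C0_mem zc T00, C0_mem z'c T00).
have Wu : W11 W2 T u by case: adm. have Wu' : W11 W2 T u' by case: adm'.
have [_ Bv _] := W11_wDt hR12 T0 p1 Wu; have [_ Bv' _] := W11_wDt hR12 T0 p1 Wu'.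
rewrite -/v in Bv; rewrite -/v' in Bv'.
have [mu [mv [Imu Imv mu0 mv0 [hmu hmv hdv hd]]]] := W11norm_sub Wu Wu' hu.
have [_ Bdv _] := hdv.
have mv_le : \int[leb]_(t in I) mv t <= delta.
  by apply: le_trans hd; rewrite lerDr; exact: Rintegral_ge0.
have hz : N2 (z' 0 \- z 0) <= Kt * delta.
  apply: (@le_trans _ _ (Kt * (\int[leb]_(t in I) mu t + \int[leb]_(t in I) mv t))); last exact: ler_wpM2l.
  refine (hKt _ _ (fun t => z' t \- z t) mu mv hdv (C0_sub bW2 z'c zc) _ Imu Imv hmu hmv).
  have [Bu _ _] := W11_wDt hR12 T0 p1 Wu; have [Bu' _ _] := W11_wDt hR12 T0 p1 Wu'.
  apply: aeS2 (aeS2 (fun t h1 h2 => conj h1 h2) z'u zu)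
    (aeS2 (fun t h1 h2 => conj h1 h2) (Bint_mem Bu) (Bint_mem Bu')) => t [h1 h2] [m1 m2] tI.
  have tT : t \in `[0, T] by apply: subset_itv_oo_cc.
  have mz := C0_mem zc tT; have mz' := C0_mem z'c tT; have mu1 := m1 tI; have mu2 := m2 tI.
  rewrite E4.
  apply/eqP; rewrite eq_le nrm_ge0// andbT.
  apply: (le_trans (nrmB bW2 (memB bW2 mz' mu2) (memB bW2 mz mu1))).
  by rewrite h1// h2// addr0.
have hG t : t \in `[0, T] -> N (strong_Dt X T f' t \- G t) <= delta.
  by move=> tT; apply: (C1norm_sub bX T0 _ _ hf tT); [case: adm|case: adm'].
set G' := strong_Dt X T f' in hG hk1'.
have cd := C0_sub bW1 ck' ck.
have [Md Md0 hMd] := C0_bounded T0 bW1 cd.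
have mG t : t \in `[0, T] -> fmem X (G t) by apply: C0_mem; exact: (strong_Dt_C0 adm).
have mG' t : t \in `[0, T] -> fmem X (G' t) by apply: C0_mem; exact: (strong_Dt_C0 adm').
have Bdv' : Bint W2 I (fun t => v t \- v' t).
  have [y hy] := Bint_bop bW2 bW2 (bop_scale bW2 (lexx `|-1 : R|)) mI Bdv.
  exists y; apply: (BI_ext bW2 hy); apply: aeW => t _; apply/funext => r /=.
  by rewrite mulN1r opprB.
pose dv t := v t \- v' t.
(* The three terms are the effects on the equation for [k'] of the changes of u(0, .), D_t f and D_t
   u. *)
pose F t := (Kk (k' t) (z 0 \- z' 0) \+ (G' t \- G t)) \+ kc k' dv t.
have mw := memB bW2 mz0 mz'0.
have kcm kx vx : C0 W1 T kx -> Bint W2 I vx -> forall t, t \in `[0, T] -> fmem X (kc kx vx t).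
  by move=> c B t tT; exact: (kconv_mem hR12 p1 T0 C0' Kop Ksub c B tT).
have mK t w : t \in `[0, T] -> fmem W2 w -> fmem X (Kk (k' t) w).
  by move=> tT; apply: (bop_mem (Kop _ (C0_mem ck' tT))).
have mF t : t \in `[0, T] -> fmem X (F t).
  by move=> tT; apply: memD => //; [apply: memD => //; [exact: mK|apply: memB => //; [exact: mG'|exact: mG]]|exact: kcm].
pose H t := Kk (k' t) (z 0) \- (G t \- kc k v t).
(* [k'] solves the unperturbed problem at time [t] for the right-hand side [Kk (k' t) (z 0)] that it
   produces itself; subtracting the equation of [k] leaves [H]. *)
have dH t : t \in `[0, T] -> base_sol u (k' t \- k t) (H t) (g' t - g t).
  move=> tT; refine (base_sol_sub (_ : base_sol u (k' t) (Kk (k' t) (z 0)) (g' t)) (hk' t tT)).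
  have [mk mH _ kg] := hk1' t tT; rewrite -kg.
  exact (base_sol_kuint mk (mK t (z 0) tT mz0)).
have mH t : t \in `[0, T] -> fmem X (H t).
  by move=> tT; exact (memB bX (mK t (z 0) tT mz0) (memB bX (mG t tT) (kcm k v ck Bv t tT))).
have hk2 t : t \in `[0, T] -> {ae leb, forall r : R, r \in `]R1, R2[ ->
    Kk (k' t) (z' 0) r = (G' t \- kc k' v' t) r}.
  by move=> tT; have [_ _ e3 _] := hk1' t tT; exact e3.
have hmv2 : {ae leb, forall t, I t -> N2 (v' t \- v t) <= mv t} := hmv.
clearbody z v G z' v' G'.
have HF t : t \in `[0, T] -> N (H t \- (F t \- kc (fun t => k' t \- k t) v t)) = 0.
  move=> tT; have mkd := kcm _ _ cd Bv t tT.
  apply: (Lp_sub_ae0 hR12 p1 (mH t tT)); first by apply: memB => //; exact: mF.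
  have e1 := Lp_sub_eq0 hR12 p1 mkd (memB bX (kcm _ _ ck' Bv t tT) (kcm _ _ ck Bv t tT))
    (kconv_subl hR12 p1 T0 C0' Kop Ksub ck' ck Bv tT cd).
  have e2 := Lp_sub_eq0 hR12 p1 (kcm _ _ ck' Bdv' t tT) (memB bX (kcm _ _ ck' Bv t tT) (kcm _ _ ck' Bv' t tT))
    (kconv_subr hR12 p1 T0 C0' Kop Ksub ck' Bv Bv' Bdv' tT).
  have e3 := hk2 t tT; have e4 := kuint_sub (k' t) mz0 mz'0.
  apply: aeS2 (aeS2 (fun t h1 h2 => conj h1 h2) e1 e2) (aeS2 (fun t h1 h2 => conj h1 h2) e3 e4).
  move=> r [h1 h2] [h3 h4] rD.
  have := h1 rD; have := h2 rD; have := h3 rD; have := h4 rD.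
  by rewrite /H /F /dv /= => -> -> -> ->; apply: E6.
have w0 t : t \in `[0, T] -> 0 <= (fun=> 1) t :> R by [].
have bnd : forall t, t \in `[0, T] -> N1 (k' t \- k t) <= 2 * (delta * c2) * (fun=> 1 : R) t.
  apply: (@half_iterate R (fun t => t \in `[0, T]) (fun t => N1 (k' t \- k t)) (fun=> 1) Md) => //.
  - by rewrite mulr_ge0// ltW.
  - by move=> t tT; rewrite mulr1; exact: hMd.
  move=> M' M'0 hM' t tT; rewrite mulr1.
  have hk'M r : r \in `[0, T] -> N1 (k' r) <= M + M'.
    move=> rT; have mk := C0_mem ck rT; have mk' := C0_mem ck' rT.
    apply: (le_trans (nrm_le_sub bW1 mk' mk)); rewrite addrC lerD//; first exact: hM.
    by have := hM' r rT; rewrite mulr1.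
  have MM : 0 <= M + M' by exact: addr_ge0.
  have dl := ltW d0.
  pose A := 2 * delta + C * (Kt + 1) * (M + M') * delta.
  have A0 : 0 <= A by rewrite addr_ge0 ?mulr_ge0// addr_ge0.
  apply: (@le_trans _ _ (Q * A)).
    apply: (hQ _ H F (fun t => g' t - g t) A cd A0 dH mF HF) => // r rT.
    have N1' : N (Kk (k' r) (z 0 \- z' 0)) <= C * (M + M') * (Kt * delta).
      apply: (le_trans (bop_le (Kop _ (C0_mem ck' rT)) mw)).
      apply: ler_pM; rewrite ?mulr_ge0 ?nrm_ge0//; first by rewrite ler_wpM2l// hk'M.
      by rewrite nrmC.
    have N2' : N (kc k' dv r) <= C * (M + M') * delta.
      have hmv' : {ae leb, forall t, I t -> N2 (dv t) <= mv t}.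
        apply: aeS2 hmv2 (aeS2 (fun t h1 h2 => conj h1 h2) (Bint_mem Bv) (Bint_mem Bv')) => s h [m1 m2] sI.
        by rewrite (nrmC bW2 (m1 sI) (m2 sI)); exact: h.
      (* The weight is [omega = 0]: smallness comes here from [mv], not from the exponential. *)
      have := @kconv_le R R1 R2 p n hR12 p1 T C T0 C0' Kop Ksub k' dv ck' Bdv' mv (M + M') 0 r rT Imv mv0 hmv' MM (lexx 0).
      rewrite mul0r expR0 mulr1 => h.
      have E : (fun s => expR (- (0 * s)) * mv s) = mv by apply/funext => s; rewrite mul0r oppr0 expR0 mul1r.
      rewrite E in h; apply: (le_trans (h _)); last by rewrite ler_wpM2l// mulr_ge0.
      by move=> s sT; rewrite mul0r expR0 mulr1 hk'M.
    have m1 := mK r _ rT mw; have m2 := memB bX (mG' r rT) (mG r rT).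
    have m3 := kcm _ _ ck' Bdv' r rT.
    have h1 : N (F r) <= C * (M + M') * (Kt * delta) + delta + C * (M + M') * delta.
      apply: (le_trans (nrmD bX (memD bX m1 m2) m3)); apply: lerD => //.
      by apply: (le_trans (nrmD bX m1 m2)); apply: lerD => //; exact: hG.
    apply: (le_trans (lerD h1 (ltW (hg r rT)))).
    by rewrite le_eqVlt; apply/orP; left; apply/eqP; rewrite /A; ring.
  rewrite [leLHS](_ : _ = delta * c2 + delta * c1 * M'); last by rewrite /A /c1 /c2; ring.
  by rewrite lerD2l mulrC ler_wpM2l.
have mkk t : t \in `[0, T] -> fmem W1 (k' t \- k0 t).
  by move=> tT; apply: (C0_mem (C0_sub bW1 ck' ((is_solutionP adm k0).1 hk0).1) tT).
apply: (@le_lt_trans _ _ (eps / 2)%:E); last by rewrite lte_fin ltr_pdivrMr// ltr_pMr// ltr1n.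
apply: ge_ereal_sup => _ [t tT <-]; rewrite (nrmE bW1 (mkk t tT)) lee_fin.
have [ck0 _] := (is_solutionP adm k0).1 hk0.
have mk' := C0_mem ck' tT; have mk := C0_mem ck tT; have mk0 := C0_mem ck0 tT.
apply: (le_trans (nrm_triangle bW1 mk' mk mk0)).
rewrite (solution_uniq adm hk0 hk tT) addr0.
by apply: le_trans dc2; have := bnd t tT; rewrite mulr1.
Qed.

End problem.

Theorem theorem7p1 (R : realType) (R1 R2 T : R) (n : nat) (p : \bar R)
    (u f : R -> R -> R) (g lambda : R -> R)
    (hR1 : 0 < R1) (hR12 : R1 < R2) (hT : 0 < T)
    (hn : n = 2%N \/ n = 3%N) (hp : (1 <= p)%E)
    (hlambda : fmem (Lp R1 R2 (hoelder_conjugate p)) lambda)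
    (hlambda_int : \int[leb]_(r in `]R1, R2[) lambda r != 0)
    (hdata : admissible R1 R2 T n p lambda u f g) :
  (exists2 k : R -> R -> R,
     is_solution R1 R2 T n p lambda u f g k &
     forall k', is_solution R1 R2 T n p lambda u f g k' ->
       forall t : R, t \in `[0, T] ->
         {ae leb, forall r : R, r \in `]R1, R2[ -> k' t r = k t r}) /\
  continuous_dependence R1 R2 T n p lambda u f g.
Proof.
split; last exact: solution_depends.
have [k hk] := solution_exists hR1 hR12 hT hp hlambda hdata.
exists k => // k' hk' t tT.
have bW1 := Wlp_banach hR12 hp 1.
have mk := C0_mem (let: And3 c _ _ := hk in c) tT.
have mk' := C0_mem (let: And3 c _ _ := hk' in c) tT.
have uq := solution_uniq hR1 hR12 hT hp hlambda hdata hk hk' tT.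
apply: (Lp_sub_eq0 hR12 hp (Wlp_Lp mk') (Wlp_Lp mk)).
apply/eqP; rewrite eq_le nrm_ge0; last exact: Lp_banach.
by rewrite andbT -uq; apply: (nrm_Lp_Wlp hR12 hp); exact: memB.
Qed.
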